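(* Let $n\ge1$ and let $\lambda$ be a partition with at most $n$ parts. The $q$-difference operators $D^{-(n)}_q(t)$, $D^{(n)}_q(t_0,t_1;t)$, $D^{+(n)}_q(t_0,t_1,t_2,t_3;t)$ (defined in the context) act on the Koornwinder polynomials as follows: $$D^{-(n)}_q(t)K^{(n)}_\lambda(;q^{-1/2}t_0,q^{-1/2}t_1,q^{-1/2}t_2,q^{-1/2}t_3;q,t)=q^{-|\lambda|/2}\prod_{1\le i\le n}(1-q^{\lambda_i}t^{n-i})\,K^{(n)}_{\lambda-1^n}(;t_0,t_1,t_2,t_3;q,t),$$ $$D^{(n)}_q(t_0,t_1;t)K^{(n)}_\lambda(;q^{1/2}t_0,q^{1/2}t_1,q^{-1/2}t_2,q^{-1/2}t_3;q,t)=q^{-|\lambda|/2}\prod_{1\le i\le n}(1-q^{\lambda_i}t^{n-i}t_0t_1)\,K^{(n)}_\lambda(;t_0,t_1,t_2,t_3;q,t),$$ $$D^{+(n)}_q(t_0,t_1,t_2,t_3;t)K^{(n)}_\lambda(;q^{1/2}t_0,q^{1/2}t_1,q^{1/2}t_2,q^{1/2}t_3;q,t)=q^{-|\lambda|/2}\prod_{1\le i\le n}(1-q^{\lambda_i}t^{n-i}t_0t_1t_2t_3)\,K^{(n)}_{\lambda+1^n}(;t_0,t_1,t_2,t_3;q,t).$$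
   Context: A $BC_n$-symmetric polynomial is a Laurent polynomial in $z_1,\dots,z_n$ invariant under permutations of the variables and all substitutions $z_i\mapsto z_i^{-1}$. For a partition $\lambda$ with at most $n$ parts, $m_\lambda$ is the sum of the distinct monomials in the orbit of $\prod_i z_i^{\lambda_i}$ under this group, and $|\lambda|=\sum_i\lambda_i$; $\lambda\pm1^n=(\lambda_1\pm1,\dots,\lambda_n\pm1)$. Dominance: $\lambda$ dominates $\mu$ iff $\lambda_1+\dots+\lambda_k\ge\mu_1+\dots+\mu_k$ for all $1\le k\le n$ (sizes need not be equal). $R(z_i)$ is the operator substituting $z_i\mapsto1/z_i$, and products of operators $(1+R(z_i))$ apply to everything to their right. A square root $\sqrt q=q^{1/2}$ is fixed. For a $BC_n$-symmetric polynomial $f$: $$(D^{-(n)}_q(t)f)(z_1,\dots,z_n)=\prod_{i=1}^n(1+R(z_i))\left[\prod_{i=1}^n\frac{z_i}{1-z_i^2}\prod_{1\le i<j\le n}\frac{1-tz_iz_j}{1-z_iz_j}\,f(\sqrt q z_1,\dots,\sqrt q z_n)\right],$$ $$(D^{(n)}_q(t_0,t_1;t)f)(z_1,\dots,z_n)=\prod_{i=1}^n(1+R(z_i))\left[\prod_{i=1}^n\frac{(1-t_0z_i)(1-t_1z_i)}{1-z_i^2}\prod_{1\le i<j\le n}\frac{1-tz_iz_j}{1-z_iz_j}\,f(\sqrt q z_1,\dots,\sqrt q z_n)\right],$$ $$(D^{+(n)}_q(t_0,t_1,t_2,t_3;t)f)(z_1,\dots,z_n)=\prod_{i=1}^n(1+R(z_i))\left[\prod_{i=1}^n\frac{\prod_{r=0}^3(1-t_rz_i)}{z_i(1-z_i^2)}\prod_{1\le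 i<j\le n}\frac{1-tz_iz_j}{1-z_iz_j}\,f(\sqrt q z_1,\dots,\sqrt q z_n)\right].$$ Let $(x;q)=\prod_{j\ge0}(1-q^jx)$, $(x_1,\dots,x_k;q)=\prod_i(x_i;q)$, with a sign $\pm$ in an argument meaning the product over all choices of signs, and $$\Delta^{(n)}(z;t_0,t_1,t_2,t_3;q,t)=\prod_{1\le i\le n}\frac{(z_i^{\pm2};q)}{(t_0z_i^{\pm1},t_1z_i^{\pm1},t_2z_i^{\pm1},t_3z_i^{\pm1};q)}\prod_{1\le i<j\le n}\frac{(z_i^{\pm1}z_j^{\pm1};q)}{(tz_i^{\pm1}z_j^{\pm1};q)}.$$ The Koornwinder polynomial $K^{(n)}_\lambda(z_1,\dots,z_n;t_0,t_1,t_2,t_3;q,t)$ (written $K^{(n)}_\lambda(;t_0,t_1,t_2,t_3;q,t)$ as a function of $z$) is the unique $BC_n$-symmetric polynomial of the form $m_\lambda$ plus a linear combination of $m_\mu$ with $\mu$ strictly dominated by $\lambda$, such that $$\int K^{(n)}_\lambda\, m_\mu\,\Delta^{(n)}(z;t_0,t_1,t_2,t_3;q,t)\prod_i\frac{dz_i}{2\pi\sqrt{-1}z_i}=0$$ for every $\mu$ strictly dominated by $\lambda$. The contour is the unit torus if $|t_0|,|t_1|,|t_2|,|t_3|,|q|,|t|<1$; otherwise one uses meromorphic continuation in the parameters. Parameters are generic (so that all polynomials involved are defined). When $\lambda_n=0$ the coefficient of $K^{(n)}_{\lambda-1^n}$ vanishes (factor $i=n$) and the right-hand side of the first identity is read as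 $0$. *)

(* Defs.v *)
From HB Require Import structures.
From mathcomp Require Import all_boot all_order all_algebra perm.
From mathcomp Require Import all_classical all_reals all_analysis.
From mathcomp.real_closed Require Export complex.

Set Implicit Arguments.
Unset Strict Implicit.
Unset Printing Implicit Defensive.

Import Order.TTheory GRing.Theory Num.Theory.
Import numFieldNormedType.Exports.

Local Open Scope classical_set_scope.
Local Open Scope ring_scope.
Local Open Scope complex_scope.

(* A Laurent polynomial in n variables is represented by the function
   [('I_n -> R[i]) -> R[i]] that it defines; distinct Laurent polynomials define
   distinct functions already on the unit torus. *)

(* Partitions with at most n parts are nonincreasing functions 'I_n -> nat. *)
Definition is_partition n (lam : {ffun 'I_n -> nat}) : bool :=
  [forall i : 'I_n, forall j : 'I_n, (i <= j)%N ==> (lam j <= lam i)%N].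

Definition psize n (lam : {ffun 'I_n -> nat}) : nat := (\sum_(i < n) lam i)%N.

Definition dominates n (lam mu : {ffun 'I_n -> nat}) : bool :=
  [forall k : 'I_n,
    (\sum_(i < n | i <= k) mu i <= \sum_(i < n | i <= k) lam i)%N].

Definition sdominated n (lam mu : {ffun 'I_n -> nat}) : bool :=
  [&& is_partition mu, dominates lam mu & mu != lam].

Definition part_succ n (lam : {ffun 'I_n -> nat}) : {ffun 'I_n -> nat} :=
  [ffun i => (lam i).+1].

Definition part_pred n (lam : {ffun 'I_n -> nat}) : {ffun 'I_n -> nat} :=
  [ffun i => (lam i).-1].

Definition bc_orbit n (lam : {ffun 'I_n -> nat}) : seq {ffun 'I_n -> int} :=
  undup [seq [ffun i => (-1) ^+ (e i : bool) * (lam (s i))%:Z]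
        | e : {ffun 'I_n -> bool} <- enum {: {ffun 'I_n -> bool}},
          s : 'S_n <- enum {: 'S_n}].

Definition msym (R : realType) n (lam : {ffun 'I_n -> nat})
    (z : 'I_n -> R[i]) : R[i] :=
  \sum_(a <- bc_orbit lam) \prod_(i < n) z i ^ a i.

Definition qpoch (R : realType) (x q : R[i]) : R[i] :=
  limn (fun N : nat => \prod_(j < N) (1 - q ^+ j * x) : R[i]^o).

Definition pm (R : realType) (x : R[i]) : seq R[i] := [:: x; x^-1].

Definition koornwinder_density (R : realType) n (t0 t1 t2 t3 q t : R[i])
    (z : 'I_n -> R[i]) : R[i] :=
  (\prod_(i < n)
     ((\prod_(x <- pm (z i)) qpoch (x ^+ 2) q) /
      (\prod_(x <- pm (z i))
         (qpoch (t0 * x) q * qpoch (t1 * x) q *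
          qpoch (t2 * x) q * qpoch (t3 * x) q)))) *
  (\prod_(i < n) \prod_(j < n | (i < j)%N)
     ((\prod_(x <- pm (z i)) \prod_(y <- pm (z j)) qpoch (x * y) q) /
      (\prod_(x <- pm (z i)) \prod_(y <- pm (z j)) qpoch (t * x * y) q))).

Definition cintegral01 (R : realType) (f : R -> R[i]) : R[i] :=
  Rintegral lebesgue_measure `[0, 1] (fun x => complex.Re (f x)) +i*
  Rintegral lebesgue_measure `[0, 1] (fun x => complex.Im (f x)).

Definition cons_var (T : Type) n (x : T) (z : 'I_n -> T) : 'I_n.+1 -> T :=
  fun i => if unlift ord0 i is Some j then z j else x.

(* Integral over the unit torus against \prod_i dz_i / (2 pi sqrt(-1) z_i),
   as an iterated integral in the angles, z_i = exp (2 pi sqrt(-1) theta_i). *)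
Fixpoint torus_integral (R : realType) n :
    (('I_n -> R[i]) -> R[i]) -> R[i] :=
  match n with
  | 0 => fun F => F (fun=> 1)
  | m.+1 => fun F => cintegral01 (fun theta =>
      torus_integral (fun z : 'I_m -> R[i] =>
        F (cons_var (cos (2 * pi * theta) +i* sin (2 * pi * theta)) z)))
  end.

Definition monic_form (R : realType) n (lam : {ffun 'I_n -> nat})
    (K : ('I_n -> R[i]) -> R[i]) : Prop :=
  exists (mus : seq {ffun 'I_n -> nat}) (c : {ffun 'I_n -> nat} -> R[i]),
    all (sdominated lam) mus /\
    forall z, K z = msym lam z + \sum_(mu <- mus) c mu * msym mu z.

Definition torus_orthogonal (R : realType) n (lam : {ffun 'I_n -> nat})
    (t0 t1 t2 t3 q t : R[i]) (K : ('I_n -> R[i]) -> R[i]) : Prop :=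
  forall mu, sdominated lam mu ->
    torus_integral (fun z =>
      K z * msym mu z * koornwinder_density t0 t1 t2 t3 q t z) = 0.

(* The Koornwinder polynomial when all parameters lie in the open unit disc,
   where the contour is the unit torus. *)
Definition koornwinder_torus (R : realType) n (lam : {ffun 'I_n -> nat})
    (t0 t1 t2 t3 q t : R[i]) (K : ('I_n -> R[i]) -> R[i]) : Prop :=
  [/\ monic_form lam K,
      torus_orthogonal lam t0 t1 t2 t3 q t K &
      forall L, monic_form lam L ->
        torus_orthogonal lam t0 t1 t2 t3 q t L -> L =1 K].

(* Entire functions of k complex variables: sums of power series converging
   absolutely everywhere. *)
Definition entire (R : realType) k (F : ('I_k -> R[i]) -> R[i]) : Prop :=
  exists a : {ffun 'I_k -> nat} -> R[i],
    forall x : 'I_k -> R[i],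
      let term N (al : {ffun 'I_k -> 'I_N}) : R[i] :=
        a [ffun i => al i : nat] * \prod_(i < k) x i ^+ al i in
      (exists M : R[i], forall N, \sum_al `|@term N al| <= M) /\
      ((fun N => \sum_al @term N al) @ \oo --> (F x : R[i]^o)).

Definition params (R : realType) (t0 t1 t2 t3 q t : R[i]) : 'I_6 -> R[i] :=
  fun i => nth 0 [:: t0; t1; t2; t3; q; t] i.

(* The Koornwinder polynomial at arbitrary parameters: its coefficients are the
   values of the meromorphic functions N mu / D of the six parameters that
   continue the coefficients given by [koornwinder_torus] on the unit
   polydisc.  The condition D <> 0 expresses that the parameters are generic.
   On C^6 every meromorphic function is a quotient of entire ones. *)
Definition koornwinder (R : realType) n (lam : {ffun 'I_n -> nat})
    (t0 t1 t2 t3 q t : R[i]) (K : ('I_n -> R[i]) -> R[i]) : Prop :=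
  exists (mus : seq {ffun 'I_n -> nat})
         (N : {ffun 'I_n -> nat} -> ('I_6 -> R[i]) -> R[i])
         (D : ('I_6 -> R[i]) -> R[i]),
    let family (p : 'I_6 -> R[i]) (z : 'I_n -> R[i]) : R[i] :=
      msym lam z + \sum_(mu <- mus) N mu p / D p * msym mu z in
    [/\ all (sdominated lam) mus,
        entire D /\ (forall mu, entire (N mu)),
        (forall u0 u1 u2 u3 r v : R[i],
           let p := params u0 u1 u2 u3 r v in
           (forall i, `|p i| < 1) -> D p != 0 ->
           forall L, koornwinder_torus lam u0 u1 u2 u3 r v L -> L =1 family p),
        D (params t0 t1 t2 t3 q t) != 0 &
        K =1 family (params t0 t1 t2 t3 q t)].

Definition invert_var (R : realType) n (i : 'I_n) (z : 'I_n -> R[i]) :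
    'I_n -> R[i] :=
  fun j => if j == i then (z j)^-1 else z j.

(* The product over i of the operators 1 + R(z_i). *)
Definition symmetrize (R : realType) n (G : ('I_n -> R[i]) -> R[i]) :
    ('I_n -> R[i]) -> R[i] :=
  foldr (fun i H z => H z + H (invert_var i z)) G (enum 'I_n).

Definition cross_factor (R : realType) n (t : R[i]) (z : 'I_n -> R[i]) : R[i] :=
  \prod_(i < n) \prod_(j < n | (i < j)%N)
    ((1 - t * z i * z j) / (1 - z i * z j)).

(* In the three operators s is the chosen square root of q. *)
Definition Dminus (R : realType) n (s t : R[i]) (f : ('I_n -> R[i]) -> R[i]) :
    ('I_n -> R[i]) -> R[i] :=
  symmetrize (fun z =>
    (\prod_(i < n) (z i / (1 - z i ^+ 2))) * cross_factor t z *
    f (fun i => s * z i)).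

Definition Dzero (R : realType) n (s t0 t1 t : R[i])
    (f : ('I_n -> R[i]) -> R[i]) : ('I_n -> R[i]) -> R[i] :=
  symmetrize (fun z =>
    (\prod_(i < n) ((1 - t0 * z i) * (1 - t1 * z i) / (1 - z i ^+ 2))) *
    cross_factor t z * f (fun i => s * z i)).

Definition Dplus (R : realType) n (s t0 t1 t2 t3 t : R[i])
    (f : ('I_n -> R[i]) -> R[i]) : ('I_n -> R[i]) -> R[i] :=
  symmetrize (fun z =>
    (\prod_(i < n)
       ((1 - t0 * z i) * (1 - t1 * z i) * (1 - t2 * z i) * (1 - t3 * z i) /
        (z i * (1 - z i ^+ 2)))) *
    cross_factor t z * f (fun i => s * z i)).

(* The points where none of the denominators occurring in the operators, after
   all substitutions z_i -> 1/z_i, vanishes.  This set is Zariski dense, so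
   equality on it is equality of rational functions. *)
Definition regular (R : realType) n (z : 'I_n -> R[i]) : Prop :=
  (forall i, z i != 0 /\ z i ^+ 2 != 1) /\
  (forall i j, i != j -> z i * z j != 1 /\ z i != z j).

(* Main.v *)
Require Import Defs.
From mathcomp Require Import all_boot all_order all_algebra perm.
From mathcomp Require Import all_classical all_reals all_analysis.
From mathcomp Require Import ring lra zify.

Set Implicit Arguments.
Unset Strict Implicit.
Unset Printing Implicit Defensive.

Import Order.TTheory GRing.Theory Num.Theory.
Import numFieldNormedType.Exports.
Import Normc.
Local Open Scope ring_scope.
Local Open Scope complex_scope.

(** Why the theorem is true.

    Write [<f, g>] for the integral over the torus of [f * g] against the density
    with parameters [t0, t1, t2, t3].  All three operators symmetrize
    [prefactor(z) * f(s z)], and the substitution [z -> 1 / (s z)] carries the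
    product of prefactor and density of one operator to that of another one, for
    shifted parameters.  Hence [D^-] and [D^+] are adjoint to each other and [D]
    is adjoint to an operator of the same kind ([adjointness]).  Moreover each
    operator is triangular for the dominance order ([qdiff_expand]): with
    [d = 0, 1, 2] for [D^-, D, D^+], the image of [msym lam] only involves orbit
    sums [msym nu] with [nu + 1^n <= lam + d^n].  If [nu] is strictly below
    [lam + (d-1)^n], the adjoint operator sends [msym nu] to a combination of orbit
    sums strictly below [lam], so the image of [K_lam] is orthogonal to [msym nu].
    By uniqueness the image is a multiple of the Koornwinder polynomial of
    [lam + (d-1)^n], the multiple being the leading coefficient in
    [qdiff_expand]; and when [lam + (d-1)^n] has a negative part, the image is
    orthogonal to each of its own terms and vanishes ([qdiff_eigen],
    [qdiff_vanish]).

    Triangularity is read off after multiplication by the Weyl denominator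
    [delta] of type C, which turns the symmetrized sum into an antisymmetric
    Laurent polynomial; such a polynomial is divided by [delta] by removing its
    dominant exponents one after the other ([antisym_division]), and extreme
    coefficients are multiplicative ([leadM]).

    This argument is carried out only where [s] is real and small, [t = q ^+ k],
    and the [t_r] are [q ^+ a, - q ^+ b, s * q ^+ c, - s * q ^+ d] up to order.
    There the quotients of infinite products in the density telescope to finite
    products ([densityE]): integrals become constant terms, the change of contour
    is the invariance of the constant term under [z -> c z], and positivity says
    that the constant term of [F * star F] is a sum of squares.  These parameters
    accumulate at [0] in each variable in turn, the other ones being fixed, so an
    identity between entire functions of the parameters that holds there holds
    everywhere ([entire6_uniqueness], [continuation]). *)

(** * Constant terms as torus integrals *)

Section TrigIntegral.
Variable R : realType.
Local Notation C := R[i].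

Definition cis (x : R) : C := cos x +i* sin x.

Lemma cisD x y : cis (x + y) = cis x * cis y.
Proof.
rewrite /cis cosD sinD; apply/eqP; rewrite eq_complex /=; apply/andP; split; apply/eqP; ring.
Qed.

Lemma cis_norm x : `|cis x| = 1.
Proof. by rewrite normc_def /= cos2Dsin2 sqrtr1. Qed.

Lemma cis_neq0 x : cis x != 0.
Proof. by rewrite -normr_gt0 cis_norm ltr01. Qed.

Lemma cisXn x n : cis x ^+ n = cis (n%:R * x).
Proof.
elim: n => [|n IH]; first by rewrite expr0 mul0r /cis cos0 sin0.
by rewrite exprS IH -cisD -natr1 mulrDl mul1r addrC.
Qed.

Lemma cisXz x (m : int) : cis x ^ m = cis (m%:~R * x).
Proof.
case: m => n; first by rewrite -exprnP cisXn.
rewrite NegzE -exprnN cisXn.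
apply: (mulfI (cis_neq0 (n.+1%:R * x))); rewrite mulfV ?cis_neq0// -cisD.
by rewrite (_ : _ + _ = 0) ?/cis ?cos0 ?sin0// -mulrDl [(- _)%:~R]intrN subrr mul0r.
Qed.

Let mu := (@lebesgue_measure R).

Let has_integral01 (f : R -> R) (v : R) :=
  continuous f /\ Rintegral mu `[0, 1] f = v.

Let continuous_integrable01 (f : R -> R) :
  continuous f -> mu.-integrable `[0, 1] (EFin \o f).
Proof.
move=> cf; apply: continuous_compact_integrable; first exact: segment_compact.
exact: continuous_subspaceT.
Qed.

Let has_integral01D f g v w : has_integral01 f v -> has_integral01 g w ->
  has_integral01 (fun x => f x + g x) (v + w).
Proof.
move=> [cf <-] [cg <-]; split; first by move=> x; apply: continuousD; [exact: cf|exact: cg].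
by rewrite RintegralD//; exact: continuous_integrable01.
Qed.

Let has_integral01_trig (a b : R) (m : int) :
  has_integral01 (fun x => a * cos (m%:~R * (2 * pi * x)) + b * sin (m%:~R * (2 * pi * x)))
                 (a *+ (m == 0)).
Proof.
set f := (fun x : R => _).
have cf : continuous f.
  move=> x; rewrite /f.
  have c0 : {for x, continuous (fun x : R => m%:~R * (2 * pi * x))}.
    by apply: continuousM; [exact: cst_continuous|]; apply: continuousM; [exact: cst_continuous|].
  apply: cvgD; (apply: cvgM; first exact: cvg_cst).
    exact: (continuous_comp c0 (@continuous_cos R _)).
  exact: (continuous_comp c0 (@continuous_sin R _)).
split=> //.
have [m0|m0] := eqVneq m 0.
  rewrite (_ : f = (fun=> a)); last first.
    by apply/funext => x; rewrite /f m0 mul0r cos0 sin0 mulr1 mulr0 addr0.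
  by rewrite Rintegral_cst//= lebesgue_measure_itv/= lte_fin ltr01 -EFinB subr0 /= mulr1.
pose w : R := m%:~R * (2 * pi).
have w0 : w != 0 by rewrite !mulf_neq0 ?intr_eq0 ?pnatr_eq0 // gt_eqF ?pi_gt0.
(* An antiderivative with period 1. *)
pose F (x : R) : R := w^-1 * (a * sin (w * x) - b * cos (w * x)).
have fE x : f x = a * cos (w * x) + b * sin (w * x) by rewrite /f mulrA.
have dF (x : R) : is_derive x (1 : R) F (f x).
  rewrite fE /F; apply: is_derive_eq; rewrite /GRing.scale /=.
  by field.
rewrite /Rintegral (@continuous_FTC2 _ f F) ?ltr01//.
- rewrite -EFinB /=.
  rewrite /F mulr0 cos0 sin0 mulr1 mulr0 mulr1.
  have [-> ->] : cos w = 1 /\ sin w = 0.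
    rewrite /w; have := cisXz (2 * pi) m.
    rewrite (_ : cis (2 * pi) = 1) ?exp1rz; last first.
      rewrite /cis mulr_natl cos2pi; congr (_ +i* _).
      by rewrite -(add0r (pi *+ 2)) mulr2n addrA sinDpi sinDpi sin0 !oppr0.
    by rewrite /cis => -[<- <-].
  by rewrite mulr1 mulr0 subrr.
- exact: continuous_subspaceT.
- split; first by move=> x _; exact: ex_derive.
    by apply: cvg_at_right_filter; apply: differentiable_continuous; apply/derivable1_diffP.
  by apply: cvg_at_left_filter; apply: differentiable_continuous; apply/derivable1_diffP.
- by move=> x _; rewrite derive1E; exact: derive_val.
Qed.

Lemma cintegral01_trig (l : seq (C * int)) :
  cintegral01 (fun x => \sum_(p <- l) p.1 * cis (2 * pi * x) ^ p.2) =
  \sum_(p <- l | p.2 == 0) p.1.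
Proof.
have [HR HI] :
  has_integral01 (fun x => complex.Re (\sum_(p <- l) p.1 * cis (2 * pi * x) ^ p.2))
     (complex.Re (\sum_(p <- l | p.2 == 0) p.1)) /\
  has_integral01 (fun x => complex.Im (\sum_(p <- l) p.1 * cis (2 * pi * x) ^ p.2))
     (complex.Im (\sum_(p <- l | p.2 == 0) p.1)).
  elim: l => [|[[a b] m] l [IR II]].
    split; rewrite big_nil /=.
      have := has_integral01_trig 0 0 0; rewrite mul0rn; congr has_integral01.
      by apply/funext => x; rewrite big_nil !mul0r addr0.
    have := has_integral01_trig 0 0 0; rewrite mul0rn; congr has_integral01.
    by apply/funext => x; rewrite big_nil !mul0r addr0.
  split.
    rewrite (_ : complex.Re _ = a *+ (m == 0) + complex.Re (\sum_(p <- l | p.2 == 0) p.1)); last first.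
      by rewrite big_cons /=; case: (m == 0); case: (\sum_(p <- l | _) _) => //= c d; rewrite mulr0n add0r.
    have := has_integral01D (has_integral01_trig a (- b) m) IR; congr has_integral01.
    apply/funext => x; rewrite big_cons /= cisXz.
    by case: (\sum_(p <- l) _) => c d /=; ring.
  rewrite (_ : complex.Im _ = b *+ (m == 0) + complex.Im (\sum_(p <- l | p.2 == 0) p.1)); last first.
    by rewrite big_cons /=; case: (m == 0); case: (\sum_(p <- l | _) _) => //= c d; rewrite mulr0n add0r.
  have := has_integral01D (has_integral01_trig b a m) II; congr has_integral01.
  apply/funext => x; rewrite big_cons /= cisXz.
  by case: (\sum_(p <- l) _) => c d /=; ring.
rewrite /cintegral01 HR.2 HI.2; by case: (\sum_(p <- l | _) _).
Qed.

End TrigIntegral.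

(** * Laurent polynomials as functions *)

Lemma big_regroup (F : nzRingType) (T : eqType) (l : seq (F * T)) (G : T -> F) :
  \sum_(x <- l) x.1 * G x.2 =
  \sum_(a <- undup [seq x.2 | x <- l]) (\sum_(x <- l | x.2 == a) x.1) * G a.
Proof.
under [RHS]eq_bigr do rewrite mulr_suml big_mkcond /=.
rewrite exchange_big /= [LHS]big_seq [RHS]big_seq; apply: eq_bigr => x xl.
rewrite (bigD1_seq x.2) /= ?undup_uniq ?mem_undup ?map_f// eqxx big1_seq ?addr0//.
by move=> a /andP[ax _]; rewrite eq_sym (negPf ax).
Qed.

Section Laurent.
Variable R : realType.
Local Notation C := R[i].

Section Basic.
Variable n : nat.
Local Notation E := {ffun 'I_n -> int}.
Implicit Types (z : 'I_n -> C) (a b : E) (f g : ('I_n -> C) -> C).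

(** Off this set inverses are junk values, so Laurent polynomials are compared on
    it only. *)
Definition nonzero z := forall i, z i != 0.

Definition mono a z : C := \prod_(i < n) z i ^ a i.

Definition lval (l : seq (C * E)) z : C := \sum_(x <- l) x.1 * mono x.2 z.

Definition lcoef (l : seq (C * E)) a : C := \sum_(x <- l | x.2 == a) x.1.

(** A function that is a Laurent polynomial with exponents in [P].  Working with
    functions rather than coefficient families makes products, substitutions and
    the ring laws those of the complex numbers. *)
Definition laurent (P : pred E) f :=
  exists2 l, all (fun x => P x.2) l & forall z, nonzero z -> f z = lval l z.

(** Extracting coefficients by an integral shows that they depend on the function
    alone and not on a list representing it. *)
Definition coef f a : C := torus_integral (fun z => f z * mono (- a) z).

Lemma mono0 z : mono 0 z = 1.
Proof. by rewrite /mono big1 // => i _; rewrite ffunE expr0z. Qed.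

Lemma monoD a b z : nonzero z -> mono (a + b) z = mono a z * mono b z.
Proof.
by move=> nz; rewrite -big_split /=; apply: eq_bigr => i _; rewrite ffunE expfzDr.
Qed.

End Basic.

Lemma torus_integral_ext n (F G : ('I_n -> C) -> C) :
  (forall z, (forall i, `|z i| = 1) -> F z = G z) ->
  torus_integral F = torus_integral G.
Proof.
elim: n F G => [|n IH] F G FG /=; first by apply: FG => -[].
congr cintegral01; apply/funext => x; apply: IH => z z1; apply: FG => i.
by rewrite /cons_var; case: unliftP => [j _|_] //; exact: (cis_norm (2 * pi * x)).
Qed.

Lemma norm1_nonzero n (z : 'I_n -> C) : (forall i, `|z i| = 1) -> nonzero z.
Proof. by move=> z1 i; rewrite -normr_gt0 z1 ltr01. Qed.

(** Only the exponent 0 survives each of the iterated integrals. *)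
Lemma torus_integral_lval n (l : seq (C * {ffun 'I_n -> int})) :
  torus_integral (lval l) = lcoef l 0.
Proof.
elim: n l => [|n IH] l /=.
  rewrite /lval /lcoef [RHS]big_mkcond; apply: eq_bigr => x _.
  rewrite /mono big_ord0 mulr1 (_ : x.2 == 0) //.
  by apply/eqP/ffunP => -[].
pose tl (a : {ffun 'I_n.+1 -> int}) : {ffun 'I_n -> int} := [ffun i => a (lift ord0 i)].
have tl0 (a : {ffun 'I_n.+1 -> int}) : (a == 0) = (tl a == 0) && (a ord0 == 0).
  apply/eqP/andP => [->|[/eqP/ffunP ta /eqP a0]].
    by split; apply/eqP; rewrite ?ffunE//; apply/ffunP => i; rewrite !ffunE.
  apply/ffunP => i; rewrite ffunE; case: (unliftP ord0 i) => [j ->|-> //].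
  by have := ta j; rewrite !ffunE.
transitivity (cintegral01 (fun x : R =>
   \sum_(p <- [seq (p.1, p.2 ord0) | p : C * {ffun 'I_n.+1 -> int} <- l & tl p.2 == 0]) p.1 * cis (2 * pi * x) ^ p.2)).
  congr cintegral01; apply/funext => x.
  set e := (X in cons_var X).
  rewrite (@torus_integral_ext _ _ (lval [seq (p.1 * e ^ (p.2 ord0), tl p.2) | p : C * {ffun 'I_n.+1 -> int} <- l])).
    by rewrite IH /lcoef !big_map big_filter.
  move=> z z1; rewrite /lval big_map; apply: eq_bigr => p _ /=.
  rewrite -mulrA; congr (_ * _); rewrite /mono big_ord_recl; congr (_ * _).
    by rewrite /cons_var unlift_none.
  by apply: eq_bigr => i _; rewrite /cons_var liftK ffunE.
rewrite cintegral01_trig big_map big_filter_cond /lcoef.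
by apply: eq_bigl => p; rewrite tl0.
Qed.

Section Coef.
Variable n : nat.
Local Notation E := {ffun 'I_n -> int}.
Implicit Types (z : 'I_n -> C) (a b : E) (f g : ('I_n -> C) -> C) (P Q PQ : pred E).

Lemma torus_integral_laurent f l :
  (forall z, nonzero z -> f z = lval l z) -> torus_integral f = lcoef l 0.
Proof.
move=> fl; rewrite -torus_integral_lval; apply: torus_integral_ext => z /norm1_nonzero.
exact: fl.
Qed.

Lemma coef_lval f l a :
  (forall z, nonzero z -> f z = lval l z) -> coef f a = lcoef l a.
Proof.
move=> fl; rewrite /coef (@torus_integral_laurent _ [seq (x.1, x.2 - a) | x <- l]).
  by rewrite /lcoef big_map; apply: eq_bigl => x; rewrite subr_eq0.
move=> z nz; rewrite fl// /lval big_map mulr_suml; apply: eq_bigr => x _.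
by rewrite -mulrA -monoD.
Qed.

Lemma torus_integral_coef f : torus_integral f = coef f 0.
Proof.
by rewrite /coef; apply: torus_integral_ext => z _; rewrite oppr0 mono0 mulr1.
Qed.

Lemma eq_coef f g a : (forall z, nonzero z -> f z = g z) -> coef f a = coef g a.
Proof. by move=> fg; apply: torus_integral_ext => z /norm1_nonzero nz; rewrite fg. Qed.

Lemma coef_eq0 f a : (forall z, nonzero z -> f z = 0) -> coef f a = 0.
Proof.
by move=> f0; rewrite (@coef_lval _ [::]) ?/lcoef ?big_nil// => z nz; rewrite f0// /lval big_nil.
Qed.

Lemma laurent_coef_supp P f a : laurent P f -> coef f a != 0 -> P a.
Proof.
case=> l /allP Pl fl; rewrite (coef_lval _ fl); apply: contraNT => nPa.
by rewrite /lcoef big1_seq// => x /andP[/eqP xa /Pl]; rewrite xa (negPf nPa).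
Qed.

Lemma laurent_expand P f : laurent P f ->
  exists s : seq E, [/\ uniq s, {in s, forall a, coef f a != 0}, all P s &
     forall z, nonzero z -> f z = \sum_(a <- s) coef f a * mono a z].
Proof.
move=> Lf; have [l _ fl] := Lf.
exists [seq a <- undup [seq x.2 | x <- l] | coef f a != 0]; split.
- by rewrite filter_uniq ?undup_uniq.
- by move=> a; rewrite mem_filter => /andP[].
- by apply/allP => a; rewrite mem_filter => /andP[/(laurent_coef_supp Lf)].
move=> z nz; rewrite fl// /lval (big_regroup l (fun a => mono a z)) big_filter [RHS]big_mkcond.
apply: eq_bigr => a _; rewrite -/(lcoef l a) (coef_lval _ fl).
by case: eqP => //= ->; rewrite mul0r.
Qed.

Lemma laurent_coef0 P f : laurent P f -> (forall a, coef f a = 0) ->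
  forall z, nonzero z -> f z = 0.
Proof.
move=> /laurent_expand[s [_ _ _ fs]] f0 z nz; rewrite fs// big1// => a _.
by rewrite f0 mul0r.
Qed.

Lemma laurent_ext P f g : (forall z, nonzero z -> f z = g z) ->
  laurent P f -> laurent P g.
Proof. by move=> fg [l Pl fl]; exists l => // z nz; rewrite -fg// fl. Qed.

Lemma laurentW P Q f : (forall a, P a -> Q a) -> laurent P f -> laurent Q f.
Proof. by move=> PQ [l Pl fl]; exists l => //; apply: sub_all Pl => x; exact: PQ. Qed.

Lemma laurent_mono P c a : P a -> laurent P (fun z => c * mono a z).
Proof.
by move=> Pa; exists [:: (c, a)]; rewrite /= ?Pa// => z _; rewrite /lval big_seq1.
Qed.

Lemma coef_mono c a b : coef (fun z => c * mono a z) b = c *+ (a == b).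
Proof.
rewrite (@coef_lval _ [:: (c, a)]); last by move=> z _; rewrite /lval big_seq1.
by rewrite /lcoef big_mkcond big_seq1 /=; case: eqP.
Qed.

Lemma laurent_cst P c : P 0 -> laurent P (fun=> c).
Proof.
move=> P0; apply: laurent_ext (laurent_mono c P0) => z nz.
by rewrite mono0 mulr1.
Qed.

Lemma laurent0 P : laurent P (fun=> 0).
Proof. by exists [::] => // z _; rewrite /lval big_nil. Qed.

Lemma laurentD P f g : laurent P f -> laurent P g -> laurent P (fun z => f z + g z).
Proof.
move=> [l Pl fl] [m Pm gm]; exists (l ++ m); first by rewrite all_cat Pl.
by move=> z nz; rewrite fl// gm// /lval big_cat.
Qed.

Lemma coef_add P Q f g a : laurent P f -> laurent Q g ->
  coef (fun z => f z + g z) a = coef f a + coef g a.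
Proof.
move=> [l Pl fl] [m Pm gm]; rewrite (coef_lval _ fl) (coef_lval _ gm).
rewrite (@coef_lval _ (l ++ m)) ?/lcoef ?big_cat//.
by move=> z nz; rewrite fl// gm// /lval big_cat.
Qed.

Lemma laurentM P Q PQ f g : (forall a b, P a -> Q b -> PQ (a + b)) ->
  laurent P f -> laurent Q g -> laurent PQ (fun z => f z * g z).
Proof.
move=> H [l /allP Pl fl] [m /allP Qm gm].
exists [seq (x.1 * y.1, x.2 + y.2) | x <- l, y <- m].
  by apply/allP => _ /allpairsP[[x y] /= [xl ym ->]]; exact: H (Pl _ xl) (Qm _ ym).
move=> z nz; rewrite fl// gm// /lval big_allpairs_dep mulr_suml; apply: eq_bigr => x _ /=.
rewrite mulr_sumr; apply: eq_bigr => y _ /=.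
by rewrite monoD// mulrACA.
Qed.

Lemma laurentZ P c f : laurent P f -> laurent P (fun z => c * f z).
Proof.
move=> Lf.
have : laurent [pred a : E | a == 0] (fun z : 'I_n -> C => c) by apply: laurent_cst => /=.
by move/(laurentM _); apply; [move=> a b /eqP-> Pb; rewrite add0r; exact: Pb|exact: Lf].
Qed.

Lemma coef_mull P c f a : laurent P f -> coef (fun z => c * f z) a = c * coef f a.
Proof.
move=> [l Pl fl]; rewrite (coef_lval _ fl) (@coef_lval _ [seq (c * x.1, x.2) | x <- l]).
  by rewrite /lcoef big_map mulr_sumr.
move=> z nz; rewrite fl// /lval big_map mulr_sumr; apply: eq_bigr => x _ /=.
by rewrite mulrA.
Qed.

Lemma laurent_sum P (I : eqType) (r : seq I) (F : I -> ('I_n -> C) -> C) :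
  {in r, forall i, laurent P (F i)} -> laurent P (fun z => \sum_(i <- r) F i z).
Proof.
elim: r => [|i r IH] H.
  by apply: laurent_ext (laurent0 P) => z _; rewrite big_nil.
apply: (@laurent_ext _ (fun z => F i z + \sum_(j <- r) F j z)).
  by move=> z _; rewrite big_cons.
apply: laurentD; first by apply: H; rewrite mem_head.
by apply: IH => j jr; apply: H; rewrite inE jr orbT.
Qed.

Lemma coef_bigsum P (I : eqType) (r : seq I) (F : I -> ('I_n -> C) -> C) a :
  {in r, forall i, laurent P (F i)} ->
  coef (fun z => \sum_(i <- r) F i z) a = \sum_(i <- r) coef (F i) a.
Proof.
elim: r => [|i r IH] H.
  rewrite big_nil (@coef_lval _ [::]) ?/lcoef ?big_nil// => z _.
  by rewrite /lval !big_nil.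
have Hr : {in r, forall i, laurent P (F i)}.
  by move=> j jr; apply: H; rewrite inE jr orbT.
have Hi : laurent P (F i) by apply: H; rewrite mem_head.
rewrite big_cons -IH// -(coef_add a Hi (laurent_sum Hr)).
by apply: eq_coef => z _; rewrite big_cons.
Qed.

(** Permutations, inversions and rescalings of the variables all send each
    monomial to a multiple of a monomial; this lemma and the next one treat them
    at once. *)
Lemma laurent_subst P Q f (T : ('I_n -> C) -> ('I_n -> C)) (w : E -> C) (th : E -> E) :
  (forall z, nonzero z -> nonzero (T z)) ->
  (forall a z, nonzero z -> mono a (T z) = w a * mono (th a) z) ->
  (forall a, P a -> Q (th a)) ->
  laurent P f -> laurent Q (fun z => f (T z)).
Proof.
move=> Tnz Tm PQ [l /allP Pl fl]; exists [seq (x.1 * w x.2, th x.2) | x <- l].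
  by apply/allP => _ /mapP[x /Pl Px ->]; exact: PQ.
move=> z nz; rewrite fl; last exact: Tnz.
rewrite /lval big_map; apply: eq_bigr => x _ /=.
by rewrite Tm// mulrA.
Qed.

Lemma coef_subst P f (T : ('I_n -> C) -> ('I_n -> C)) (w : E -> C) (th : E -> E) a :
  (forall z, nonzero z -> nonzero (T z)) ->
  (forall a z, nonzero z -> mono a (T z) = w a * mono (th a) z) ->
  injective th ->
  laurent P f -> coef (fun z => f (T z)) (th a) = w a * coef f a.
Proof.
move=> Tnz Tm thI [l /allP Pl fl].
rewrite (@coef_lval _ [seq (x.1 * w x.2, th x.2) | x <- l]); last first.
  move=> z nz; rewrite fl; last exact: Tnz.
  by rewrite /lval big_map; apply: eq_bigr => x _ /=; rewrite Tm// mulrA.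
rewrite (coef_lval _ fl) /lcoef big_map mulr_sumr /=.
rewrite (eq_bigl (fun x => x.2 == a)); last by move=> x /=; rewrite (inj_eq thI).
by apply: eq_bigr => x /eqP ->; rewrite mulrC.
Qed.

End Coef.
End Laurent.

(** * Monomial substitutions, zero divisors and positivity *)

Section Substitutions.
Variables (R : realType) (n : nat).
Local Notation C := R[i].
Local Notation E := {ffun 'I_n -> int}.
Local Notation signs := {ffun 'I_n -> bool}.
Implicit Types (z : 'I_n -> C) (a b : E) (f g : ('I_n -> C) -> C) (P Q : pred E).
Implicit Types (e : signs) (s : 'S_n).

Definition flip e z : 'I_n -> C := fun i => if e i then (z i)^-1 else z i.
Definition exp_flip e a : E := [ffun i => if e i then - a i else a i].
Definition permz s z : 'I_n -> C := fun i => z (s i).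
Definition exp_perm s a : E := [ffun i => a (s i)].
Definition scalez c z : 'I_n -> C := fun i => c * z i.
Definition invz c z : 'I_n -> C := fun i => (c * z i)^-1.

Lemma flip_nonzero e z : nonzero z -> nonzero (flip e z).
Proof. by move=> nz i; rewrite /flip; case: ifP => _; rewrite ?invr_eq0. Qed.

Lemma permz_nonzero s z : nonzero z -> nonzero (permz s z).
Proof. by move=> nz i; exact: nz. Qed.

Lemma scalez_nonzero c z : c != 0 -> nonzero z -> nonzero (scalez c z).
Proof. by move=> c0 nz i; rewrite mulf_neq0. Qed.

Lemma invz_nonzero c z : c != 0 -> nonzero z -> nonzero (invz c z).
Proof. by move=> c0 nz i; rewrite invr_eq0 mulf_neq0. Qed.

Lemma mono_flip e a z : mono a (flip e z) = mono (exp_flip e a) z.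
Proof.
apply: eq_bigr => i _; rewrite /flip ffunE; case: ifP => // _.
exact: exprz_inv.
Qed.

Lemma mono_perm s a z : mono a (permz s z) = mono (exp_perm s^-1 a) z.
Proof.
rewrite /mono [RHS](reindex_inj (@perm_inj _ s)) /=; apply: eq_bigr => i _.
by rewrite /permz ffunE permK.
Qed.

Lemma mono_scale c a z :
  mono a (scalez c z) = (\prod_(i < n) c ^ a i) * mono a z.
Proof. by rewrite -big_split; apply: eq_bigr => i _; rewrite /scalez expfzMl. Qed.

Lemma mono_invz c a z :
  mono a (invz c z) = (\prod_(i < n) c ^ (- a i)) * mono (- a) z.
Proof.
rewrite -big_split; apply: eq_bigr => i _.
by rewrite /= /invz ffunE -expfzMl exprz_inv.
Qed.

Lemma exp_flipK e : involutive (exp_flip e).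
Proof. by move=> a; apply/ffunP => i; rewrite !ffunE; case: (e i); rewrite ?opprK. Qed.

Lemma exp_permK s : cancel (exp_perm s) (exp_perm s^-1).
Proof. by move=> a; apply/ffunP => i; rewrite !ffunE permKV. Qed.

Lemma coef_flip P e f a : laurent P f ->
  coef (fun z => f (flip e z)) a = coef f (exp_flip e a).
Proof.
move=> Lf; rewrite -{1}(exp_flipK e a).
rewrite (@coef_subst _ _ P _ (flip e) (fun=> 1) (exp_flip e)) ?mul1r//.
- exact: flip_nonzero.
- by move=> b z _; rewrite mono_flip mul1r.
- exact: inv_inj (exp_flipK e).
Qed.

Lemma coef_perm P s f a : laurent P f ->
  coef (fun z => f (permz s z)) a = coef f (exp_perm s a).
Proof.
move=> Lf; rewrite -{1}(exp_permK s a).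
rewrite (@coef_subst _ _ P _ (permz s) (fun=> 1) (exp_perm s^-1)) ?mul1r//.
- exact: permz_nonzero.
- by move=> b z _; rewrite mono_perm mul1r.
- by apply: (can_inj (g := exp_perm s)) => b; apply/ffunP => i; rewrite !ffunE permK.
Qed.

Lemma coef_scale P c f a : c != 0 -> laurent P f ->
  coef (fun z => f (scalez c z)) a = (\prod_(i < n) c ^ a i) * coef f a.
Proof.
move=> c0 Lf; rewrite (@coef_subst _ _ P _ (scalez c) (fun a => \prod_(i < n) c ^ a i) id)//.
- by move=> z; exact: scalez_nonzero.
- by move=> b z _; rewrite mono_scale.
Qed.

Lemma laurent_flip P Q e f : (forall a, P a -> Q (exp_flip e a)) -> laurent P f ->
  laurent Q (fun z => f (flip e z)).
Proof.
apply: (@laurent_subst _ _ _ _ _ (flip e) (fun=> 1)); first exact: flip_nonzero.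
by move=> b z _; rewrite mono_flip mul1r.
Qed.

Lemma laurent_scale P c f : c != 0 -> laurent P f ->
  laurent P (fun z => f (scalez c z)).
Proof.
move=> c0; apply: (@laurent_subst _ _ _ _ _ (scalez c) (fun a => \prod_(i < n) c ^ a i) id) => //.
- by move=> z; exact: scalez_nonzero.
- by move=> b z _; rewrite mono_scale.
Qed.

Lemma torus_integral_flip P e f : laurent P f ->
  torus_integral (fun z => f (flip e z)) = torus_integral f.
Proof.
move=> Lf; rewrite !torus_integral_coef (coef_flip _ _ Lf); congr coef.
by apply/ffunP => i; rewrite !ffunE oppr0 if_same.
Qed.

(** For Laurent polynomials the change of contour behind adjointness needs no
    complex analysis: rescaling the variables leaves the constant term alone. *)
Lemma torus_integral_invz P c f : c != 0 -> laurent P f ->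
  torus_integral (fun z => f (invz c z)) = torus_integral f.
Proof.
move=> c0 Lf; rewrite !torus_integral_coef -[X in coef _ X](@oppr0 E).
rewrite (@coef_subst _ _ P _ (invz c) (fun a => \prod_(i < n) c ^ - a i) -%R)//.
- by rewrite big1 ?mul1r// => i _; rewrite ffunE oppr0 expr0z.
- by move=> z; exact: invz_nonzero.
- by move=> b z _; rewrite mono_invz.
Qed.

(** The complex field is infinite. *)
Lemma poly_nonroot (p : {poly C}) : p != 0 -> exists x, p.[x] != 0.
Proof.
move=> p0; apply: contrapT => H0.
have H x : p.[x] = 0 by apply/eqP; apply: contraT => px; case: H0; exists x.
(* One root more than the degree allows. *)
pose rs : seq C := [seq k%:R | k <- iota 0 (size p)].
have := @max_poly_roots _ p rs p0; rewrite size_map size_iota ltnn.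
move=> F; suff : false by []; apply: F.
  by apply/allP => x _; rewrite /root H.
rewrite map_inj_uniq ?iota_uniq//; move=> i j /eqP; rewrite eqr_nat => /eqP; exact.
Qed.

(** On a line, a Laurent polynomial times a power of the product of the
    coordinates is a polynomial. *)
Lemma laurent_line P f (u v : 'I_n -> C) : laurent P f ->
  exists (p : {poly C}) (N : nat), forall x,
    let z := fun i => u i + x * (v i - u i) in
    nonzero z -> p.[x] = f z * (\prod_(i < n) z i) ^+ N.
Proof.
move=> [l _ fl].
(* A power large enough to clear all negative exponents. *)
pose N := (\sum_(x <- l) \sum_(i < n) `|x.2 i|)%N.
have NP x i : x \in l -> 0 <= x.2 i + N%:Z.
  move=> xl; have : (`|x.2 i| <= N)%N.
    rewrite /N (big_rem x)//= (bigD1 i)//= -addnA; exact: leq_addr.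
  by clearbody N => H; lia.
exists (\sum_(x <- l) x.1 *: \prod_(i < n) ((u i)%:P + (v i - u i) *: 'X) ^+ `|x.2 i + N%:Z|).
exists N => x z nz; rewrite fl// /lval mulr_suml horner_sum [LHS]big_seq [RHS]big_seq.
apply: eq_bigr => y yl; rewrite hornerZ -mulrA; congr (_ * _).
rewrite horner_prod /mono -prodrXl -big_split /=; apply: eq_bigr => i _.
rewrite horner_exp !hornerE [X in _ + X]mulrC -/(z i) [LHS]exprnP.
by rewrite gez0_abs ?NP// expfzDr.
Qed.

(** Restrict both functions to the complex line through a point where the first
    is nonzero and a point where the second is: on that line they become nonzero
    polynomials in one variable. *)
Lemma laurent_mul_neq0 P Q f g u v : laurent P f -> laurent Q g ->
  nonzero u -> nonzero v -> f u != 0 -> g v != 0 ->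
  exists z, [/\ nonzero z, f z != 0 & g z != 0].
Proof.
move=> /(laurent_line u v)[p [N pE]] /(laurent_line u v)[q [M qE]] nu nv fu gv.
pose L := \prod_(i < n) ((u i)%:P + (v i - u i) *: 'X).
have LE x : L.[x] = \prod_(i < n) (u i + x * (v i - u i)).
  by rewrite horner_prod; apply: eq_bigr => i _; rewrite !hornerE mulrC.
have line0 : (fun i => u i + 0 * (v i - u i)) = u by apply/funext => i; ring.
have line1 : (fun i => u i + 1 * (v i - u i)) = v by apply/funext => i; ring.
have prod0 w k : nonzero w -> (\prod_(i < n) w i) ^+ k != 0 :> C.
  by move=> nw; rewrite expf_neq0//; apply/prodf_neq0 => i _; exact: nw.
have p0 : p != 0.
  apply: contraTneq (prod0 _ N nu) => p0; have := pE 0; rewrite line0 p0 horner0.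
  by move=> /(_ nu)/esym/eqP; rewrite mulf_eq0 (negPf fu) /= => ->.
have q0 : q != 0.
  apply: contraTneq (prod0 _ M nv) => q0; have := qE 1; rewrite line1 q0 horner0.
  by move=> /(_ nv)/esym/eqP; rewrite mulf_eq0 (negPf gv) /= => ->.
have L0 : L != 0.
  apply: contraTneq isT => L0; have := LE 0; rewrite L0 horner0 => /esym/eqP.
  by move=> /prodf_eq0[i _]; rewrite mul0r addr0 => /eqP ui; have := nu i; rewrite ui eqxx.
have [x] : exists x, (p * q * L).[x] != 0.
  by apply: poly_nonroot; rewrite !mulf_neq0.
rewrite !hornerM !mulf_eq0 !negb_or LE => /andP[/andP[px qx] /prodf_neq0 zx].
have nz : nonzero (fun i => u i + x * (v i - u i)) by move=> i; exact: zx.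
exists (fun i => u i + x * (v i - u i)); split=> //.
  by apply: contraNneq px => /= fz; rewrite pE// fz mul0r.
by apply: contraNneq qx => /= fz; rewrite qE// fz mul0r.
Qed.

Lemma laurent_mul_eq0 P Q f g v : laurent P f -> laurent Q g -> nonzero v -> g v != 0 ->
  (forall z, nonzero z -> f z * g z = 0) -> forall z, nonzero z -> f z = 0.
Proof.
move=> Lf Lg nv gv H z nz; apply/eqP; apply: contraT => fz.
have [w [nw fw gw]] := laurent_mul_neq0 Lf Lg nz nv fz gv.
by have /eqP := H w nw; rewrite mulf_eq0 (negPf fw) (negPf gw).
Qed.

(** The Laurent polynomial that equals the complex conjugate of [f] on the unit
    torus. *)
Definition star f z : C := (f (fun i => ((z i)^*)^-1))^*.

Lemma star_lval (l : seq (C * E)) z :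
  star (lval l) z = lval [seq ((x.1)^*, - x.2) | x <- l] z.
Proof.
rewrite /star /lval big_map rmorph_sum /=; apply: eq_bigr => x _.
rewrite rmorphM /mono rmorph_prod; congr (_ * _); apply: eq_bigr => i _ /=.
by rewrite fmorphXz fmorphV /= conjcK ffunE exprz_inv.
Qed.

Lemma starP P f l : laurent P f -> (forall z, nonzero z -> f z = lval l z) ->
  forall z, nonzero z -> star f z = lval [seq ((x.1)^*, - x.2) | x <- l] z.
Proof.
move=> Lf fl z nz; rewrite -star_lval /star fl// => i.
by rewrite invr_eq0 conjc_eq0.
Qed.

(** The constant term of [f * star f] is the sum of the squared moduli of the
    coefficients of [f]. *)
Lemma torus_integral_norm P f : laurent P f ->
  torus_integral (fun z => f z * star f z) = 0 ->
  forall z, nonzero z -> f z = 0.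
Proof.
move=> Lf; have [s [us _ _ fs]] := laurent_expand Lf.
pose l := [seq (coef f a, a) | a <- s].
have fl z : nonzero z -> f z = lval l z by move=> nz; rewrite fs// /lval big_map.
rewrite (@torus_integral_laurent _ _ _
   [seq (x.1 * y.1, x.2 + y.2) | x <- l, y <- [seq ((x.1)^*, - x.2) | x <- l]]); last first.
  move=> z nz; rewrite fl// (starP Lf fl)// /lval big_allpairs_dep mulr_suml.
  apply: eq_bigr => x _ /=; rewrite mulr_sumr; apply: eq_bigr => y _ /=.
  by rewrite monoD// mulrACA.
rewrite /lcoef big_mkcond big_allpairs_dep /= big_map.
under eq_bigr do rewrite !big_map /=.
rewrite big_seq (eq_bigr (fun a => coef f a * (coef f a)^*)); last first.
  move=> a sa; rewrite (bigD1_seq a)//= subrr eqxx big1_seq ?addr0//.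
  by move=> b /andP[ba _]; rewrite subr_eq0 eq_sym (negPf ba).
rewrite -big_seq => /eqP; rewrite psumr_eq0; last by move=> a _; exact: mulcJ_ge0.
move=> /allP s0; apply: (laurent_coef0 Lf) => a.
case: (boolP (a \in s)) => [/s0/=|].
  by rewrite mulf_eq0 conjc_eq0 orbb => /eqP.
move=> nas; rewrite (coef_lval _ fl) /lcoef big_map /= big1_seq//.
by move=> b /andP[/eqP-> /(negP nas)].
Qed.

End Substitutions.

(** * Supports and extreme coefficients *)

Lemma absz_add (x y : int) : (absz (x + y)%R <= absz x + absz y)%N.
Proof. lia. Qed.

Section InitialSums.
Variable n : nat.
Local Notation E := {ffun 'I_n -> int}.
Local Notation part := {ffun 'I_n -> nat}.
Implicit Types (a b : E) (S : {set 'I_n}) (K : {set 'I_n} -> nat) (e : {ffun 'I_n -> bool}).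
Implicit Types (lam mu kap : part).

Definition init k : {set 'I_n} := [set i : 'I_n | (i < k)%N].

Lemma card_init k : (k <= n)%N -> #|init k| = k.
Proof.
move=> kn; rewrite cardsE -sum1_card.
rewrite (eq_bigl (fun i : 'I_n => (i < k)%N)) //.
by rewrite -(big_ord_widen _ (fun=> 1%N) kn) sum1_card card_ord.
Qed.

Lemma init0 : init 0 = finset.set0.
Proof. by apply/setP => i; rewrite !inE. Qed.

Lemma big_initS (T : Type) (idx : T) (op : Monoid.com_law idx) (F : 'I_n -> T) (i : 'I_n) :
  \big[op/idx]_(j in init i.+1) F j = op (F i) (\big[op/idx]_(j in init i) F j).
Proof.
rewrite (bigD1 i) ?inE ?ltnSn//=; congr (op _ _); apply: eq_bigl => j.
by rewrite !inE ltnS [RHS]ltn_neqAle andbC.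
Qed.

Lemma eq_from_init_sums (T : zmodType) (F G : 'I_n -> T) :
  (forall k, (k <= n)%N -> \sum_(j in init k) F j = \sum_(j in init k) G j) -> F =1 G.
Proof.
move=> H i; have := H i.+1 (ltn_ord i); rewrite !big_initS H; last exact: ltnW.
by move/addIr.
Qed.

Definition psum lam k : nat := (\sum_(i in init k) lam i)%N.

Lemma psum_shift lam mu d : (forall i, (mu i).+1 = lam i + d)%N ->
  forall k, (k <= n)%N -> (k + psum mu k = d * k + psum lam k)%N.
Proof.
move=> E; elim=> [|k IH] kn; first by rewrite /psum init0 !big_set0 muln0.
have := IH (ltnW kn); rewrite /psum !(big_initS _ _ (Ordinal kn)) /=.
have := E (Ordinal kn); rewrite mulnS.
by move: (\sum_(i in _) _)%N (\sum_(i in _) _)%N => X Y; lia.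
Qed.

Lemma psum_inj lam mu : (forall k, (k <= n)%N -> psum lam k = psum mu k) -> lam = mu.
Proof.
move=> H; apply/ffunP => i; have := H i.+1 (ltn_ord i); rewrite /psum !big_initS /=.
by move: (H i (ltnW (ltn_ord i))); rewrite /psum => ->; move/addIn.
Qed.

Lemma dominatesP lam mu :
  reflect (forall k, (k <= n)%N -> (psum mu k <= psum lam k)%N) (dominates lam mu).
Proof.
have E k (f : part) : (\sum_(i < n | (i <= k)%N) f i)%N = psum f k.+1.
  by apply: eq_bigl => i; rewrite inE ltnS.
apply: (iffP forallP) => [H [|k] kn|H k].
- by rewrite /psum init0 !big_set0.
- by have := H (Ordinal kn); rewrite !E.
- by rewrite !E; exact: H.
Qed.

Lemma partP lam (i j : 'I_n) : is_partition lam -> (i <= j)%N -> (lam j <= lam i)%N.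
Proof. by move=> /forallP/(_ i)/forallP/(_ j)/implyP; apply. Qed.

(** Exchange the elements of [S] outside the initial segment against those of
    the segment outside [S]: none of the former exceeds any of the latter. *)
Lemma sum_le_psum lam S : is_partition lam -> (\sum_(i in S) lam i <= psum lam #|S|)%N.
Proof.
move=> lamP; rewrite /psum; set T := init _.
have cT : #|T| = #|S| by rewrite card_init// -[X in (_ <= X)%N]card_ord max_card.
have cD : #|S :\: T| = #|T :\: S|.
  have := cardsID T S; have := cardsID S T; rewrite finset.setIC cT => <- /eqP.
  by rewrite eqn_add2l => /eqP.
rewrite (big_setID T) [X in (_ <= X)%N](big_setID S) finset.setIC /= leq_add2l.
(* [v] separates the values outside the segment from those inside. *)
pose v := (\max_(i in S :\: T) lam i)%N.
apply: (@leq_trans (#|S :\: T| * v)).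
  by rewrite -sum_nat_const; apply: leq_sum => i iS; exact: leq_bigmax_cond.
rewrite cD -sum_nat_const; apply: leq_sum => i.
rewrite !inE => /andP[_ iT]; apply/bigmax_leqP => j.
rewrite !inE -leqNgt => /andP[jT _]; apply: partP => //.
exact: leq_trans (ltnW iT) jT.
Qed.

(** The inequalities of a polytope invariant under sign changes.  The bound is a
    function of the set, and not only of its size, because the single factors of
    the Weyl denominator are not symmetric; only their product is. *)
Definition bnd K : pred E := fun a => [forall S : {set 'I_n}, (\sum_(i in S) `|a i| <= K S)%N].

Lemma bndP K a : reflect (forall S, (\sum_(i in S) `|a i| <= K S)%N) (bnd K a).
Proof. exact: forallP. Qed.

Lemma bndD K1 K2 a b : bnd K1 a -> bnd K2 b -> bnd (fun S => K1 S + K2 S)%N (a + b).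
Proof.
move=> /bndP H1 /bndP H2; apply/bndP => S; apply: leq_trans (leq_add (H1 S) (H2 S)).
by rewrite -big_split /=; apply: leq_sum => i _; rewrite ffunE; exact: absz_add.
Qed.

Lemma bndW K1 K2 a : (forall S, (K1 S <= K2 S)%N) -> bnd K1 a -> bnd K2 a.
Proof. by move=> K12 /bndP H; apply/bndP => S; exact: leq_trans (H S) (K12 S). Qed.

Lemma bnd_flip K e a : bnd K (exp_flip e a) = bnd K a.
Proof.
apply: eq_forallb => S; congr (_ <= _)%N; apply: eq_bigr => i _.
by rewrite ffunE; case: ifP; rewrite ?abszN.
Qed.

(** The successive differences of [K] along the initial segments: the vertex of
    the polytope at which the inequalities of all initial segments are tight. *)
Definition ktop K : E := [ffun i : 'I_n => (K (init i.+1))%:Z - (K (init i))%:Z].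

Lemma sum_ktop K k : (k <= n)%N ->
  \sum_(i in init k) ktop K i = (K (init k))%:Z - (K finset.set0)%:Z.
Proof.
elim: k => [|k IH] kn; first by rewrite init0 big_set0 subrr.
rewrite (big_initS _ _ (Ordinal kn)) IH ?ffunE /=; last exact: ltnW.
by rewrite addrA subrK.
Qed.

Lemma ktopD K1 K2 : ktop (fun S => K1 S + K2 S)%N = ktop K1 + ktop K2.
Proof. by apply/ffunP => i; rewrite !ffunE !PoszD opprD addrACA. Qed.

Lemma exp_flipD e a b : exp_flip e (a + b) = exp_flip e a + exp_flip e b.
Proof. by apply/ffunP => i; rewrite !ffunE; case: ifP; rewrite ?opprD. Qed.

(** A sum of two points of two polytopes can be the vertex of the sum only if both
    are the corresponding vertices, since all inequalities of initial segments
    must be tight.  This makes extreme coefficients multiplicative. *)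
Lemma bnd_tight K1 K2 e a b : K1 finset.set0 = 0%N -> K2 finset.set0 = 0%N ->
  bnd K1 a -> bnd K2 b -> a + b = exp_flip e (ktop (fun S => K1 S + K2 S)%N) ->
  a = exp_flip e (ktop K1) /\ b = exp_flip e (ktop K2).
Proof.
move=> K10 K20; rewrite -(bnd_flip K1 e) -(bnd_flip K2 e) => /bndP Ha /bndP Hb ab.
have {}ab : exp_flip e a + exp_flip e b = ktop (fun S => K1 S + K2 S)%N.
  by rewrite -exp_flipD ab exp_flipK.
have le_sum (c : E) k : (\sum_(i in init k) c i <= (\sum_(i in init k) `|c i|)%N%:Z).
  by rewrite (big_morph Posz PoszD (erefl _)); apply: ler_sum => i _; lia.
have H k : (k <= n)%N ->
   \sum_(i in init k) (exp_flip e a) i = (K1 (init k))%:Z /\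
   \sum_(i in init k) (exp_flip e b) i = (K2 (init k))%:Z.
  move=> kn; have := sum_ktop (fun S => K1 S + K2 S)%N kn; rewrite -ab K10 K20.
  under eq_bigr do rewrite ffunE.
  rewrite big_split /=.
  have := le_sum (exp_flip e a) k; have := Ha (init k).
  have := le_sum (exp_flip e b) k; have := Hb (init k).
  move: (\sum_(i in init k) (exp_flip e a) i) (\sum_(i in init k) (exp_flip e b) i) => x y.
  by move: (\sum_(i in _) _)%N (\sum_(i in _) _)%N => u v; lia.
suff [<- <-] : exp_flip e a = ktop K1 /\ exp_flip e b = ktop K2 by rewrite !exp_flipK.
split; apply/ffunP; apply: eq_from_init_sums => k kn; rewrite sum_ktop// ?K10 ?K20 subr0.
  by case: (H k kn).
by case: (H k kn).
Qed.

End InitialSums.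

Section Lead.
Variables (R : realType) (n : nat).
Local Notation C := R[i].
Local Notation E := {ffun 'I_n -> int}.
Local Notation part := {ffun 'I_n -> nat}.
Implicit Types (K : {set 'I_n} -> nat) (e : {ffun 'I_n -> bool}) (f g : ('I_n -> C) -> C).

(** [f] has its exponents in the polytope of [K], and [c] is its coefficient at
    the vertex in the orthant of signs [e].  The value 0 at the empty set keeps
    tightness additive. *)
Definition lead e K (c : C) f :=
  [/\ K finset.set0 = 0%N, laurent (bnd K) f & coef f (exp_flip e (ktop K)) = c].

Lemma lead_ext e K K' c c' f g :
  (forall S, K S = K' S) -> c = c' -> (forall z, nonzero z -> f z = g z) ->
  lead e K c f -> lead e K' c' g.
Proof.
move=> KK' -> fg [K0 Lf cf]; have -> : K' = K by apply/funext => S; rewrite KK'.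
split=> //; first exact: laurent_ext Lf.
by rewrite -(eq_coef _ fg).
Qed.

Lemma leadM e K1 K2 c1 c2 f g : lead e K1 c1 f -> lead e K2 c2 g ->
  lead e (fun S => K1 S + K2 S)%N (c1 * c2) (fun z => f z * g z).
Proof.
move=> [K10 Lf <-] [K20 Lg <-]; split; first by rewrite K10 K20.
  exact: laurentM (@bndD _ _ _) Lf Lg.
have [s [us _ sb fs]] := laurent_expand Lf; have [t [ut _ tb gt]] := laurent_expand Lg.
rewrite (@coef_lval _ _ _ [seq (coef f a * coef g b, a + b) | a <- s, b <- t]); last first.
  move=> z nz; rewrite fs// gt// /lval big_allpairs_dep mulr_suml.
  apply: eq_bigr => a _; rewrite mulr_sumr; apply: eq_bigr => b _ /=.
  by rewrite monoD// mulrACA.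
rewrite /lcoef big_mkcond big_allpairs_dep /=.
set a0 := exp_flip e (ktop K1); set b0 := exp_flip e (ktop K2).
have E0 a b : a \in s -> b \in t ->
    (a + b == exp_flip e (ktop (fun S => K1 S + K2 S)%N)) = (a == a0) && (b == b0).
  move=> /(allP sb) ha /(allP tb) hb; apply/eqP/andP => [|[/eqP-> /eqP->]].
    by move/(bnd_tight K10 K20 ha hb) => [-> ->].
  by rewrite ktopD exp_flipD.
transitivity ((\sum_(a <- s | a == a0) coef f a) * (\sum_(b <- t | b == b0) coef g b)).
  rewrite mulr_suml [RHS]big_mkcond [LHS]big_seq [RHS]big_seq; apply: eq_bigr => a ha.
  rewrite mulr_sumr [in RHS]big_mkcond [LHS]big_seq; case: ifP => [aa|naa].
    by rewrite [RHS]big_seq; apply: eq_bigr => b hb; rewrite E0// aa.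
  by rewrite big1// => b hb; rewrite E0// naa.
congr (_ * _).
  rewrite [RHS](@coef_lval _ _ _ [seq (coef f a, a) | a <- s]) ?/lcoef ?big_map//.
  by move=> z nz; rewrite fs// /lval big_map.
rewrite [RHS](@coef_lval _ _ _ [seq (coef g a, a) | a <- t]) ?/lcoef ?big_map//.
by move=> z nz; rewrite gt// /lval big_map.
Qed.

Lemma lead_prod e (I : Type) (r : seq I) (P : pred I) (K : I -> {set 'I_n} -> nat)
    (c : I -> C) (F : I -> ('I_n -> C) -> C) :
  (forall i, P i -> lead e (K i) (c i) (F i)) ->
  lead e (fun S => \sum_(i <- r | P i) K i S)%N (\prod_(i <- r | P i) c i)
    (fun z => \prod_(i <- r | P i) F i z).
Proof.
move=> H; elim: r => [|i r IH].
  have L : lead e (fun=> 0%N) 1 (fun z : 'I_n -> C => 1 * mono 0 z).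
    split=> //.
      by apply: laurent_mono; apply/bndP => S; rewrite big1// => i _; rewrite ffunE.
    rewrite coef_mono (_ : _ == _) //; apply/eqP/ffunP => i.
    by rewrite !ffunE subrr oppr0 if_same.
  apply: lead_ext L => [S||z _]; rewrite ?big_nil//.
  by rewrite mono0 mulr1.
case: (boolP (P i)) => Pi.
  apply: lead_ext (leadM (H i Pi) IH) => [S||z _]; by rewrite big_cons Pi.
by apply: lead_ext IH => [S||z _]; rewrite big_cons (negPf Pi).
Qed.

End Lead.

(** * Orbit sums *)

Section Orbits.
Variables (R : realType) (n : nat).
Local Notation C := R[i].
Local Notation E := {ffun 'I_n -> int}.
Local Notation part := {ffun 'I_n -> nat}.
Local Notation signs := {ffun 'I_n -> bool}.
Implicit Types (a b : E) (lam mu kap : part) (e : signs) (s : 'S_n) (z : 'I_n -> C).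

(** A partition as the exponent of a dominant monomial. *)
Definition exponent lam : E := [ffun i => (lam i)%:Z].

Lemma bc_orbitP lam a :
  reflect (exists e s, a = exp_flip e (exp_perm s (exponent lam))) (a \in bc_orbit lam).
Proof.
have sgnE (b : bool) (m : nat) : (-1) ^+ b * m%:Z = if b then - m%:Z else m%:Z.
  by case: b; rewrite ?mulN1r ?mul1r.
rewrite mem_undup; apply: (iffP allpairsP) => [[[e s] /= [_ _ ->]]|[e [s ->]]].
  by exists e, s; apply/ffunP => i; rewrite !ffunE sgnE.
exists (e, s); rewrite !mem_enum; split=> //=.
by apply/ffunP => i; rewrite !ffunE sgnE.
Qed.

Lemma msymE lam z : msym lam z = \sum_(a <- bc_orbit lam) mono a z.
Proof. by []. Qed.

Lemma bc_orbit_flip lam e a : (exp_flip e a \in bc_orbit lam) = (a \in bc_orbit lam).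
Proof.
suff H b : b \in bc_orbit lam -> exp_flip e b \in bc_orbit lam.
  by apply/idP/idP => [/H|/H //]; rewrite exp_flipK.
move=> /bc_orbitP[e' [s ->]]; apply/bc_orbitP.
exists [ffun i => e i (+) e' i], s; apply/ffunP => i; rewrite !ffunE.
by case: (e i); case: (e' i); rewrite ?opprK.
Qed.

Lemma bc_orbit_perm lam s a : (exp_perm s a \in bc_orbit lam) = (a \in bc_orbit lam).
Proof.
suff H b t : b \in bc_orbit lam -> exp_perm t b \in bc_orbit lam.
  by apply/idP/idP => [/(H _ (s^-1)%g)|/H //]; rewrite exp_permK.
move=> /bc_orbitP[e' [u ->]]; apply/bc_orbitP.
exists [ffun i => e' (t i)], (t * u)%g; apply/ffunP => i; rewrite !ffunE.
by rewrite permM.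
Qed.

Lemma msym_flip lam e z : msym lam (flip e z) = msym lam z.
Proof.
rewrite !msymE; under eq_bigr do rewrite mono_flip.
rewrite -(big_map (exp_flip e) xpredT (fun a => mono a z)); apply/perm_big/uniq_perm.
- by rewrite map_inj_uniq ?undup_uniq//; exact: inv_inj (exp_flipK e).
- exact: undup_uniq.
move=> a; rewrite -{1}(exp_flipK e a) mem_map; last exact: inv_inj (exp_flipK e).
exact: bc_orbit_flip.
Qed.

Lemma msym_perm lam s z : msym lam (permz s z) = msym lam z.
Proof.
rewrite !msymE; under eq_bigr do rewrite mono_perm.
rewrite -(big_map (exp_perm (s^-1)%g) xpredT (fun a => mono a z)); apply/perm_big/uniq_perm.
- rewrite map_inj_uniq ?undup_uniq//; apply: (can_inj (g := exp_perm s)) => b.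
  by apply/ffunP => i; rewrite !ffunE permK.
- exact: undup_uniq.
move=> a; rewrite -{1}(exp_permK s a) mem_map ?bc_orbit_perm//.
by apply: (can_inj (g := exp_perm s)) => b; apply/ffunP => i; rewrite !ffunE permK.
Qed.

Lemma msym_laurent (P : pred E) lam : {in bc_orbit lam, forall a, P a} ->
  laurent P (fun z : 'I_n -> C => msym lam z).
Proof.
move=> HP; apply: (@laurent_ext _ _ _ (fun z => \sum_(a <- bc_orbit lam) 1 * mono a z)).
  by move=> z _; rewrite msymE; apply: eq_bigr => a _; rewrite mul1r.
by apply: laurent_sum => a /HP; exact: laurent_mono.
Qed.

Lemma coef_msym lam a : coef (fun z : 'I_n -> C => msym lam z) a = (a \in bc_orbit lam)%:R.
Proof.
rewrite (@eq_coef _ _ _ (fun z => \sum_(b <- bc_orbit lam) 1 * mono b z)); last first.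
  by move=> z _; rewrite msymE; apply: eq_bigr => b _; rewrite mul1r.
rewrite (@coef_bigsum _ _ xpredT); last by move=> b _; exact: laurent_mono.
under eq_bigr do rewrite coef_mono.
case: (boolP (a \in _)) => al.
  rewrite (bigD1_seq a) ?undup_uniq//= eqxx big1 ?addr0// => b ba.
  by rewrite (negPf ba).
rewrite big1_seq// => b /= bl; case: eqP => // ba; by rewrite -ba bl in al.
Qed.

Definition Kpart lam (S : {set 'I_n}) : nat := psum lam #|S|.

Lemma bc_orbit_bnd lam a : is_partition lam -> a \in bc_orbit lam -> bnd (Kpart lam) a.
Proof.
move=> lamP /bc_orbitP[e [s ->]]; rewrite bnd_flip; apply/bndP => S.
rewrite /Kpart -(card_imset _ (@perm_inj _ s)); apply: leq_trans (sum_le_psum _ lamP).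
rewrite big_imset /=; last by move=> i j _ _; exact: perm_inj.
by apply: leq_sum => i _; rewrite !ffunE.
Qed.

Lemma ktop_Kpart lam : ktop (Kpart lam) = exponent lam.
Proof.
apply/ffunP => i; rewrite !ffunE /Kpart !card_init //; last exact: ltnW.
by rewrite /psum big_initS /= PoszD addrK.
Qed.

Lemma bnd_exponent K lam k : bnd K (exponent lam) -> (psum lam k <= K (init n k))%N.
Proof.
by move=> /bndP/(_ (init n k)); apply: leq_trans; apply: leq_sum => i _; rewrite ffunE.
Qed.

Lemma bnd_Kpart lam mu : bnd (Kpart lam) (exponent mu) ->
  forall k, (k <= n)%N -> (psum mu k <= psum lam k)%N.
Proof. by move=> H k kn; have := bnd_exponent k H; rewrite /Kpart card_init. Qed.

(** Each of two partitions in the same orbit bounds the partial sums of the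
    other. *)
Lemma exponent_in_orbit lam mu : is_partition lam -> is_partition mu ->
  (exponent mu \in bc_orbit lam) = (mu == lam).
Proof.
move=> lP mP; apply/idP/eqP => [mul|->]; last first.
  apply/bc_orbitP; exists [ffun=> false], 1%g.
  by apply/ffunP => i; rewrite !ffunE perm1.
have lmu : exponent lam \in bc_orbit mu.
  have /bc_orbitP[e [s /ffunP H]] := mul; apply/bc_orbitP.
  exists [ffun=> false], (s^-1)%g; apply/ffunP => i; rewrite !ffunE.
  have := H ((s^-1)%g i); rewrite !ffunE permKV.
  by move=> H1; rewrite H1; case: ifP H1 => // _; lia.
apply: psum_inj => k kn; apply/eqP; rewrite eqn_leq.
rewrite (bnd_Kpart (bc_orbit_bnd lP mul))//.
exact: bnd_Kpart (bc_orbit_bnd mP lmu) _ kn.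
Qed.

Lemma lead_msym e lam : is_partition lam ->
  lead e (Kpart lam) 1 (fun z : 'I_n -> C => msym lam z).
Proof.
move=> lP; split.
- by rewrite /Kpart cards0 /psum init0 big_set0.
- by apply: msym_laurent => a; exact: bc_orbit_bnd.
- by rewrite coef_msym ktop_Kpart bc_orbit_flip exponent_in_orbit// eqxx.
Qed.

(** Sort the absolute values of the exponents. *)
Lemma exists_partition a :
  exists kap e s, is_partition kap /\ exponent kap = exp_perm s (exp_flip e a).
Proof.
pose t : n.-tuple nat := [tuple `|a i|%N | i < n].
pose st := sort_tuple geq t.
have /tuple_permP[s ss] : perm_eq st t by rewrite perm_sort.
exists [ffun i => tnth st i], [ffun i => (a i < 0)], s; split.
  apply/forallP => i; apply/forallP => j; apply/implyP => ij; rewrite !ffunE.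
  rewrite !(tnth_nth 0%N) /=; apply: (sorted_leq_nth (leT := geq)) => //.
  - by move=> x y z /= yx zy; exact: leq_trans zy yx.
  - by move=> x /=.
  - by apply: (@sort_sorted _ geq) => x y; exact: leq_total.
  - by rewrite inE size_sort size_map size_enum_ord.
  - by rewrite inE size_sort size_map size_enum_ord.
apply/ffunP => i; rewrite !ffunE (tnth_nth 0%N) ss -tnth_nth !tnth_mktuple.
by case: ltP => H; lia.
Qed.

Definition bounded_ffuns (N : nat) : seq part :=
  [seq [ffun i => nat_of_ord (x i)] | x : {ffun 'I_n -> 'I_N.+1} <- enum {: {ffun 'I_n -> 'I_N.+1}}].

Lemma bounded_ffuns_uniq N : uniq (bounded_ffuns N).
Proof.
rewrite map_inj_uniq ?enum_uniq// => x y /ffunP xy; apply/ffunP => i.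
by have := xy i; rewrite !ffunE => /val_inj.
Qed.

Lemma mem_bounded_ffuns N lam : (forall i, (lam i <= N)%N) -> lam \in bounded_ffuns N.
Proof.
move=> H; apply/mapP; exists [ffun i => inord (lam i)]; rewrite ?mem_enum//.
by apply/ffunP => i; rewrite !ffunE inordK// ltnS.
Qed.

Lemma psum_ge lam (i : 'I_n) : (lam i <= psum lam n)%N.
Proof. by rewrite /psum (bigD1 i) ?inE//= leq_addr. Qed.

Lemma bounded_support K lam : bnd K (exponent lam) -> lam \in bounded_ffuns (K finset.setT).
Proof.
move=> H; apply: mem_bounded_ffuns => i; apply: leq_trans (psum_ge lam i) _.
have := bnd_exponent n H; congr (_ <= K _)%N; by apply/setP => j; rewrite !inE ltn_ord.
Qed.

End Orbits.

(** * Antisymmetric Laurent polynomials and the Weyl denominator *)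

Lemma crossb_arith (n m X : nat) : (m <= n)%N ->
  (X + (m + X) = m * n + (n - m) * m)%N -> (m * (n.*2.-1 - m) = X.*2)%N.
Proof.
case: m => [|m] mn; first by lia.
have [r ->] : exists r, n = (m.+1 + r)%N by exists (n - m.+1)%N; lia.
have -> : (m.+1 + r - m.+1 = r)%N by lia.
have -> : ((m.+1 + r).*2.-1 - m.+1 = m + r + r)%N by lia.
by lia.
Qed.

Lemma crossb_step_arith (n i : nat) : (i < n)%N ->
  (i.+1 * (n.*2.-1 - i.+1) = (n - i.+1).*2 + i * (n.*2.-1 - i))%N.
Proof.
move=> lin; have [m ->] : exists m, n = (i + m.+1)%N by exists (n - i).-1; lia.
have -> : ((i + m.+1).*2.-1 - i.+1 = i + m + m)%N by lia.
have -> : ((i + m.+1).*2.-1 - i = i + m + m.+1)%N by lia.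
have -> : (i + m.+1 - i.+1 = m)%N by lia.
by lia.
Qed.

Section Antisymmetric.
Variables (R : realType) (n : nat).
Local Notation C := R[i].
Local Notation E := {ffun 'I_n -> int}.
Local Notation part := {ffun 'I_n -> nat}.
Local Notation signs := {ffun 'I_n -> bool}.
Implicit Types (a b : E) (lam mu kap : part) (e : signs) (s : 'S_n) (z : 'I_n -> C).

Definition sgn e : C := \prod_(i < n) (-1) ^+ (e i).

(** Alternating under the hyperoctahedral group, generated here by the sign changes
    and the permutations of the variables. *)
Definition antisym (A : ('I_n -> C) -> C) :=
  (forall e z, nonzero z -> A (flip e z) = sgn e * A z) /\
  (forall s z, nonzero z -> A (permz s z) = (-1) ^+ (odd_perm s) * A z).

Lemma sgn_sq e : sgn e * sgn e = 1.
Proof. by rewrite /sgn -big_split /= big1// => i _; rewrite -expr2 sqrr_sign. Qed.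

Definition vdm (y : 'I_n -> C) : C := \prod_(i < n) \prod_(j < n | (i < j)%N) (y i - y j).

(** The product is a Vandermonde determinant, whose columns get permuted. *)
Lemma vdm_perm s y : vdm (permz s y) = (-1) ^+ (odd_perm s) * vdm y.
Proof.
have E (x : 'I_n -> C) : vdm x = \det (Vandermonde n (\row_i (- x i))).
  rewrite det_Vandermonde; apply: eq_bigr => i _; apply: eq_bigr => j _.
  by rewrite !mxE opprK addrC.
rewrite !E; have -> : Vandermonde n (\row_i - permz s y i) = col_perm s (Vandermonde n (\row_i - y i)).
  by apply/matrixP => i j; rewrite !mxE.
by rewrite col_permE det_mulmx det_perm odd_permV mulrC.
Qed.

(** The Weyl denominator of type C, up to sign. *)
Definition delta z : C :=
  (\prod_(i < n) ((z i)^-1 - z i)) * vdm (fun i => z i + (z i)^-1).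

Lemma delta_antisym : antisym delta.
Proof.
split=> [e z _|s z _].
  rewrite /delta mulrA; congr (_ * _).
    rewrite /sgn -big_split; apply: eq_bigr => i _ /=.
    by rewrite /flip; case: (e i); rewrite ?invrK ?expr0 ?mul1r// expr1 mulN1r opprB.
  congr vdm; apply/funext => i; rewrite /flip; case: (e i) => //.
  by rewrite invrK addrC.
rewrite /delta (_ : \prod_(i < n) _ = \prod_(i < n) ((z i)^-1 - z i)); last first.
  by rewrite [RHS](reindex_inj (@perm_inj _ s)).
by rewrite -[X in _ * vdm X]/(permz s (fun i => z i + (z i)^-1)) vdm_perm mulrCA.
Qed.

Definition Kpt (i : 'I_n) (S : {set 'I_n}) : nat := (i \in S).
Definition Kpair (i j : 'I_n) (S : {set 'I_n}) : nat := (i \in S) || (j \in S).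
(** The bound for a product over all pairs [i < j] of factors with exponents
    among the unit vectors at [i] and [j] and their opposites. *)
Definition Kcross (S : {set 'I_n}) : nat := (\sum_(i < n) \sum_(j < n | (i < j)%N) Kpair i j S)%N.

(** The number of pairs of indices that meet a given set of size [k]. *)
Definition crossb (k : nat) : nat := ((k * (n.*2.-1 - k)) ./2)%N.

(** Count ordered pairs that meet [S], with and without the diagonal. *)
Lemma KcrossE S : Kcross S = crossb #|S|.
Proof.
pose T := ~: S; pose m := #|S|.
have mn : (m <= n)%N by rewrite -[X in (_ <= X)%N]card_ord max_card.
pose f (i j : 'I_n) : nat := (i \in S) || (j \in S).
have tot : (\sum_(i < n) \sum_(j < n) f i j = m * n + (n - m) * m)%N.
  rewrite (bigID (mem S)) /=; congr (_ + _)%N.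
    rewrite (eq_bigr (fun=> n)); first by rewrite sum_nat_const.
    move=> i iS; rewrite (eq_bigr (fun=> 1%N)) ?sum1_card ?card_ord// => j _.
    by rewrite /f iS.
  rewrite (eq_bigr (fun=> m)).
    rewrite sum_nat_const; congr (_ * _)%N.
    have := cardC S; rewrite card_ord => H.
    by rewrite -[X in (X - _)%N]H addKn; apply: eq_card => i.
  move=> i niS; rewrite /m -sum1_card [RHS]big_mkcond; apply: eq_bigr => j _.
  by rewrite /f (negPf niS) /=; case: (j \in S).
have dia : (\sum_(i < n) f i i = m)%N.
  rewrite /m -sum1_card [RHS]big_mkcond; apply: eq_bigr => i _.
  by rewrite /f orbb; case: (i \in S).
have low : (\sum_(i < n) \sum_(j < n | (j < i)%N) f i j = Kcross S)%N.
  rewrite (exchange_big_dep xpredT) //=; apply: eq_bigr => i _; apply: eq_bigr => j _.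
  by rewrite /f /Kpair orbC.
have sp : (\sum_(i < n) \sum_(j < n) f i j = Kcross S + (m + Kcross S))%N.
  rewrite -{2}low -dia -!big_split /=; apply: eq_bigr => i _.
  rewrite (bigID (fun j : 'I_n => (i < j)%N)) /=; congr (_ + _)%N.
  rewrite (bigD1 i) ?ltnn//=; congr (_ + _)%N; apply: eq_bigl => j.
  by rewrite -leqNgt ltn_neqAle andbC.
rewrite sp in tot; rewrite /crossb -/m.
by rewrite (crossb_arith mn tot) doubleK.
Qed.

Lemma crossb_step (i : nat) : (i < n)%N -> (crossb i.+1 = crossb i + (n - i.+1))%N.
Proof.
move=> lin; rewrite /crossb (crossb_step_arith lin).
by rewrite halfD odd_double /= doubleK add0n addnC.
Qed.

Definition Kdelta (S : {set 'I_n}) : nat := (#|S| + crossb #|S|)%N.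

Lemma sum_Kpt S : (\sum_(i < n) Kpt i S = #|S|)%N.
Proof. by rewrite -sum1_card [RHS]big_mkcond; apply: eq_bigr => i _; rewrite /Kpt; case: (i \in S). Qed.

Lemma crossb0 : crossb 0 = 0%N. Proof. by []. Qed.

Lemma ktop_Kpt (i j : 'I_n) : ktop (Kpt i) j = (i == j)%:Z.
Proof.
rewrite ffunE /Kpt !inE; case: (ltngtP i j) => [ij|ji|/val_inj->].
- by rewrite ltnS (ltnW ij) subrr; case: eqP ij => // ->; rewrite ltnn.
- by rewrite ltnS leqNgt ji subrr; case: eqP ji => // ->; rewrite ltnn.
- by rewrite ltnSn eqxx subr0.
Qed.

Lemma ktop_Kpair (i j k : 'I_n) : (i < j)%N -> ktop (Kpair i j) k = (i == k)%:Z.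
Proof.
move=> ij; rewrite ffunE /Kpair !inE; have -> : (i == k) = (val i == val k) by [].
by rewrite /=; lia.
Qed.

End Antisymmetric.

(** * Division by the Weyl denominator *)

Section Division.
Variables (R : realType) (n : nat).
Local Notation C := R[i].
Local Notation E := {ffun 'I_n -> int}.
Local Notation part := {ffun 'I_n -> nat}.
Local Notation signs := {ffun 'I_n -> bool}.
Implicit Types (a b : E) (lam mu kap : part) (e : signs) (s : 'S_n) (z : 'I_n -> C).

Definition single (i : 'I_n) (m : int) : E := [ffun j => if j == i then m else 0].

Lemma mono_single i m z : mono (single i m) z = z i ^ m.
Proof.
rewrite /mono (bigD1 i)//= ffunE eqxx big1 ?mulr1// => j ji.
by rewrite ffunE (negPf ji).
Qed.

Lemma single_eq i j m m' : m' != 0 -> (single i m == single j m') = (i == j) && (m == m').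
Proof.
move=> m0; apply/eqP/andP => [/ffunP H|[/eqP-> /eqP->]//].
have := H j; rewrite !ffunE eqxx; have [_ -> //=|_ H1] := eqVneq j i.
by rewrite -H1 eqxx in m0.
Qed.

Lemma bnd_single (K : {set 'I_n} -> nat) i m :
  (forall S : {set 'I_n}, i \in S -> (`|m| <= K S)%N) -> bnd K (single i m).
Proof.
move=> H; apply/bndP => S; case: (boolP (i \in S)) => iS.
  rewrite (bigD1 i)//= ffunE eqxx big1 ?addn0 ?H// => j /andP[_ ji].
  by rewrite ffunE (negPf ji).
rewrite big1// => j jS; rewrite ffunE; case: eqP => // ji.
by rewrite -ji jS in iS.
Qed.

Lemma lead_single e i (d : nat) (l : seq (C * int)) : (forall p, p \in l -> (`|p.2| <= d)%N) ->
  lead e (fun S => d * Kpt i S)%N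
    (\sum_(p <- l | p.2 == (if e i then - d%:Z else d%:Z)) p.1)
    (fun z => \sum_(p <- l) p.1 * z i ^ p.2).
Proof.
move=> ld; have fl z : nonzero z -> \sum_(p <- l) p.1 * z i ^ p.2
    = lval [seq (p.1, single i p.2) | p <- l] z.
  by move=> _; rewrite /lval big_map; apply: eq_bigr => p _; rewrite mono_single.
split.
- by rewrite /Kpt inE muln0.
- exists [seq (p.1, single i p.2) | p <- l] => //.
  apply/allP => _ /mapP[p pl ->] /=; apply: bnd_single => S iS.
  by rewrite /Kpt iS muln1 ld.
rewrite (coef_lval _ fl) /lcoef big_map; apply: eq_bigl => p /=.
have -> : exp_flip e (ktop (fun S => d * Kpt i S)%N) = single i (if e i then - d%:Z else d%:Z).
  apply/ffunP => j; rewrite !ffunE !PoszM -mulrBr.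
  have := ktop_Kpt i j; rewrite ffunE => ->; rewrite eq_sym.
  by case: eqP => [->|_]; rewrite ?mulr1// mulr0 oppr0 if_same.
apply/eqP/eqP => [/ffunP/(_ i)|->//].
by rewrite !ffunE eqxx.
Qed.

(** Since [i < j], the initial segments meet the pair as soon as they contain
    [i], so the extreme monomial is [z i] or its inverse. *)
Lemma lead_pair e (i j : 'I_n) (al be ga de : C) : (i < j)%N ->
  lead e (Kpair i j) (if e i then al else be)
    (fun z => al * (z i)^-1 + be * z i + ga * (z j)^-1 + de * z j).
Proof.
move=> ij; pose l := [:: (al, single i (-1)); (be, single i 1); (ga, single j (-1)); (de, single j 1)].
have fl z : nonzero z -> al * (z i)^-1 + be * z i + ga * (z j)^-1 + de * z j = lval l z.
  by move=> _; rewrite /lval /l !big_cons big_nil /= !mono_single !exprN1 !expr1z addr0 !addrA.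
split.
- by rewrite /Kpair !inE.
- exists l => //=; rewrite andbT; apply/and4P; split; apply: bnd_single => S iS;
  by rewrite /Kpair iS ?orbT.
rewrite (coef_lval _ fl) /lcoef /l.
have -> : exp_flip e (ktop (Kpair i j)) = single i (if e i then -1 else 1).
  apply/ffunP => k; rewrite !ffunE.
  have := ktop_Kpair k ij; rewrite ffunE => ->; rewrite eq_sym.
  by case: eqP => [->|_]; rewrite ?oppr0 ?if_same.
rewrite !big_cons big_nil /= !single_eq; try by case: (e i).
rewrite eqxx (_ : j == i = false) /=; last by apply/eqP => ji; rewrite ji ltnn in ij.
by case: (e i) => /=; rewrite ?addr0 ?add0r.
Qed.

Lemma lead_cross e (c : signs -> 'I_n -> C) (F : 'I_n -> 'I_n -> ('I_n -> C) -> C) :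
  (forall i j : 'I_n, (i < j)%N -> lead e (Kpair i j) (c e i) (F i j)) ->
  lead e (fun S => crossb n #|S|) (\prod_(i < n) c e i ^+ (n - i.+1))
    (fun z => \prod_(i < n) \prod_(j < n | (i < j)%N) F i j z).
Proof.
move=> H; apply: (lead_ext (fun S => KcrossE S) _ _ (@lead_prod _ _ e _ (index_enum 'I_n) xpredT
   (fun i S => \sum_(j < n | (i < j)%N) Kpair i j S)%N
   (fun i => \prod_(j < n | (i < j)%N) c e i) _ _)) => //; last first.
  by move=> i _; apply: lead_prod => j; exact: H.
apply: eq_bigr => i _; rewrite prodr_const; congr (_ ^+ _).
have lin := ltn_ord i.
have -> : #|[pred j : 'I_n | (i < j)%N]| = #|[predC (init n i.+1)]|.
  by apply: eq_card => j; rewrite !inE -leqNgt.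
have := cardC (init n i.+1); rewrite (card_init lin) card_ord => H1.
by apply: (@addnI i.+1); rewrite subnKC.
Qed.

Lemma lead_delta e : lead e (@Kdelta n) ((-1) ^+ n * sgn R e) (@delta R n).
Proof.
apply: (@lead_ext _ _ _ (fun S => (\sum_(i < n) 1 * Kpt i S) + crossb n #|S|)%N _
   ((\prod_(i < n) (if e i then 1 else -1)) * \prod_(i < n) 1 ^+ (n - i.+1)) _
   (fun z => (\prod_(i < n) (\sum_(p <- [:: (1, -1); (-1, 1)]) p.1 * z i ^ p.2)) *
             \prod_(i < n) \prod_(j < n | (i < j)%N)
                (1 * (z i)^-1 + 1 * z i + (-1) * (z j)^-1 + (-1) * z j))).
- move=> S; rewrite /Kdelta; congr (_ + _)%N; rewrite -[RHS]sum_Kpt.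
  by apply: eq_bigr => i _; rewrite mul1n.
- rewrite [X in _ * X]big1 ?mulr1; last by move=> i _; rewrite expr1n.
  have -> : (-1) ^+ n = \prod_(i < n) (-1) :> C by rewrite prodr_const card_ord.
  rewrite /sgn -big_split /=; apply: eq_bigr => i _.
  by case: (e i); rewrite ?expr0 ?expr1 ?mulr1 ?mulrNN ?mulr1.
- move=> z _; rewrite /delta; congr (_ * _).
    apply: eq_bigr => i _; rewrite !big_cons big_nil /= exprN1 expr1z; ring.
  apply: eq_bigr => i _; apply: eq_bigr => j _; ring.
apply: leadM.
  apply: lead_prod => i _.
  have H (p : C * int) : p \in [:: (1, -1); (-1, 1)] -> (`|p.2| <= 1)%N.
    by rewrite !inE => /orP[/eqP->|/eqP->].
  apply: lead_ext (lead_single e i H) => //.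
  by rewrite !big_cons big_nil /=; case: (e i) => /=; rewrite addr0.
apply: (@lead_cross e (fun _ _ => 1)) => i j ij.
apply: lead_ext (lead_pair e 1 1 (-1) (-1) ij) => //.
by rewrite if_same.
Qed.

Lemma delta_laurent : laurent (bnd (@Kdelta n)) (@delta R n).
Proof. by have [] := lead_delta [ffun=> false]. Qed.

Definition staircase : part := [ffun i : 'I_n => (n - i)%N].

Lemma antisym_coef_perm P (A : ('I_n -> C) -> C) s a : laurent P A -> antisym A ->
  coef A (exp_perm s a) = (-1) ^+ (odd_perm s) * coef A a.
Proof.
move=> LA [_ HA]; rewrite -(coef_perm _ _ LA) -(coef_mull _ _ LA).
by apply: eq_coef => z nz; exact: HA.
Qed.

Lemma antisym_coef_flip P (A : ('I_n -> C) -> C) e a : laurent P A -> antisym A ->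
  coef A (exp_flip e a) = sgn R e * coef A a.
Proof.
move=> LA [HA _]; rewrite -(coef_flip _ _ LA) -(coef_mull _ _ LA).
by apply: eq_coef => z nz; exact: HA.
Qed.

Lemma sgn_single (i : 'I_n) : sgn R [ffun j => j == i] = -1.
Proof.
rewrite /sgn (bigD1 i)//= ffunE eqxx expr1 big1 ?mulr1// => j ji.
by rewrite ffunE (negPf ji) expr0.
Qed.

Lemma eqN1M0 (x : C) : x = -1 * x -> x = 0.
Proof.
move=> H; have : 2 * x = 0 by rewrite mulr_natl mulr2n {1}H; ring.
by move/eqP; rewrite mulf_eq0 pnatr_eq0 => /eqP.
Qed.

(** If a part of [kap] is 0, or two parts are equal, then a sign change or a
    transposition fixes the exponent but changes the sign of the coefficient. *)
Lemma antisym_staircase P (A : ('I_n -> C) -> C) kap : laurent P A -> antisym A ->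
  is_partition kap -> coef A (exponent kap) != 0 ->
  exists2 mu, is_partition mu & kap = [ffun i => staircase i + mu i]%N.
Proof.
move=> LA aA kP ck.
have kpos i : (0 < kap i)%N.
  rewrite lt0n; apply: contra_neq ck => ki; apply: eqN1M0.
  rewrite -(sgn_single i) -(antisym_coef_flip _ _ LA aA); congr coef.
  by apply/ffunP => j; rewrite !ffunE; case: eqP => // ->; rewrite ki.
have kstr (i j : 'I_n) : (i < j)%N -> (kap j < kap i)%N.
  move=> ij; rewrite ltn_neqAle (partP kP (ltnW ij)) andbT.
  apply: contra_neq ck => kij; apply: eqN1M0.
  have nij : i != j by apply/eqP => eij; rewrite eij ltnn in ij.
  have := antisym_coef_perm (tperm i j) (exponent kap) LA aA; rewrite odd_tperm nij expr1 => <-.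
  congr coef; apply/ffunP => k; rewrite !ffunE; case: tpermP => // ->.
    by rewrite kij.
  by rewrite kij.
have kdiff d (i j : 'I_n) : (i + d = j)%N -> (kap j + d <= kap i)%N.
  elim: d i => [|d IH] i; first by rewrite addn0 => /val_inj->; rewrite addn0.
  move=> idj; have li : (i.+1 < n)%N by have := ltn_ord j; lia.
  have := IH (Ordinal li); rewrite /= addSnnS => /(_ idj).
  have := kstr i (Ordinal li) (ltnSn _); lia.
have kge (i : 'I_n) : (n - i <= kap i)%N.
  have ln : (n.-1 < n)%N by have := ltn_ord i; lia.
  have := kdiff (n.-1 - i)%N i (Ordinal ln); have := kpos (Ordinal ln).
  have := ltn_ord i => /= li H1 H2.
  have : (i + (n.-1 - i) = n.-1)%N by lia.
  by move/H2; lia.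
exists [ffun i => (kap i - (n - i))%N].
  apply/forallP => i; apply/forallP => j; apply/implyP => ij; rewrite !ffunE.
  have := kdiff (j - i)%N i j; rewrite subnKC// => /(_ erefl).
  have := kge i; have := kge j; have := ltn_ord j; lia.
by apply/ffunP => i; rewrite !ffunE subnKC.
Qed.

Lemma psumD lam mu k : psum [ffun i => lam i + mu i]%N k = (psum lam k + psum mu k)%N.
Proof. by rewrite /psum -big_split; apply: eq_bigr => i _; rewrite ffunE. Qed.

Lemma psum_staircase k : (k <= n)%N -> psum staircase k = (k + crossb n k)%N.
Proof.
elim: k => [|k IH] kn; first by rewrite /psum init0 big_set0 crossb0.
rewrite /psum (big_initS _ _ (Ordinal kn)) /= -/(psum staircase k) IH; last exact: ltnW.
by rewrite ffunE crossb_step//=; lia.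
Qed.

Lemma card_le_n (S : {set 'I_n}) : (#|S| <= n)%N.
Proof. by rewrite -[X in (_ <= X)%N]card_ord max_card. Qed.

Lemma lead_delta_msym mu : is_partition mu ->
  lead [ffun=> false] (fun S => psum [ffun i => staircase i + mu i]%N #|S|)
    ((-1) ^+ n) (fun z : 'I_n -> C => delta z * msym mu z).
Proof.
move=> mP; apply: lead_ext (leadM (lead_delta _) (lead_msym R _ mP)) => //.
  by move=> S; rewrite psumD psum_staircase// card_le_n.
rewrite mulr1 /sgn big1 ?mulr1// => i _; by rewrite ffunE expr0.
Qed.

(** The sum of all partial sums; it is strictly monotone for dominance and turns
    that partial order into an induction parameter. *)
Definition height kap : nat := (\sum_(k < n.+1) psum kap k)%N.

Lemma height_mono kap nu : (forall k, (k <= n)%N -> (psum kap k <= psum nu k)%N) ->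
  (height kap <= height nu)%N.
Proof. by move=> H; apply: leq_sum => k _; apply: H; rewrite -ltnS. Qed.

Lemma height_eq kap nu : (forall k, (k <= n)%N -> (psum kap k <= psum nu k)%N) ->
  height nu = height kap -> kap = nu.
Proof.
move=> H; rewrite /height => /eqP; rewrite eq_sym.
have /leqif_sum : forall k : 'I_n.+1, true -> (psum kap k <= psum nu k ?= iff (psum kap k == psum nu k))%N.
  by move=> k _; split=> //; apply: H; rewrite -ltnS.
move=> [_ ->] /forallP Heq; apply: psum_inj => k kn.
by have /eqP := Heq (Ordinal (kn : (k < n.+1)%N)).
Qed.

(** The products [delta * msym mu] are unitriangular, up to a global sign, with
    respect to the height of dominant exponents. *)
Lemma delta_msym_coef mu kap : is_partition mu -> is_partition kap ->
  let nu := [ffun i => staircase i + mu i]%N in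
  (height nu <= height kap)%N ->
  coef (fun z : 'I_n -> C => delta z * msym mu z) (exponent kap) = (-1) ^+ n *+ (kap == nu).
Proof.
move=> mP kP nu hk; have [K0 L c] := lead_delta_msym mP.
have -> : (-1) ^+ n = coef (fun z : 'I_n -> C => delta z * msym mu z) (exponent nu).
  rewrite -c; congr coef; apply/ffunP => i; rewrite !ffunE.
  rewrite !card_init ?ltnS//; last exact: ltnW.
  by rewrite /psum big_initS /= PoszD addrK !ffunE.
have [->//|nk] := eqVneq kap nu; rewrite mulr0n.
apply/eqP; apply: contraT => /(laurent_coef_supp L) bk.
have H k : (k <= n)%N -> (psum kap k <= psum nu k)%N.
  by move=> kn; have := bnd_exponent k bk; rewrite card_init.
case/eqP: nk; apply: height_eq => //; apply/eqP; rewrite eqn_leq hk.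
exact: height_mono.
Qed.

(** By [delta_msym_coef], subtracting multiples of [delta * msym mu] removes the
    dominant exponents of greatest height; induction on the height empties the
    support, because every exponent is conjugate to a dominant one. *)
Lemma antisym_division (K : nat -> nat) (A : ('I_n -> C) -> C) :
  laurent (bnd (fun S : {set 'I_n} => K #|S|)) A -> antisym A ->
  exists l : seq (C * part),
    (forall x, x \in l -> is_partition x.2 /\
       forall k, (k <= n)%N -> (k + crossb n k + psum x.2 k <= K k)%N) /\
    forall z, nonzero z -> A z = delta z * \sum_(x <- l) x.1 * msym x.2 z.
Proof.
move=> LA aA.
pose M := (\sum_(kap <- bounded_ffuns n (K n)) (height kap).+1)%N.
have bsup kap (B : ('I_n -> C) -> C) : laurent (bnd (fun S : {set 'I_n} => K #|S|)) B ->
   coef B (exponent kap) != 0 -> kap \in bounded_ffuns n (K n).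
  by move=> LB /(laurent_coef_supp LB) /bounded_support; rewrite cardsT card_ord.
have hM kap : is_partition kap -> coef A (exponent kap) != 0 -> (height kap < M)%N.
  move=> _ /(bsup _ _ LA) kin; rewrite /M (big_rem kap)//=; exact: leq_addr.
move: M hM => M; elim: M A LA aA => [|M IH] A LA aA hM.
  exists [::]; split=> // z nz; rewrite big_nil mulr0; apply: (laurent_coef0 LA) nz => a.
  have [kap [e [s [kP ka]]]] := exists_partition a.
  have H0 : coef A (exponent kap) = 0 by apply/eqP; apply: contraT => /(hM _ kP).
  move: H0; rewrite ka (antisym_coef_perm _ _ LA aA) (antisym_coef_flip _ _ LA aA).
  move=> /eqP; rewrite mulrA mulf_eq0 mulf_eq0 signr_eq0 /= => /orP[|/eqP//].
  by move=> /eqP s0; have := sgn_sq R e; rewrite s0 mul0r => /esym/eqP; rewrite oner_eq0.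
pose ks := [seq kap <- undup (bounded_ffuns n (K n)) | [&& is_partition kap, coef A (exponent kap) != 0 & height kap == M]].
pose sub kap : part := [ffun i => (kap i - staircase i)%N].
have ksP kap : kap \in ks -> [/\ is_partition (sub kap), kap = [ffun i => staircase i + sub kap i]%N,
    is_partition kap, coef A (exponent kap) != 0 & height kap = M].
  rewrite mem_filter => /andP[/and3P[kP ck /eqP hk] _].
  have [mu mP kE] := antisym_staircase LA aA kP ck.
  have -> : sub kap = mu by apply/ffunP => i; rewrite /sub kE !ffunE addKn.
  by split=> //; rewrite kE.
pose l0 := [seq ((-1) ^+ n * coef A (exponent kap), sub kap) | kap <- ks].
pose A' z := A z - delta z * \sum_(x <- l0) x.1 * msym x.2 z.
have kapK kap : kap \in ks -> forall k, (k <= n)%N -> (psum kap k <= K k)%N.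
  move=> /ksP[_ _ _ /(laurent_coef_supp LA) bk _] k kn.
  by have := bnd_exponent k bk; rewrite card_init.
have LT kap : kap \in ks -> laurent (bnd (fun S : {set 'I_n} => K #|S|))
    (fun z => - ((-1) ^+ n * coef A (exponent kap)) * (delta z * msym (sub kap) z)).
  move=> kin; have [sP kE _ _ _] := ksP _ kin; apply: laurentZ.
  have [_ L _] := lead_delta_msym sP.
  apply: laurentW L => a; apply: bndW => S; rewrite -kE.
  by apply: kapK => //; exact: card_le_n.
have A'E z : A' z = A z + \sum_(kap <- ks) - ((-1) ^+ n * coef A (exponent kap)) * (delta z * msym (sub kap) z).
  rewrite /A' mulr_sumr -sumrN /l0 big_map; congr (_ + _); apply: eq_bigr => kap _ /=.
  by rewrite mulNr mulrCA.
have LS : laurent (bnd (fun S : {set 'I_n} => K #|S|))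
   (fun z => \sum_(kap <- ks) - ((-1) ^+ n * coef A (exponent kap)) * (delta z * msym (sub kap) z)).
  exact: laurent_sum.
have LA' : laurent (bnd (fun S : {set 'I_n} => K #|S|)) A'.
  by apply: laurent_ext (laurentD LA LS) => z _; rewrite A'E.
have aA' : antisym A'.
  have [A1 A2] := aA; have [d1 d2] := @delta_antisym R n.
  split=> [e z nz|s z nz]; rewrite /A'.
    rewrite A1// d1// -mulrA -mulrBr; congr (_ * (_ - _ * _)).
    by apply: eq_bigr => x _; rewrite msym_flip.
  rewrite A2// d2// -mulrA -mulrBr; congr (_ * (_ - _ * _)).
  by apply: eq_bigr => x _; rewrite msym_perm.
have cA' kap : is_partition kap -> (M <= height kap)%N -> coef A' (exponent kap) = 0.
  move=> kP hk.
  rewrite (eq_coef _ (fun z _ => A'E z)) (coef_add _ LA LS) (coef_bigsum _ LT).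
  transitivity (coef A (exponent kap) - \sum_(kap' <- ks) coef A (exponent kap') *+ (kap == kap')).
    congr (_ + _); rewrite -sumrN !big_seq; apply: eq_bigr => kap' k'in.
    have [sP kE k'P ck' hk'] := ksP _ k'in.
    have [_ L _] := lead_delta_msym sP.
    rewrite (coef_mull _ _ L) delta_msym_coef// -kE ?hk'//.
    rewrite mulrnAr mulNr mulrAC -expr2 sqrr_sign mul1r mulNrn; by case: (_ == _).
  case: (boolP (kap \in ks)) => kin.
    rewrite (bigD1_seq kap)//= ?filter_uniq ?undup_uniq// eqxx big1 ?addr0 ?subrr// => k' kk'.
    by rewrite eq_sym (negPf kk').
  rewrite big1_seq ?subr0; last first.
    by move=> k' /= k'in; case: eqP => // kk'; rewrite kk' k'in in kin.
  apply/eqP; apply: contraT => ck; case/negP: kin.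
  rewrite mem_filter kP ck mem_undup (bsup _ _ LA)// andbT /=.
  by rewrite eqn_leq hk andbT -ltnS hM.
have [l1 [l1P l1E]] : exists l : seq (C * part),
    (forall x, x \in l -> is_partition x.2 /\
       forall k, (k <= n)%N -> (k + crossb n k + psum x.2 k <= K k)%N) /\
    forall z, nonzero z -> A' z = delta z * \sum_(x <- l) x.1 * msym x.2 z.
  apply: IH => // kap kP; apply: contraNT; rewrite -leqNgt => hk.
  by rewrite cA'.
exists (l0 ++ l1); split.
  move=> x; rewrite mem_cat => /orP[|/l1P//].
  move=> /mapP[kap kin ->] /=; have [sP kE _ _ _] := ksP _ kin; split=> // k kn.
  by have := kapK _ kin k kn; rewrite {1}kE psumD psum_staircase.
move=> z nz; rewrite big_cat /= mulrDr -l1E// /A'.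
by rewrite addrC subrK.
Qed.

End Division.

(** * Triangularity of the q-difference operators *)

Section Operators.
Variables (R : realType) (n : nat).
Local Notation C := R[i].
Local Notation E := {ffun 'I_n -> int}.
Local Notation part := {ffun 'I_n -> nat}.
Local Notation signs := {ffun 'I_n -> bool}.
Implicit Types (a b : E) (lam mu kap : part) (e : signs) (z : 'I_n -> C).

Lemma symmetrizeE (G : ('I_n -> C) -> C) z :
  symmetrize G z = \sum_e G (flip e z).
Proof.
rewrite /symmetrize; suff H (r : seq 'I_n) : uniq r -> forall z,
    foldr (fun i H z => H z + H (invert_var i z)) G r z =
    \sum_(e : signs | [forall i, e i ==> (i \in r)]) G (flip e z).
  rewrite H ?enum_uniq//; apply: eq_bigl => e.
  by apply/forallP => i; rewrite mem_enum implybT.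
elim: r => [|i r IH] /=.
  move=> _ w; rewrite (big_pred1 [ffun=> false]); last first.
    move=> e; apply/forallP/eqP => [H|-> i]; last by rewrite ffunE.
    by apply/ffunP => i; have := H i; rewrite ffunE implybF => /negbTE.
  by congr G; apply/funext => i; rewrite /flip ffunE.
move=> /andP[nir ur] w; rewrite !IH// addrC.
(* Switching the sign at [i] matches the subsets of [r] with those of [i :: r]
   that contain [i]. *)
pose tog e : signs := [ffun j => if j == i then ~~ e j else e j].
have togK : involutive tog.
  by move=> e; apply/ffunP => j; rewrite !ffunE; case: eqP => //; rewrite negbK.
rewrite [RHS](bigID (fun e : signs => e i)) /=; congr (_ + _).
  rewrite [RHS](reindex_inj (inv_inj togK)) /=; apply: eq_big => e.
    rewrite ffunE eqxx; apply/forallP/andP => [H|[/forallP H ei] j].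
      have ei : ~~ e i by have := H i; rewrite (negPf nir) implybF.
      split=> //; apply/forallP => j; rewrite !ffunE inE.
      by case: eqP => _; rewrite ?implybT //=; exact: H.
    have := H j; rewrite !ffunE inE; case: eqP => //= ->.
    by rewrite (negPf ei).
  move=> /forallP/(_ i); rewrite (negPf nir) implybF => ei.
  congr G; apply/funext => j; rewrite /flip /invert_var ffunE.
  by case: eqP => // ->; rewrite ei (negPf ei).
apply: eq_bigl => e; apply/forallP/andP => [H|[/forallP H ei] j].
  split; last by have := H i; rewrite (negPf nir) implybF.
  by apply/forallP => j; have := H j; rewrite inE; case: (e j) => //= ->; rewrite orbT.
by have := H j; rewrite inE; case: eqP => //= -> _; rewrite (negPf ei).
Qed.

(** The three operators differ only in the factor [h] of each variable. *)
Definition qdiff (h : C -> C) (s t : C) (f : ('I_n -> C) -> C) : ('I_n -> C) -> C :=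
  symmetrize (fun z => (\prod_(i < n) (h (z i) / (1 - z i ^+ 2))) * cross_factor t z * f (scalez s z)).

Lemma regular_nonzero z : regular z -> nonzero z.
Proof. by move=> [H _] i; have [] := H i. Qed.

Lemma regular_flip e z : regular z -> regular (flip e z).
Proof.
move=> rz; have nz := regular_nonzero rz; have [H1 H2] := rz; split=> [i|i j ij].
  have [zi zi2] := H1 i; rewrite /flip; case: (e i) => //; rewrite invr_eq0; split=> //.
  by rewrite exprVn invr_eq1.
have [zij zij'] := H2 i j ij.
have inv_eq (x y : C) : x != 0 -> (x^-1 * y == 1) = (y == x).
  by move=> x0; rewrite -(inj_eq (mulfI x0)) mulrA mulfV// mul1r mulr1.
have eq_inv (x y : C) : y != 0 -> (x == y^-1) = (x * y == 1).
  by move=> y0; rewrite -(inj_eq (mulIf y0)) mulVf.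
rewrite /flip; case: (e i); case: (e j).
- by rewrite -invfM invr_eq1 (inj_eq (@invr_inj _)).
- by split; [rewrite inv_eq// eq_sym | rewrite eq_sym eq_inv// mulrC].
- by split; [rewrite mulrC inv_eq | rewrite eq_inv].
- by split.
Qed.

Lemma pair_delta (x y : C) : x != 0 -> y != 0 ->
  (x + x^-1) - (y + y^-1) = (1 - x * y) * (x^-1 - y^-1).
Proof. by move=> x0 y0; field; rewrite x0 y0. Qed.

Lemma delta_regular z : regular z -> delta z != 0.
Proof.
move=> rz; have nz := regular_nonzero rz; have [H1 H2] := rz.
rewrite mulf_neq0//; apply/prodf_neq0 => i _.
  have [zi zi2] := H1 i; rewrite -(inj_eq (mulfI zi)) mulr0 mulrBr mulfV//.
  by rewrite subr_eq0 eq_sym.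
apply/prodf_neq0 => j ij; rewrite pair_delta//.
have [|zij zij'] := H2 i j; first by apply/eqP => eij; rewrite eij ltnn in ij.
rewrite mulf_neq0// subr_eq0 ?(inj_eq (@invr_inj _))// eq_sym //.
Qed.

Lemma exists_regular : exists z : 'I_n -> C, regular z.
Proof.
exists (fun i => (i.+2)%:R); split=> [i|i j ij].
  by rewrite pnatr_eq0 expr2 -natrM pnatr_eq1 muln_eq1.
by rewrite -natrM pnatr_eq1 muln_eq1 eqr_nat !eqSS.
Qed.

(** The difference of the two functions is annihilated by [delta], whose
    zeros among the nonzero points are exactly those that are not regular. *)
Lemma eq_on_regular P Q (f g : ('I_n -> C) -> C) : laurent P f -> laurent Q g ->
  (forall z, regular z -> f z = g z) -> forall z, nonzero z -> f z = g z.
Proof.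
move=> Lf Lg fg z nz; have [v rv] := exists_regular.
have Lfg : laurent xpredT (fun z => f z + (-1) * g z).
  by apply: laurentD; [apply: laurentW Lf|apply/laurentZ/(laurentW _ Lg)].
apply/eqP; rewrite -subr_eq0 -mulN1r.
rewrite (laurent_mul_eq0 Lfg (@delta_laurent R n) (regular_nonzero rv) (delta_regular rv))//.
move=> w nw; have [->|dw] := eqVneq (delta w) 0; first by rewrite mulr0.
rewrite fg ?mulN1r ?subrr ?mul0r//.
have [d1 d2] : (forall i, (w i)^-1 - w i != 0) /\
    forall i j : 'I_n, (i < j)%N -> (w i + (w i)^-1) - (w j + (w j)^-1) != 0.
  move: dw; rewrite /delta mulf_eq0 negb_or => /andP[/prodf_neq0 p1 /prodf_neq0 p2].
  split=> [i|i j ij]; first exact: p1.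
  by have /prodf_neq0/(_ j ij) := p2 i isT.
have d3 (i j : 'I_n) : i != j -> (w i + (w i)^-1) - (w j + (w j)^-1) != 0.
  rewrite neq_ltn => /orP[/d2//|/d2]; by rewrite -oppr_eq0 opprB.
split=> [i|i j /d3]; last first.
  rewrite pair_delta// mulf_eq0 negb_or !subr_eq0 (inj_eq (@invr_inj _)) eq_sym.
  by case/andP.
split=> //; have := d1 i; apply: contraNneq => w2.
by rewrite subr_eq0 -(inj_eq (mulfI (nw i))) mulfV// -expr2 w2.
Qed.

Section Expansion.
Variables (h g : C -> C) (l : seq (C * int)) (d : nat) (H s t : C) (lam : part)
  (f : ('I_n -> C) -> C).
Hypothesis (hg : forall x, x != 0 -> h x = x * g x).
Hypothesis (gl : forall x, g x = \sum_(p <- l) p.1 * x ^ p.2).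
Hypothesis (ld : forall p, p \in l -> (`|p.2| <= d)%N).
Hypothesis (ltop : \sum_(p <- l | p.2 == d%:Z) p.1 = H).
Hypothesis (lbot : \sum_(p <- l | p.2 == - d%:Z) p.1 = 1).
Hypothesis (s0 : s != 0).
Hypothesis (lamP : is_partition lam).
Hypothesis (fperm : forall u z, f (permz u z) = f z).
Hypothesis (flead : forall e, lead e (Kpart lam) 1 f).

Let P z := (\prod_(i < n) g (z i)) * vdm (fun i => (z i)^-1 + t * z i) * f (scalez s z).

Let A z := \sum_e sgn R e * P (flip e z).

Let KA k := (d * k + crossb n k + psum lam k)%N.

Let P_perm u z : P (permz u z) = (-1) ^+ (odd_perm u) * P z.
Proof.
rewrite /P (_ : \prod_(i < n) _ = \prod_(i < n) g (z i)); last first.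
  by rewrite [RHS](reindex_inj (@perm_inj _ u)).
have -> : scalez s (permz u z) = permz u (scalez s z) by [].
by rewrite fperm -[X in _ * vdm X * _]/(permz u (fun i => (z i)^-1 + t * z i)) vdm_perm
  mulrCA -[LHS]mulrA.
Qed.

Let P_lead e : lead e (fun S => KA #|S|)
  (\prod_(i < n) (if e i then s ^ (- (lam i)%:Z) else H * t ^+ (n - i.+1) * s ^ (lam i)%:Z)) P.
Proof.
have L1 : lead e (fun S => \sum_(i < n) d * Kpt i S)%N
   (\prod_(i < n) (if e i then 1 else H)) (fun z => \prod_(i < n) g (z i)).
  apply: lead_prod => i _; apply: lead_ext (lead_single e i ld) => //.
  by case: (e i).
have L2 : lead e (fun S => crossb n #|S|) (\prod_(i < n) (if e i then 1 else t) ^+ (n - i.+1))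
   (fun z => vdm (fun i => (z i)^-1 + t * z i)).
  apply: (@lead_cross R n e (fun e i => if e i then 1 else t)) => i j ij.
  by apply: lead_ext (lead_pair e 1 t (-1) (-t) ij) => // z _; ring.
have L3 : lead e (Kpart lam) (\prod_(i < n) s ^ (exp_flip e (exponent lam) i))
    (fun z => f (scalez s z)).
  have [K0 Lf cf] := flead e; split=> //; first exact: laurent_scale.
  by rewrite (coef_scale _ s0 Lf) cf mulr1 ktop_Kpart.
apply: lead_ext (leadM (leadM L1 L2) L3) => //.
  move=> S; rewrite /KA; congr (_ + _ + _)%N.
  by rewrite -big_distrr /= sum_Kpt.
rewrite -!big_split /=; apply: eq_bigr => i _; rewrite !ffunE.
by case: (e i); rewrite ?expr1n ?mul1r.
Qed.

Let P_laurent : laurent (bnd (fun S : {set 'I_n} => KA #|S|)) P.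
Proof. by have [] := P_lead [ffun=> false]. Qed.

Let A_term e : laurent (bnd (fun S : {set 'I_n} => KA #|S|)) (fun z => sgn R e * P (flip e z)).
Proof.
by apply/laurentZ/(laurent_flip _ P_laurent) => a; rewrite bnd_flip.
Qed.

Let A_laurent : laurent (bnd (fun S : {set 'I_n} => KA #|S|)) A.
Proof. by apply: laurent_sum => e _; exact: A_term. Qed.

Let A_antisym : antisym A.
Proof.
split=> [e z nz|u z nz].
  pose xr e' : signs := [ffun i => e i (+) e' i].
  have xrK : involutive xr.
    by move=> e'; apply/ffunP => i; rewrite !ffunE addbA addbb.
  rewrite /A (reindex_inj (inv_inj xrK)) mulr_sumr /=; apply: eq_bigr => e' _.
  rewrite mulrA; congr (_ * P _).
    rewrite /sgn -big_split; apply: eq_bigr => i _ /=.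
    by rewrite ffunE signr_addb.
  apply/funext => i; rewrite /flip ffunE.
  by case: (e i); case: (e' i); rewrite ?invrK.
pose pe e' : signs := [ffun i => e' (u i)].
have peI : injective pe.
  move=> e1 e2 /ffunP H12; apply/ffunP => i; have := H12 ((u^-1)%g i).
  by rewrite !ffunE permKV.
rewrite /A (reindex_inj peI) mulr_sumr /=; apply: eq_bigr => e' _.
have -> : sgn R (pe e') = sgn R e'.
  rewrite /sgn [RHS](reindex_inj (@perm_inj _ u)) /=; apply: eq_bigr => i _.
  by rewrite ffunE.
have -> : flip (pe e') (permz u z) = permz u (flip e' z).
  by apply/funext => i; rewrite /flip /permz ffunE.
by rewrite P_perm mulrCA.
Qed.

Let delta_pref z : regular z ->
  delta z * ((\prod_(i < n) (h (z i) / (1 - z i ^+ 2))) * cross_factor t z * f (scalez s z)) = P z.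
Proof.
move=> rz; have nz := regular_nonzero rz; have [H1 H2] := rz.
rewrite /P /delta [LHS]mulrA; congr (_ * _); rewrite mulrACA; congr (_ * _).
  rewrite -big_split; apply: eq_bigr => i _ /=.
  have [zi zi2] := H1 i; rewrite hg//.
  have zi3 : 1 - z i * z i != 0 by rewrite -expr2 subr_eq0 eq_sym.
  field; by rewrite ?expr2 ?zi3 ?zi.
rewrite -big_split; apply: eq_bigr => i _ /=.
rewrite -big_split; apply: eq_bigr => j ij /=.
have [|zij zij'] := H2 i j; first by apply/eqP => eij; rewrite eij ltnn in ij.
rewrite pair_delta//; field.
by rewrite !nz/= subr_eq0 eq_sym.
Qed.

Let A_qdiff z : regular z -> A z = delta z * qdiff h s t f z.
Proof.
move=> rz; rewrite /qdiff symmetrizeE mulr_sumr; apply: eq_bigr => e _.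
rewrite -delta_pref; last exact: regular_flip.
have [d1 _] := @delta_antisym R n; rewrite d1; last exact: regular_nonzero.
by rewrite !mulrA sgn_sq mul1r.
Qed.

Let A_top (lam' : part) : (forall i, (lam' i).+1 = lam i + d)%N ->
  coef A (exponent [ffun i => staircase n i + lam' i]%N) =
  \prod_(i < n) (H * t ^+ (n - i.+1) * s ^ (lam i)%:Z - s ^ (- (lam i)%:Z)).
Proof.
move=> lam'E; have -> : exponent [ffun i => staircase n i + lam' i]%N = ktop (fun S : {set 'I_n} => KA #|S|).
  apply/ffunP => i; rewrite !ffunE !card_init ?ltnS//; last exact: ltnW.
  rewrite /KA crossb_step// /psum big_initS /=.
  by have := lam'E i; have := ltn_ord i; move: (\sum_(j in _) _)%N => X; nia.
rewrite (coef_bigsum _ (fun e _ => A_term e)).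
have cP e : coef (fun z => sgn R e * P (flip e z)) (ktop (fun S : {set 'I_n} => KA #|S|)) =
  \prod_(i < n) (if e i then - s ^ (- (lam i)%:Z) else H * t ^+ (n - i.+1) * s ^ (lam i)%:Z).
  have [_ _ c] := P_lead e.
  have Lfl : laurent xpredT (fun z => P (flip e z)) by exact: laurent_flip P_laurent.
  rewrite (coef_mull _ _ Lfl) (coef_flip _ _ P_laurent) c /sgn -big_split.
  by apply: eq_bigr => i _ /=; case: (e i); rewrite ?expr1 ?mulN1r ?expr0 ?mul1r.
under eq_bigr do rewrite cP.
rewrite -(bigA_distr_bigA (fun i (b : bool) => if b then - s ^ (- (lam i)%:Z) else H * t ^+ (n - i.+1) * s ^ (lam i)%:Z)).
by apply: eq_bigr => i _; rewrite big_bool /= addrC.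
Qed.

(** Multiplied by [delta], each summand of the symmetrization becomes the Laurent
    polynomial [P] below, up to a sign, and their alternating sum [A] is
    antisymmetric, hence divisible by [delta].  The leading coefficient compares
    extreme coefficients on both sides; the sum over the signs factors into a
    product over the variables. *)
Lemma qdiff_expand : exists lc : seq (C * part),
  [/\ forall x, x \in lc -> is_partition x.2 /\
        forall k, (k <= n)%N -> (k + psum x.2 k <= d * k + psum lam k)%N,
      forall z, regular z -> qdiff h s t f z = \sum_(x <- lc) x.1 * msym x.2 z &
      forall lam', is_partition lam' -> (forall i, (lam' i).+1 = lam i + d)%N ->
        \sum_(x <- lc | x.2 == lam') x.1 =
        \prod_(i < n) (s ^ (- (lam i)%:Z) - H * t ^+ (n - i.+1) * s ^ (lam i)%:Z)].
Proof.
have [lc [lcP lcE]] := antisym_division A_laurent A_antisym.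
exists lc; split.
- move=> x /lcP[xP xK]; split=> // k kn; have := xK k kn; rewrite /KA; lia.
- move=> z rz; apply: (mulfI (delta_regular rz)); rewrite -A_qdiff// lcE//.
  exact: regular_nonzero.
move=> lam' l'P l'E; set kap := [ffun i => staircase n i + lam' i]%N.
have pl' := psum_shift l'E.
have kapP : is_partition kap.
  apply/forallP => i; apply/forallP => j; apply/implyP => ij; rewrite !ffunE.
  by have := partP l'P ij; lia.
have cA : coef A (exponent kap) = (-1) ^+ n * \sum_(x <- lc | x.2 == lam') x.1.
  rewrite (eq_coef _ lcE).
  rewrite (@eq_coef _ _ _ (fun z => \sum_(x <- lc) x.1 * (delta z * msym x.2 z))); last first.
    by move=> z _; rewrite mulr_sumr; apply: eq_bigr => x _; rewrite mulrCA.
  have LL x : x \in lc -> laurent xpredT (fun z : 'I_n -> C => delta z * msym x.2 z).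
    by move=> /lcP[xP _]; have [_ L _] := lead_delta_msym R xP; apply: laurentW L.
  rewrite (@coef_bigsum _ _ xpredT); last by move=> x xl; apply/laurentZ/LL.
  rewrite mulr_sumr [RHS]big_mkcond [LHS]big_seq [RHS]big_seq; apply: eq_bigr => x xl.
  have [xP xK] := lcP _ xl.
  rewrite (coef_mull _ _ (LL _ xl)) delta_msym_coef//; last first.
    apply: height_mono => k kn; rewrite !psumD psum_staircase//.
    by have := xK k kn; have := pl' k kn; rewrite /KA; lia.
  have -> : (kap == [ffun i => staircase n i + x.2 i]%N) = (x.2 == lam').
    apply/eqP/eqP => [/ffunP Hk|->//]; apply/ffunP => i.
    by have := Hk i; rewrite !ffunE => /addnI.
  by case: ifP => _; rewrite ?mulr0n ?mulr0// mulr1n mulrC.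
have := A_top l'E; rewrite cA => /(congr1 (fun x => (-1) ^+ n * x)).
rewrite mulrA -expr2 sqrr_sign mul1r => ->.
have -> : (-1) ^+ n = \prod_(i < n) (-1) :> C by rewrite prodr_const card_ord.
by rewrite -big_split; apply: eq_bigr => i _ /=; rewrite mulN1r opprB.
Qed.

End Expansion.
End Operators.

(** * Laurent polynomial weights and adjointness *)

Section LaurentRing.
Variables (R : realType) (n : nat).
Local Notation C := R[i].
Implicit Types (f g : ('I_n -> C) -> C).

Definition laur f := laurent xpredT f.

Lemma laur_cst (c : C) : laur (fun=> c). Proof. exact: laurent_cst. Qed.

Lemma laurD f g : laur f -> laur g -> laur (fun z => f z + g z).
Proof. exact: laurentD. Qed.

Lemma laurM f g : laur f -> laur g -> laur (fun z => f z * g z).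
Proof. exact: laurentM. Qed.

Lemma laur_sum (I : eqType) (r : seq I) (F : I -> ('I_n -> C) -> C) :
  (forall i, i \in r -> laur (F i)) -> laur (fun z => \sum_(i <- r) F i z).
Proof. exact: laurent_sum. Qed.

Lemma laur_prod (I : Type) (r : seq I) (P : pred I) (F : I -> ('I_n -> C) -> C) :
  (forall i, P i -> laur (F i)) -> laur (fun z => \prod_(i <- r | P i) F i z).
Proof.
move=> H; elim: r => [|i r IH].
  by apply: laurent_ext (laur_cst 1) => z _; rewrite big_nil.
case: (boolP (P i)) => Pi.
  by apply: laurent_ext (laurM (H i Pi) IH) => z _; rewrite big_cons Pi.
by apply: laurent_ext IH => z _; rewrite big_cons (negPf Pi).
Qed.

Lemma laur_coord i : laur (fun z => z i).
Proof.
apply: laurent_ext (@laurent_mono R n xpredT 1 (single i 1) isT) => z _.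
by rewrite mono_single expr1z mul1r.
Qed.

Lemma laur_coordV i : laur (fun z => (z i)^-1).
Proof.
apply: laurent_ext (@laurent_mono R n xpredT 1 (single i (-1)) isT) => z _.
by rewrite mono_single exprN1 mul1r.
Qed.

Lemma laur_msym lam : laur (fun z => msym lam z).
Proof. exact: msym_laurent. Qed.

End LaurentRing.

Section Pochhammer.
Variables (R : realType).
Local Notation C := R[i].

(** The finite q-Pochhammer symbol, with [m] factors. *)
Definition qpochn (q x : C) (m : nat) : C := \prod_(j < m) (1 - q ^+ j * x).

Lemma qpochn_recl q x m : qpochn q x m.+1 = (1 - x) * qpochn q (q * x) m.
Proof.
rewrite /qpochn big_ord_recl mul1r; congr (_ * _); apply: eq_bigr => j _.
by rewrite mulrA -exprSr.
Qed.

Lemma qpochn_recr q x m : qpochn q x m.+1 = qpochn q x m * (1 - q ^+ m * x).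
Proof. by rewrite /qpochn big_ord_recr. Qed.

Lemma qpochn_shift q x m : (1 - x) * qpochn q (q * x) m = (1 - q ^+ m * x) * qpochn q x m.
Proof. by rewrite -qpochn_recl qpochn_recr mulrC. Qed.

Lemma laur_qpochn n q (f : ('I_n -> C) -> C) m : laur f -> laur (fun z => qpochn q (f z) m).
Proof.
move=> Lf; apply: laur_prod => j _; apply: laurD; first exact: laur_cst.
apply: (@laurent_ext _ _ _ (fun z => (- q ^+ j) * f z)); first by move=> z _; rewrite mulNr.
by apply: laurM => //; exact: laur_cst.
Qed.

Lemma qpochn_neq0 q x m : `|q| < 1 -> `|x| < 1 -> qpochn q x m != 0.
Proof.
move=> q1 x1; apply/prodf_neq0 => j _; rewrite subr_eq0 eq_sym.
apply: contraTneq x1 => qx; have H : 1 <= `|x|; last by rewrite (le_gtF H).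
by rewrite -[1]normr1 -qx normrM normrX ler_piMl// exprn_ile1// ltW.
Qed.

Lemma qpochn_conj q x m : q^* = q -> (qpochn q x m)^* = qpochn q x^* m.
Proof.
move=> qq; rewrite /qpochn rmorph_prod; apply: eq_bigr => j _ /=.
by rewrite rmorphB rmorph1 rmorphM rmorphXn /= qq.
Qed.

End Pochhammer.

Section InnerProduct.
Variables (R : realType) (n : nat).
Local Notation C := R[i].
Local Notation part := {ffun 'I_n -> nat}.
Variables (q : C) (k : nat).
Implicit Types (w h v : C -> C) (f g : ('I_n -> C) -> C) (z : 'I_n -> C).

Definition coordinate_laurent w := forall i : 'I_n,
  laur (fun z : 'I_n -> C => w (z i)) /\ laur (fun z : 'I_n -> C => w (z i)^-1).

(** The factors of one pair of variables in the density when [t = q ^+ k].  With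
    [p = q] instead of [p = 1], the prefactor of the operators is absorbed. *)
Definition pair_weight (p x y : C) : C :=
  qpochn q (p * (x * y)) k * qpochn q (x * y)^-1 k * qpochn q (x / y) k * qpochn q (y / x) k.

Definition weight w z : C :=
  (\prod_(i < n) (w (z i) * w (z i)^-1)) *
  \prod_(i < n) \prod_(j < n | (i < j)%N) pair_weight 1 (z i) (z j).

(** The weight times the prefactor of the operator with numerator [h], where
    [v x] stands for [w x / (1 - x ^+ 2)].  It is again a Laurent polynomial, because
    the weight vanishes at the poles of the prefactor. *)
Definition pre_weight h v w z : C :=
  (\prod_(i < n) (h (z i) * v (z i) * w (z i)^-1)) *
  \prod_(i < n) \prod_(j < n | (i < j)%N) pair_weight q (z i) (z j).

(** If [q] is real and [w] commutes with complex conjugation, the weight is the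
    squared modulus of this function on the torus. *)
Definition half_weight w z : C :=
  (\prod_(i < n) w (z i)) *
  \prod_(i < n) \prod_(j < n | (i < j)%N) (qpochn q (z i * z j) k * qpochn q (z i / z j) k).

Lemma laur_pair p i j : laur (fun z : 'I_n -> C => pair_weight p (z i) (z j)).
Proof.
have x i' := laur_coord R i'; have xV i' := laur_coordV R i'.
do 3 ?[apply: laurM]; apply: laur_qpochn.
- by apply: laurM; [exact: laur_cst | exact: laurM].
- apply: (@laurent_ext _ _ _ (fun z => (z i)^-1 * (z j)^-1)).
    by move=> z _; rewrite invfM.
  exact: laurM.
- exact: laurM.
- exact: laurM.
Qed.

Lemma laur_weight w : coordinate_laurent w -> laur (weight w).
Proof.
move=> Lw; apply: laurM; apply: laur_prod => i _.
  by apply: laurM; have [] := Lw i.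
by apply: laur_prod => j _; exact: laur_pair.
Qed.

Lemma laur_pre_weight h v w : coordinate_laurent h -> coordinate_laurent v ->
  coordinate_laurent w -> laur (pre_weight h v w).
Proof.
move=> Lh Lv Lw; apply: laurM; apply: laur_prod => i _.
  by apply: laurM; [apply: laurM; [have [] := Lh i|have [] := Lv i]|have [] := Lw i].
by apply: laur_prod => j _; exact: laur_pair.
Qed.

Lemma laur_half_weight w : coordinate_laurent w -> laur (half_weight w).
Proof.
move=> Lw; apply: laurM; apply: laur_prod => i _.
  by have [] := Lw i.
apply: laur_prod => j _; apply: laurM; apply: laur_qpochn; apply: laurM; try exact: laur_coord.
exact: laur_coordV.
Qed.

Lemma weight_flip w e z : weight w (flip e z) = weight w z.
Proof.
rewrite /weight; congr (_ * _).
  apply: eq_bigr => i _; rewrite /flip; case: (e i) => //.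
  by rewrite invrK mulrC.
apply: eq_bigr => i _; apply: eq_bigr => j _; rewrite /pair_weight /flip !mul1r.
by case: (e i); case: (e j); rewrite ?invfM ?invrK // ?[z j * _]mulrC ?[(z j)^-1 * _]mulrC; ring.
Qed.

Lemma weight_half w z : weight w z = half_weight w z * half_weight w (fun i => (z i)^-1).
Proof.
rewrite /weight /half_weight mulrACA; congr (_ * _).
  by rewrite -big_split; apply: eq_bigr => i _.
rewrite -big_split; apply: eq_bigr => i _ /=.
rewrite -big_split; apply: eq_bigr => j _ /=.
by rewrite /pair_weight mul1r -invfM invrK [z j / z i]mulrC; ring.
Qed.

Lemma pre_weightE h v w z : regular z ->
  (forall x, w x = (1 - x ^+ 2) * v x) ->
  (\prod_(i < n) (h (z i) / (1 - z i ^+ 2))) * cross_factor (q ^+ k) z * weight w z =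
  pre_weight h v w z.
Proof.
move=> [H1 H2] wv; rewrite /weight mulrACA; congr (_ * _).
  rewrite -big_split; apply: eq_bigr => i _ /=; have [zi zi2] := H1 i.
  rewrite [w (z i)]wv mulrA [X in X * _ = _]mulrA mulfVK//.
  by rewrite subr_eq0 eq_sym.
rewrite /cross_factor -big_split; apply: eq_bigr => i _ /=.
rewrite -big_split; apply: eq_bigr => j ij /=.
have [|zij _] := H2 i j; first by apply/eqP => eij; rewrite eij ltnn in ij.
rewrite /pair_weight mul1r !mulrA; congr (_ * _ * _ * _).
rewrite mulrAC -[_ * z i * z j]mulrA -qpochn_shift mulrAC mulfV ?mul1r//.
  by rewrite mulrA.
by rewrite subr_eq0 eq_sym.
Qed.

Definition inner w f g : C := torus_integral (fun z => f z * g z * weight w z).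

Definition symmetric f := forall e z, nonzero z -> f (flip e z) = f z.

Lemma eq_inner w f f' g : (forall z, nonzero z -> f z = f' z) -> inner w f g = inner w f' g.
Proof. by move=> ff; apply: torus_integral_ext => z /norm1_nonzero nz; rewrite ff. Qed.

Lemma torus_integral_sum (I : eqType) (r : seq I) (F : I -> ('I_n -> C) -> C) :
  (forall i, i \in r -> laur (F i)) ->
  torus_integral (fun z => \sum_(i <- r) F i z) = \sum_(i <- r) torus_integral (F i).
Proof.
move=> LF; rewrite torus_integral_coef (coef_bigsum _ LF).
by apply: eq_bigr => i _; rewrite torus_integral_coef.
Qed.

Lemma torus_integralZ c f : laur f -> torus_integral (fun z => c * f z) = c * torus_integral f.
Proof. by move=> Lf; rewrite !torus_integral_coef (coef_mull _ _ Lf). Qed.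

Lemma innerZl w c f g : coordinate_laurent w -> laur f -> laur g ->
  inner w (fun z => c * f z) g = c * inner w f g.
Proof.
move=> Lw Lf Lg; rewrite /inner -torus_integralZ.
  by apply: torus_integral_ext => z _; rewrite !mulrA.
by apply: laurM; [exact: laurM|exact: laur_weight].
Qed.

Lemma inner_sumr w f (l : seq (C * part)) : coordinate_laurent w -> laur f ->
  inner w f (fun z => \sum_(x <- l) x.1 * msym x.2 z) = \sum_(x <- l) x.1 * inner w f (msym x.2).
Proof.
move=> Lw Lf; have LW := laur_weight Lw.
have LT (x : C * part) : laur (fun z => f z * msym x.2 z * weight w z).
  by apply: laurM => //; apply: laurM => //; exact: laur_msym.
rewrite /inner -(eq_bigr _ (fun x _ => torus_integralZ x.1 (LT x))) -torus_integral_sum.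
  apply: torus_integral_ext => z _; rewrite mulr_sumr mulr_suml.
  by apply: eq_bigr => x _; ring.
by move=> x _; apply: laurM => //; exact: laur_cst.
Qed.

Lemma innerC w f g : inner w f g = inner w g f.
Proof. by apply: torus_integral_ext => z _; rewrite [f z * _]mulrC. Qed.

Lemma inner_suml w g (l : seq (C * part)) : coordinate_laurent w -> laur g ->
  inner w (fun z => \sum_(x <- l) x.1 * msym x.2 z) g = \sum_(x <- l) x.1 * inner w (msym x.2) g.
Proof.
move=> Lw Lg; rewrite innerC inner_sumr//; apply: eq_bigr => x _; by rewrite innerC.
Qed.

Lemma star_msym (l : seq (C * part)) z : nonzero z ->
  star (fun z => \sum_(x <- l) x.1 * msym x.2 z) z = \sum_(x <- l) (x.1)^* * msym x.2 z.
Proof.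
move=> nz; rewrite /star rmorph_sum; apply: eq_bigr => x _; rewrite rmorphM; congr (_ * _).
rewrite -(msym_flip _ [ffun=> true] z) !msymE rmorph_sum; apply: eq_bigr => a _ /=.
rewrite /mono rmorph_prod; apply: eq_bigr => i _ /=.
by rewrite fmorphXz fmorphV /= conjcK /flip ffunE.
Qed.

(** By hypothesis the integral of [B * star B] against the weight is 0, and this
    is the constant term of [F * star F] for [F = B * half_weight]. *)
Lemma posdef w (l : seq (C * part)) : coordinate_laurent w ->
  q^* = q -> (forall x, (w x^*)^* = w x) ->
  (exists2 v, nonzero v & half_weight w v != 0) ->
  let B z := \sum_(x <- l) x.1 * msym x.2 z in
  (forall x, x \in l -> inner w B (msym x.2) = 0) ->
  forall z, nonzero z -> B z = 0.
Proof.
move=> Lw qr wr [v nv hv] B HB.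
have LB : laur B.
  by apply: laur_sum => x _; apply: laurM; [exact: laur_cst|exact: laur_msym].
have Lh := laur_half_weight Lw.
apply: (laurent_mul_eq0 LB Lh nv hv).
apply: (torus_integral_norm (laurM LB Lh)).
rewrite (@torus_integral_ext _ _ _ (fun z => B z * (\sum_(x <- [seq ((x.1)^*, x.2) | x <- l]) x.1 * msym x.2 z) * weight w z)).
  rewrite -/(inner w B _) inner_sumr// big_map big1_seq// => x /= xl.
  by rewrite HB// mulr0.
move=> z z1; have nz := norm1_nonzero z1.
have SB : star B z = \sum_(x <- l) (x.1)^* * msym x.2 z := star_msym l nz.
have -> : star (fun z => B z * half_weight w z) z = star B z * star (half_weight w) z.
  by rewrite /star rmorphM.
rewrite weight_half SB big_map.
have -> : star (half_weight w) z = half_weight w (fun i => (z i)^-1).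
  rewrite /star /half_weight rmorphM !rmorph_prod; congr (_ * _).
    by apply: eq_bigr => i _; rewrite -conjc_inv; exact: wr.
  apply: eq_bigr => i _; rewrite rmorph_prod; apply: eq_bigr => j _.
  by rewrite rmorphM /= !qpochn_conj// !rmorphM /= !fmorphV /= !conjcK.
by rewrite mulrACA.
Qed.

(** [z -> 1 / (s z)] exchanges [q * z i * z j] with the inverse of [z i * z j] and
    [z i / z j] with its inverse, so only the one-variable factors change. *)
Lemma pre_weight_inv s kap h v w h' v' w' z : s != 0 -> s ^+ 2 = q -> nonzero z ->
  (forall x, x != 0 -> h (s * x)^-1 * v (s * x)^-1 * w (s * x) = kap * (h' x * v' x * w' x^-1)) ->
  pre_weight h v w (invz s z) = kap ^+ n * pre_weight h' v' w' z.
Proof.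
move=> s0 sq nz H; rewrite /pre_weight mulrA; congr (_ * _).
  rewrite -[in kap ^+ n](card_ord n) -prodr_const -big_split; apply: eq_bigr => i _ /=.
  by rewrite /invz invrK H.
apply: eq_bigr => i _; apply: eq_bigr => j _; rewrite /pair_weight /invz.
have zi := nz i; have zj := nz j.
have -> : q * ((s * z i)^-1 * (s * z j)^-1) = (z i * z j)^-1 by rewrite -sq; field; rewrite ?zi ?zj ?s0.
have -> : ((s * z i)^-1 * (s * z j)^-1)^-1 = q * (z i * z j) by rewrite -invfM invrK -sq; ring.
have -> : (s * z i)^-1 / (s * z j)^-1 = z j / z i by rewrite invrK; field; rewrite ?zi ?zj ?s0.
have -> : (s * z j)^-1 / (s * z i)^-1 = z i / z j by rewrite invrK; field; rewrite ?zi ?zj ?s0.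
by rewrite -!mulrA [qpochn q (z i * z j)^-1 _ * _]mulrCA [qpochn q (z j / z i) _ * _]mulrC.
Qed.

Section Adjoint.
Variables (s kap : C) (h v w h' v' w' : C -> C).
Hypotheses (s0 : s != 0) (sq : s ^+ 2 = q).
Hypotheses (wv : forall x, w x = (1 - x ^+ 2) * v x).
Hypotheses (wv' : forall x, w' x = (1 - x ^+ 2) * v' x).
Hypotheses (Lh : coordinate_laurent h) (Lv : coordinate_laurent v) (Lw : coordinate_laurent w).
Hypotheses (Lh' : coordinate_laurent h') (Lv' : coordinate_laurent v') (Lw' : coordinate_laurent w').
Hypothesis adj : forall x, x != 0 ->
  h (s * x)^-1 * v (s * x)^-1 * w (s * x) = kap * (h' x * v' x * w' x^-1).

(** All terms of the symmetrization have the same integral against a symmetric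
    function. *)
Lemma inner_qdiff h0 v0 w0 f g B : (forall x, w0 x = (1 - x ^+ 2) * v0 x) ->
  coordinate_laurent h0 -> coordinate_laurent v0 -> coordinate_laurent w0 ->
  laur f -> laur g -> symmetric g -> laur B ->
  (forall z, regular z -> B z = qdiff h0 s (q ^+ k) f z) ->
  inner w0 B g = #|{: {ffun 'I_n -> bool}}|%:R *
    torus_integral (fun z => pre_weight h0 v0 w0 z * f (scalez s z) * g z).
Proof.
move=> wv0 Lh0 Lv0 Lw0 Lf Lg sg LB BE.
have Lfs : laur (fun z => f (scalez s z)) by exact: laurent_scale.
have LT : laur (fun z => pre_weight h0 v0 w0 z * f (scalez s z) * g z).
  by apply: laurM => //; apply: laurM => //; exact: laur_pre_weight.
have LTe e : laur (fun z => (fun z => pre_weight h0 v0 w0 z * f (scalez s z) * g z) (flip e z)).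
  exact: laurent_flip LT.
transitivity (torus_integral (fun z => \sum_e (fun z => pre_weight h0 v0 w0 z * f (scalez s z) * g z) (flip e z))).
  apply: torus_integral_ext => z /norm1_nonzero nz.
  move: z nz; apply: (@eq_on_regular R n xpredT xpredT).
  - by apply: laurM; [exact: laurM|exact: laur_weight].
  - by apply: laur_sum => e _; exact: LTe.
  move=> z rz; rewrite BE// /qdiff symmetrizeE !mulr_suml; apply: eq_bigr => e _.
  have re := regular_flip e rz.
  rewrite -(sg e); last exact: regular_nonzero.
  rewrite -(weight_flip _ e) -(pre_weightE h0 re wv0); ring.
rewrite torus_integral_sum; last by move=> e _; exact: LTe.
rewrite (eq_bigr (fun=> torus_integral (fun z => pre_weight h0 v0 w0 z * f (scalez s z) * g z))).
  by rewrite sumr_const mulr_natl.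
by move=> e _; rewrite (torus_integral_flip e LT).
Qed.

(** Unfold the symmetrization on both sides; the two integrals correspond to each
    other under [z -> 1 / (s z)]. *)
Lemma adjointness f g B B' : laur f -> laur g -> symmetric f -> symmetric g ->
  laur B -> laur B' ->
  (forall z, regular z -> B z = qdiff h s (q ^+ k) f z) ->
  (forall z, regular z -> B' z = qdiff h' s (q ^+ k) g z) ->
  inner w B g = kap ^+ n * inner w' f B'.
Proof.
move=> Lf Lg sf sg LB LB' BE BE'.
rewrite (inner_qdiff wv Lh Lv Lw Lf Lg sg LB BE) innerC (inner_qdiff wv' Lh' Lv' Lw' Lg Lf sf LB' BE').
have Lfs : laur (fun z => f (scalez s z)) by exact: laurent_scale.
have Lgs : laur (fun z => g (scalez s z)) by exact: laurent_scale.
rewrite mulrCA; congr (_ * _).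
rewrite -(@torus_integral_invz _ _ xpredT s)//; last first.
  by apply: laurM => //; apply: laurM => //; exact: laur_pre_weight.
rewrite -torus_integralZ; last first.
  by apply: laurM => //; apply: laurM => //; exact: laur_pre_weight.
apply: torus_integral_ext => z /norm1_nonzero nz.
rewrite (pre_weight_inv s0 sq nz adj).
have -> : f (scalez s (invz s z)) = f z.
  rewrite -(sf [ffun=> true] z nz); congr f; apply/funext => i.
  by rewrite /scalez /invz /flip ffunE invfM mulrA mulfV// mul1r.
have -> : g (invz s z) = g (scalez s z).
  rewrite -(sg [ffun=> true] (scalez s z) (scalez_nonzero s0 nz)).
  by congr g; apply/funext => i; rewrite /scalez /invz /flip ffunE.
ring.
Qed.

End Adjoint.
End InnerProduct.

(** * Orthogonality and eigenvector equations *)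

Section MonicForms.
Variables (R : realType) (n : nat).
Local Notation C := R[i].
Local Notation E := {ffun 'I_n -> int}.
Local Notation part := {ffun 'I_n -> nat}.
Implicit Types (lam mu nu : part) (l : seq (C * part)) (K : ('I_n -> C) -> C).

Lemma sdominatedP lam mu :
  reflect [/\ is_partition mu, forall k, (k <= n)%N -> (psum mu k <= psum lam k)%N & mu != lam]
          (sdominated lam mu).
Proof.
by apply: (iffP and3P) => -[mP /dominatesP H ml]; split=> //; exact/dominatesP.
Qed.

Definition msum l (z : 'I_n -> C) : C := \sum_(x <- l) x.1 * msym x.2 z.

Lemma laur_msum l : laur (msum l).
Proof. by apply: laur_sum => x _; apply: laurM; [exact: laur_cst|exact: laur_msym]. Qed.

Lemma msum_flip l e z : msum l (flip e z) = msum l z.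
Proof. by apply: eq_bigr => x _; rewrite msym_flip. Qed.

Lemma msum_perm l u z : msum l (permz u z) = msum l z.
Proof. by apply: eq_bigr => x _; rewrite msym_perm. Qed.

Lemma monic_formP lam K : monic_form lam K <->
  exists2 l, forall x, x \in l -> sdominated lam x.2 & forall z, K z = msym lam z + msum l z.
Proof.
split=> [[mus [c [/allP H KE]]]|[l H KE]].
  exists [seq (c mu, mu) | mu <- mus]; first by move=> _ /mapP[mu /H ? ->].
  by move=> z; rewrite KE /msum big_map.
exists (undup [seq x.2 | x <- l]), (fun mu => \sum_(x <- l | x.2 == mu) x.1); split.
  by apply/allP => mu; rewrite mem_undup => /mapP[x /H ? ->].
move=> z; rewrite KE; congr (_ + _).
exact: (big_regroup l (fun mu => msym mu z)).
Qed.

Lemma coef_msum l mu : (forall x, x \in l -> is_partition x.2) -> is_partition mu ->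
  coef (msum l) (exponent mu) = \sum_(x <- l | x.2 == mu) x.1.
Proof.
move=> lP mP; rewrite (@coef_bigsum _ _ xpredT); last first.
  by move=> x _; apply: laurentZ; exact: laur_msym.
rewrite [RHS]big_mkcond [LHS]big_seq [RHS]big_seq; apply: eq_bigr => x xl.
rewrite (coef_mull _ _ (@laur_msym R n _)) coef_msym exponent_in_orbit ?lP// eq_sym.
by case: (_ == _); rewrite ?mulr1 ?mulr0.
Qed.

(** The vanishing extends from nonzero points to all points because the orbit sums
    of distinct partitions are linearly independent. *)
Lemma msum_eq0 l : (forall x, x \in l -> is_partition x.2) ->
  (forall z, nonzero z -> msum l z = 0) -> forall z, msum l z = 0.
Proof.
move=> lP H z.
rewrite /msum (big_regroup l (fun mu => msym mu z)).
rewrite big1_seq// => mu; rewrite mem_undup => /andP[_ /mapP[x xl ->]].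
by rewrite -coef_msum ?lP// coef_eq0 ?mul0r.
Qed.

Section Monic.
Variables (lam : part) (K : ('I_n -> C) -> C).
Hypotheses (lamP : is_partition lam) (KM : monic_form lam K).

Lemma monic_laur : laur K.
Proof.
have /monic_formP[l _ KE] := KM.
apply: laurent_ext (laurD (laur_msym R lam) (laur_msum l)) => z _.
by rewrite KE.
Qed.

Lemma monic_flip e z : K (flip e z) = K z.
Proof. by have /monic_formP[l _ KE] := KM; rewrite !KE msym_flip msum_flip. Qed.

Lemma monic_perm u z : K (permz u z) = K z.
Proof. by have /monic_formP[l _ KE] := KM; rewrite !KE msym_perm msum_perm. Qed.

Lemma monic_lead e : lead e (Kpart lam) 1 K.
Proof.
have /monic_formP[l lP KE] := KM; have [K0 Lm cm] := lead_msym R e lamP.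
have Lx x : x \in l -> laurent (bnd (Kpart lam)) (fun z : 'I_n -> C => x.1 * msym x.2 z).
  move=> /lP/sdominatedP[xP xl _]; apply: laurentZ; have [_ L _] := lead_msym R e xP.
  by apply: laurentW L => a; apply: bndW => S; apply: xl; exact: card_le_n.
have Ls : laurent (bnd (Kpart lam)) (msum l) by exact: laurent_sum.
split=> //; first by apply: laurent_ext (laurentD Lm Ls) => z _; rewrite KE.
rewrite (@eq_coef _ _ _ (fun z => msym lam z + msum l z)); last by move=> z _; rewrite KE.
rewrite (coef_add _ Lm Ls) cm (coef_bigsum _ Lx) big1_seq ?addr0// => x /= xl.
have /sdominatedP[xP xlam nx] := lP _ xl.
rewrite (coef_mull _ _ (laur_msym R x.2)) coef_msym ktop_Kpart bc_orbit_flip exponent_in_orbit//.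
by rewrite eq_sym (negPf nx) mulr0.
Qed.

End Monic.
End MonicForms.

Section Gram.
Variables (R : realType) (n : nat).
Local Notation C := R[i].
Local Notation part := {ffun 'I_n -> nat}.
Variables (q : C) (k : nat) (w : C -> C).
Hypotheses (Lw : coordinate_laurent n w) (qr : q^* = q) (wr : forall x, (w x^*)^* = w x).
Hypothesis (hw : exists2 v : 'I_n -> C, nonzero v & half_weight q k w v != 0).
Local Notation innerw := (@inner R n q k w).
Implicit Types (lam mu nu : part) (l : seq (C * part)) (K : ('I_n -> C) -> C).

Definition orthogonal_to lam K := forall mu, sdominated lam mu -> innerw K (msym mu) = 0.

Lemma posdef_msum l : (forall x, x \in l -> innerw (msum l) (msym x.2) = 0) ->
  forall z, nonzero z -> msum l z = 0.
Proof. exact: posdef. Qed.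

Lemma innerDl f g h : laur f -> laur g -> laur h ->
  innerw (fun z => f z + g z) h = innerw f h + innerw g h.
Proof.
move=> Lf Lg Lh; have LW := laur_weight q k Lw.
rewrite /inner !torus_integral_coef -(@coef_add _ _ xpredT xpredT).
- by apply: eq_coef => z _; ring.
- by apply: laurM => //; exact: laurM.
- by apply: laurM => //; exact: laurM.
Qed.

Lemma orthogonal_unique lam K L : monic_form lam K -> monic_form lam L ->
  orthogonal_to lam K -> orthogonal_to lam L -> L =1 K.
Proof.
move=> KM LM oK oL; have /monic_formP[lk lkP KE] := KM; have /monic_formP[ll llP LE] := LM.
pose l := ll ++ [seq (- x.1, x.2) | x <- lk].
have lE z : msum l z = L z - K z.
  rewrite /msum /l big_cat big_map /= LE KE opprD addrACA subrr add0r.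
  by congr (_ + _); rewrite -sumrN; apply: eq_bigr => x _; rewrite mulNr.
have lP x : x \in l -> sdominated lam x.2.
  by rewrite mem_cat => /orP[/llP//|/mapP[y /lkP ? ->]].
suff H z : msum l z = 0 by move=> z; apply/eqP; rewrite -subr_eq0 -lE H.
apply: msum_eq0 => [x /lP/sdominatedP[]//|]; apply: posdef_msum => x xl.
have LK := monic_laur KM; have LL := monic_laur LM.
rewrite (@eq_inner _ _ _ _ _ _ (fun z => L z + (-1) * K z)); last first.
  by move=> y _; rewrite lE mulN1r.
rewrite innerDl//; last 2 first.
- by apply: laurM => //; exact: laur_cst.
- exact: laur_msym.
by rewrite oL ?lP// add0r innerZl// ?oK ?lP ?mulr0//; exact: laur_msym.
Qed.

Lemma sdominated_bounded lam mu : sdominated lam mu -> mu \in bounded_ffuns n (psum lam n).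
Proof.
move=> /sdominatedP[_ H _]; apply: mem_bounded_ffuns => i.
by apply: leq_trans (psum_ge mu i) (H n (leqnn n)).
Qed.

(** The Gram matrix of the dominated orbit sums is invertible, because a vector in
    its kernel is a combination orthogonal to each of its own terms. *)
Lemma orthogonal_exists lam : exists2 K, monic_form lam K & orthogonal_to lam K.
Proof.
pose ms := [seq mu <- bounded_ffuns n (psum lam n) | sdominated lam mu].
have msP mu : (mu \in ms) = sdominated lam mu.
  by rewrite mem_filter; apply/andb_idr; exact: sdominated_bounded.
have ums : uniq ms by rewrite filter_uniq ?bounded_ffuns_uniq.
pose m := size ms; pose mui (i : 'I_m) : part := tnth (in_tuple ms) i.
have mui_in i : mui i \in ms by exact: mem_tnth.
have mui_inj : injective mui by apply/tuple_uniqP.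
have big_ms (F : part -> C) : \sum_(mu <- ms) F mu = \sum_(i < m) F (mui i).
  by rewrite big_tnth.
pose G : 'M[C]_m := \matrix_(i, j) innerw (msym (mui i)) (msym (mui j)).
have msumE (v : 'rV[C]_m) z : msum [seq (v 0 i, mui i) | i <- enum 'I_m] z =
    \sum_(i < m) v 0 i * msym (mui i) z.
  by rewrite /msum big_map big_enum.
have inner_msum (v : 'rV[C]_m) j : innerw (msum [seq (v 0 i, mui i) | i <- enum 'I_m]) (msym (mui j)) =
    (v *m G) 0 j.
  rewrite mxE inner_suml//; last exact: laur_msym.
  by rewrite big_map big_enum; apply: eq_bigr => i _; rewrite mxE.
have Gu : G \in unitmx.
  rewrite -row_free_unit; apply: inj_row_free => v vG.
  set l := [seq (v 0 i, mui i) | i <- enum 'I_m].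
  have l0 z : nonzero z -> msum l z = 0.
    by apply: posdef_msum => _ /mapP[i _ ->]; rewrite inner_msum vG mxE.
  have lP x : x \in l -> is_partition x.2.
    by move=> /mapP[i _ ->]; have := mui_in i; rewrite msP => /sdominatedP[].
  apply/rowP => i; rewrite mxE; have miP : is_partition (mui i).
    by have := mui_in i; rewrite msP => /sdominatedP[].
  have := coef_msum lP miP; rewrite /l big_map big_mkcond big_enum /= -big_mkcond /=.
  rewrite (big_pred1 i); last by move=> j /=; rewrite (inj_eq mui_inj).
  by move=> <-; exact: coef_eq0.
pose b : 'rV[C]_m := \row_j innerw (msym lam) (msym (mui j)).
pose cv : 'rV[C]_m := - (b *m invmx G).
exists (fun z => msym lam z + msum [seq (cv 0 i, mui i) | i <- enum 'I_m] z).
  apply/monic_formP; exists [seq (cv 0 i, mui i) | i <- enum 'I_m] => //.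
  by move=> _ /mapP[i _ ->] /=; rewrite -msP.
move=> mu; rewrite -msP => /seq_tnthP[j ->].
rewrite innerDl; [|exact: laur_msym|exact: laur_msum|exact: laur_msym].
rewrite inner_msum mulNmx mulmxKV// mxE mxE.
by rewrite subrr.
Qed.

End Gram.

Lemma dominance_step (A B X Y Z j : nat) : (A + B = 2 * j)%N ->
  (j + X <= A + Y)%N -> (j + Z <= B + X)%N -> (Z <= Y)%N.
Proof. lia. Qed.

Lemma dominance_step_strict (A B X Y j : nat) : (A + B = 2 * j)%N ->
  (j + Y <= B + X)%N -> ~~ (j + X < A + Y)%N.
Proof. lia. Qed.

Section Eigen.
Variables (R : realType) (n : nat).
Local Notation C := R[i].
Local Notation part := {ffun 'I_n -> nat}.

(** The conditions on the one-variable factor that determine how the operator acts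
    on leading terms: [h x / x] is a Laurent polynomial of degree at most [d] in
    both directions, with extreme coefficients [H] and [1]. *)
Definition numerator (h : C -> C) (d : nat) (H : C) := exists (g : C -> C) (l : seq (C * int)),
  [/\ forall x, x != 0 -> h x = x * g x,
      forall x, g x = \sum_(p <- l) p.1 * x ^ p.2,
      forall p, p \in l -> (`|p.2| <= d)%N,
      \sum_(p <- l | p.2 == d%:Z) p.1 = H &
      \sum_(p <- l | p.2 == - d%:Z) p.1 = 1].

Lemma laur_numerator h d H : numerator h d H -> coordinate_laurent n h.
Proof.
move=> [g [l [hg gl _ _ _]]] i; split.
  apply: (@laurent_ext _ _ _ (fun z => z i * \sum_(p <- l) p.1 * mono (single i p.2) z)).
    move=> z nz; rewrite hg// gl; congr (_ * _); apply: eq_bigr => p _.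
    by rewrite mono_single.
  apply: laurM; first exact: laur_coord.
  by apply: laur_sum => p _; exact: laurent_mono.
apply: (@laurent_ext _ _ _ (fun z => (z i)^-1 * \sum_(p <- l) p.1 * mono (single i (- p.2)) z)).
  move=> z nz; rewrite hg ?invr_eq0// gl; congr (_ * _); apply: eq_bigr => p _.
  by rewrite mono_single exprz_inv.
apply: laurM; first exact: laur_coordV.
by apply: laur_sum => p _; exact: laurent_mono.
Qed.

Variables (q s kap : C) (k : nat) (h v w h' v' w' : C -> C) (d d' : nat) (H H' : C).
Hypotheses (s0 : s != 0) (sq : s ^+ 2 = q).
Hypotheses (wv : forall x, w x = (1 - x ^+ 2) * v x).
Hypotheses (wv' : forall x, w' x = (1 - x ^+ 2) * v' x).
Hypotheses (Lv : coordinate_laurent n v) (Lw : coordinate_laurent n w).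
Hypotheses (Lv' : coordinate_laurent n v') (Lw' : coordinate_laurent n w').
Hypotheses (hd : numerator h d H) (hd' : numerator h' d' H') (dd : (d + d' = 2)%N).
Hypothesis adj : forall x, x != 0 ->
  h (s * x)^-1 * v (s * x)^-1 * w (s * x) = kap * (h' x * v' x * w' x^-1).
Hypotheses (qr : q^* = q) (wr : forall x, (w x^*)^* = w x).
Hypothesis (hw : exists2 z : 'I_n -> C, nonzero z & half_weight q k w z != 0).

Variables (lam : part) (K : ('I_n -> C) -> C).
Hypotheses (lamP : is_partition lam) (KM : monic_form lam K).
Hypothesis (oK : orthogonal_to q k w' lam K).

(** Move the operator to the other side: its adjoint sends [msym nu] to orbit sums
    strictly dominated by [lam], to which [K] is orthogonal. *)
Lemma image_orthogonal (lc : seq (C * part)) nu : is_partition nu ->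
  (forall z, regular z -> qdiff h s (q ^+ k) K z = msum lc z) ->
  (forall j, (j <= n)%N -> (j + psum nu j <= d * j + psum lam j)%N) ->
  (exists2 j, (j <= n)%N & (j + psum nu j < d * j + psum lam j)%N) ->
  inner q k w (msum lc) (msym nu) = 0.
Proof.
move=> nuP KE le_nu [j0 j0n lt_nu].
have [g' [l' [hg' gl' ld' lt' lb']]] := hd'.
have [lc' [lcP' lcE' _]] := qdiff_expand (q ^+ k) hg' gl' ld' lt' lb' s0 nuP (msym_perm nu)
   (fun e => lead_msym R e nuP).
have := @adjointness R n q k s kap h v w h' v' w' s0 sq wv wv' (laur_numerator hd) Lv Lw
  (laur_numerator hd') Lv' Lw' adj K (msym nu) (msum lc) (msum lc') (monic_laur KM) (laur_msym R nu).
move=> ->; first last.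
- by move=> z rz; rewrite lcE'.
- by move=> z rz; rewrite KE.
- exact: laur_msum.
- exact: laur_msum.
- by move=> e z _; exact: msym_flip.
- by move=> e z _; exact: (monic_flip KM).
rewrite inner_sumr//; last exact: monic_laur KM.
rewrite big1_seq ?mulr0// => x /= xl; have [xP xK] := lcP' _ xl.
rewrite oK ?mulr0//; apply/sdominatedP; split=> //.
  move=> j jn; apply: dominance_step (le_nu j jn) (xK j jn).
  by rewrite -mulnDl dd.
apply: contraTneq lt_nu => xlam; have := xK j0 j0n; rewrite xlam.
by apply: dominance_step_strict; rewrite -mulnDl dd.
Qed.

Lemma qdiff_vanish : d = 0%N -> (exists i, lam i = 0%N) ->
  forall z, regular z -> qdiff h s (q ^+ k) K z = 0.
Proof.
move=> d0 [i0 li0] z rz.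
have [g [l [hg gl ld lt lb]]] := hd.
have [lc [lcP lcE _]] := qdiff_expand (q ^+ k) hg gl ld lt lb s0 lamP (monic_perm KM)
   (monic_lead lamP KM).
rewrite lcE//; apply: (posdef_msum Lw qr wr hw _ (regular_nonzero rz)) => x xl.
have [xP xK] := lcP _ xl; apply: (image_orthogonal xP lcE xK).
have strict j : (j <= n)%N -> (j + psum x.2 j <= psum lam j)%N.
  by move=> jn; have := xK j jn; rewrite d0.
(* The bound at [i0.+1] is the one that is strict at [i0], since [lam i0 = 0]. *)
exists i0; first exact: ltnW.
rewrite d0 mul0n add0n; have := strict i0.+1 (ltn_ord i0).
rewrite /psum !big_initS /= li0 add0n addSn; apply: leq_trans.
by rewrite ltnS leq_add2l leq_addl.
Qed.

(** The image of [K] minus the right multiple of [K'] is a combination of orbit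
    sums strictly dominated by [lam'] and is orthogonal to all of these. *)
Lemma qdiff_eigen (lam' : part) K' : is_partition lam' ->
  (forall i, (lam' i).+1 = lam i + d)%N ->
  monic_form lam' K' -> orthogonal_to q k w lam' K' ->
  forall z, regular z -> qdiff h s (q ^+ k) K z =
    \prod_(i < n) (s ^ (- (lam i)%:Z) - H * (q ^+ k) ^+ (n - i.+1) * s ^ (lam i)%:Z) * K' z.
Proof.
move=> l'P l'E KM' oK' z rz.
have [g [l [hg gl ld lt lb]]] := hd.
have [lc [lcP lcE lcT]] := qdiff_expand (q ^+ k) hg gl ld lt lb s0 lamP (monic_perm KM)
   (monic_lead lamP KM).
rewrite lcE// -(lcT _ l'P l'E); set T := \sum_(x <- lc | x.2 == lam') x.1.
have /monic_formP[lk lkP KE] := KM'.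
have pl' := psum_shift l'E.
pose lr := [seq x <- lc | x.2 != lam'] ++ [seq (- T * x.1, x.2) | x <- lk].
have lrE y : msum lr y = msum lc y + (- T) * K' y.
  rewrite KE mulrDr addrA /lr [LHS]/msum big_cat big_map; congr (_ + _); last first.
    by rewrite /msum mulr_sumr; apply: eq_bigr => x _; rewrite mulrA.
  rewrite big_filter /= [X in _ = X + _](bigID (fun x => x.2 == lam')) /=.
  rewrite [X in _ = X + _ + _](eq_bigr (fun x => x.1 * msym lam' y)); last by move=> x /eqP->.
  by rewrite -mulr_suml -/T mulNr addrAC subrr add0r.
have lrP x : x \in lr -> sdominated lam' x.2.
  rewrite mem_cat => /orP[|/mapP[y /lkP ? ->]//].
  rewrite mem_filter => /andP[xl' /lcP[xP xK]]; apply/sdominatedP; split=> // j jn.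
  by have := xK j jn; rewrite -pl'//; lia.
have LK' := monic_laur KM'.
suff : msum lr z = 0.
  rewrite lrE mulNr => /eqP; rewrite subr_eq0 => /eqP <-.
  by [].
apply: (posdef_msum Lw qr wr hw _ (regular_nonzero rz)) => x xl.
rewrite (@eq_inner _ _ _ _ _ _ (fun z => msum lc z + (- T) * K' z)); last first.
  by move=> y _; rewrite lrE.
rewrite innerDl//; last 3 first.
- exact: laur_msum.
- by apply: laurM => //; exact: laur_cst.
- exact: laur_msym.
have /sdominatedP[xP xK nx] := lrP _ xl.
rewrite (image_orthogonal xP lcE) ?add0r; last 2 first.
- by move=> j jn; rewrite -pl'// leq_add2l; exact: xK.
- apply: contrapT => nex; case/eqP: nx; apply: psum_inj => j jn.
  apply/eqP; rewrite eqn_leq xK//= leqNgt; apply/negP => lt1; apply: nex.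
  by exists j => //; rewrite -pl'// ltn_add2l.
by rewrite innerZl// ?oK' ?lrP ?mulr0//; exact: laur_msym.
Qed.

End Eigen.

(** * Infinite q-Pochhammer symbols *)

Section ComplexLimits.
Local Open Scope classical_set_scope.
Variable R : realType.
Local Notation C := R[i].
Implicit Types (x y : C) (u v : nat -> C).

Notation cnorm := (@normc R).

Lemma normr_cnorm x : `|x| = (cnorm x)%:C.
Proof. by rewrite normc_def; case: x. Qed.

Lemma cnorm_ge0 x : 0 <= cnorm x.
Proof. by case: x => a b; exact: sqrtr_ge0. Qed.

Lemma cnorm_lt x (e : R) : (`|x| < e%:C) = (cnorm x < e).
Proof. by rewrite normr_cnorm ltcR. Qed.

Lemma cnorm_real (a : R) : cnorm a%:C = `|a|.
Proof. by rewrite /= expr0n addr0 sqrtr_sqr. Qed.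

Lemma cnorm_le_ReIm x : cnorm x <= `|complex.Re x| + `|complex.Im x|.
Proof.
case: x => a b /=; rewrite -[X in _ <= X]ger0_norm ?addr_ge0// -sqrtr_sqr.
rewrite ler_wsqrtr// sqrrD !real_normK ?num_real// addrAC lerDl.
by rewrite mulrn_wge0// mulr_ge0.
Qed.

(** Convergence of complex sequences with real tolerances; the norm of a complex
    number is complex-valued in the topology of [R[i]]. *)
Definition tends_to u x := forall e : R, 0 < e ->
  exists N0, forall N, (N0 <= N)%N -> cnorm (u N - x) < e.

Lemma tends_toP u x : tends_to u x <-> ((u : nat -> R[i]^o) @ \oo --> (x : R[i]^o)).
Proof.
split=> [H|/cvgrPdist_lt H].
  apply/cvgrPdist_lt => e e0; have er : e = (complex.Re e)%:C.
    by move: e0; rewrite ltcE; case: e => a b /= /andP[/eqP -> _].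
  rewrite er; have e1 : 0 < complex.Re e by rewrite -ltcR -er.
  have [N0 HN] := H _ e1; exists N0 => // N /= N0N.
  by rewrite distrC cnorm_lt HN.
move=> e e0; have e1 : 0 < e%:C :> C by rewrite ltcR.
have [N0 _ HN] := H _ e1; exists N0 => N N0N.
by have := HN N N0N; rewrite /= distrC cnorm_lt.
Qed.

Lemma tends_to_lim u x : tends_to u x -> limn (u : nat -> R[i]^o) = x.
Proof. by move=> /tends_toP H; apply: cvg_lim => //; exact: norm_hausdorff. Qed.

Lemma tends_toM u v x y : tends_to u x -> tends_to v y -> tends_to (fun N => u N * v N) (x * y).
Proof.
move=> ux vy e e0; pose B := cnorm x + 1 + cnorm y.
have B0 : 0 < B by rewrite /B; have := cnorm_ge0 x; have := cnorm_ge0 y; lra.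
pose de := Num.min 1 (e / (2 * B)).
have de0 : 0 < de by rewrite lt_min ltr01 divr_gt0// mulr_gt0.
have [N1 H1] := ux _ de0; have [N2 H2] := vy _ de0.
exists (maxn N1 N2) => N; rewrite geq_max => /andP[n1 n2].
have {H1} h1 := H1 N n1; have {H2} h2 := H2 N n2.
have -> : u N * v N - x * y = u N * (v N - y) + y * (u N - x) by ring.
apply: le_lt_trans (le_normcD _ _) _; rewrite !normcM.
have de1 : de <= 1 by rewrite ge_min lexx.
have deB : de * B <= e / 2.
  have : de <= e / (2 * B) by rewrite ge_min lexx orbT.
  by rewrite ler_pdivlMr ?mulr_gt0// ler_pdivlMr// mulrCA mulrC.
have uN : cnorm (u N) <= cnorm x + 1.
  have := le_normcD (u N - x) x; rewrite subrK => h; lra.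
have p1 : cnorm (u N) * cnorm (v N - y) <= (cnorm x + 1) * de.
  by apply: ler_pM; rewrite ?cnorm_ge0// ltW.
have p2 : cnorm y * cnorm (u N - x) <= cnorm y * de.
  by rewrite ler_wpM2l ?cnorm_ge0// ltW.
have : (cnorm x + 1) * de + cnorm y * de = de * B by rewrite /B; ring.
lra.
Qed.

Lemma tends_toD u v x y : tends_to u x -> tends_to v y -> tends_to (fun N => u N + v N) (x + y).
Proof.
move=> ux vy e e0; have e2 : 0 < e / 2 by rewrite divr_gt0.
have [N1 H1] := ux _ e2; have [N2 H2] := vy _ e2.
exists (maxn N1 N2) => N; rewrite geq_max => /andP[n1 n2].
have {H1} h1 := H1 N n1; have {H2} h2 := H2 N n2.
rewrite opprD addrACA [e]splitr; apply: le_lt_trans (le_normcD _ _) _.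
exact: ltrD.
Qed.

Lemma tends_to_cst x : tends_to (fun=> x) x.
Proof. by move=> e e0; exists 0%N => N _; rewrite subrr cnorm_real normr0. Qed.

Lemma tends_to_sub u x (phi : nat -> nat) : (forall N, (N <= phi N)%N) ->
  tends_to u x -> tends_to (fun N => u (phi N)) x.
Proof.
move=> H ux e e0; have [N0 HN] := ux e e0; exists N0 => N N0N.
exact/HN/(leq_trans N0N).
Qed.

Lemma tends_to_unique u x y : tends_to u x -> tends_to u y -> x = y.
Proof. by move=> /tends_to_lim <- /tends_to_lim <-. Qed.

Lemma tends_to_ext u v x : u =1 v -> tends_to u x -> tends_to v x.
Proof. by move=> uv ux e /ux[N0 H]; exists N0 => N NN; rewrite -uv H. Qed.

Lemma tends_to_ge u x (b : R) : (forall N, b <= cnorm (u N)) -> tends_to u x -> b <= cnorm x.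
Proof.
move=> ub ux; rewrite leNgt; apply/negP => xb.
have [N0 HN] := ux (b - cnorm x) (ltac:(by rewrite subr_gt0)).
have := HN N0 (leqnn _); rewrite ltrBrDr => H.
have := le_lt_trans (le_normcD (u N0 - x) x) H; rewrite subrK ltNge.
by rewrite ub.
Qed.

(** Steps bounded by a geometric sequence make the real and imaginary parts
    absolutely convergent series. *)
Lemma tends_to_geometric u (a r : R) : 0 <= r < 1 ->
  (forall N, cnorm (u N.+1 - u N) <= a * r ^+ N) -> exists x, tends_to u x.
Proof.
move=> /andP[r0 r1] H.
have part (f : C -> R) : (forall x y, f (x - y) = f x - f y) ->
    (forall x, `|f x| <= cnorm x) -> cvgn (fun N => f (u N)).
  move=> fB fle; pose w := [sequence f (u N.+1) - f (u N)]_N.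
  have sw N : series w N = f (u N) - f (u 0%N).
    rewrite /series /=; elim: N => [|N IH]; first by rewrite big_geq// subrr.
    by rewrite big_nat_recr//= IH addrC subrKA.
  have cw : cvgn (series w).
    apply: normed_cvg; apply: (@series_le_cvg _ _ (geometric a r)).
    - by move=> N; rewrite /= normr_ge0.
    - by move=> N; rewrite /= (le_trans _ (H N))// cnorm_ge0.
    - by move=> N; rewrite /w /= -fB; exact: le_trans (fle _) (H N).
    - by apply: is_cvg_geometric_series; rewrite ger0_norm.
  have -> : (fun N => f (u N)) = (fun N => series w N + f (u 0%N)).
    by apply/funext => N; rewrite sw subrK.
  by apply: is_cvgD => //; exact: is_cvg_cst.
have cR : cvgn (fun N => complex.Re (u N)).
  apply: part; first by move=> [? ?] [? ?].
  move=> x; rewrite -lecR -normr_cnorm; exact: normc_ge_Re.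
have cI : cvgn (fun N => complex.Im (u N)).
  apply: part; first by move=> [? ?] [? ?].
  move=> [x y] /=; rewrite -sqrtr_sqr ler_wsqrtr// lerDr sqr_ge0//.
exists (limn (fun N => complex.Re (u N)) +i* limn (fun N => complex.Im (u N))) => e e0.
have e2 : 0 < e / 2 by rewrite divr_gt0.
move/cvgrPdist_lt: cR => /(_ _ e2)[N1 _ H1].
move/cvgrPdist_lt: cI => /(_ _ e2)[N2 _ H2].
exists (maxn N1 N2) => N; rewrite geq_max => /andP[n1 n2].
apply: le_lt_trans (cnorm_le_ReIm _) _.
have := H1 N n1; have := H2 N n2; rewrite /= !(distrC (limn _)).
case: (u N) => a0 b0 /= h2 h1; rewrite [e]splitr; exact: ltrD.
Qed.

End ComplexLimits.

Section InfinitePochhammer.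
Variable R : realType.
Local Notation C := R[i].
Notation cnorm := (@normc R).
Variables (q0 : R).
Hypotheses (q0_ge0 : 0 <= q0) (q0_le : q0 <= 4^-1).
Let q : C := q0%:C.

Lemma cnormX (x : C) m : cnorm (x ^+ m) = cnorm x ^+ m.
Proof. by elim: m => [|m IH]; rewrite ?expr0 ?normc1// !exprS normcM IH. Qed.

Let nq m : cnorm (q ^+ m) = q0 ^+ m.
Proof. by rewrite cnormX cnorm_real ger0_norm. Qed.

Let q0X_le1 m : q0 ^+ m <= 1.
Proof. by apply: exprn_ile1 => //; apply: le_trans q0_le _; rewrite invf_le1 ?ler1n. Qed.

(** For [q0 <= 1/4] the bound [3 - 4 * q0 ^+ m] reproduces itself from each number
    [m > 0] of factors to the next. *)
Lemma qpochn_bound (x : C) m : cnorm x <= 1 -> cnorm (qpochn q x m) <= 3.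
Proof.
move=> x1; suff H k : cnorm (qpochn q x k.+1) <= 3 - 4 * q0 ^+ k.+1.
  case: m => [|k]; first by rewrite /qpochn big_ord0 normc1 ler1n.
  by apply: le_trans (H k) _; rewrite gerBl mulr_ge0// exprn_ge0.
have step j : cnorm (1 - q ^+ j * x) <= 1 + q0 ^+ j.
  apply: le_trans (le_normcD _ _) _; rewrite normc1 lerD2l normcN normcM nq.
  by rewrite ler_piMr// exprn_ge0.
elim: k => [|k IH].
  rewrite /qpochn big_ord1 expr1; apply: le_trans (step 0%N) _; rewrite expr0.
  have := q0_le; lra.
rewrite qpochn_recr normcM; apply: (le_trans (ler_pM _ _ IH (step _))); rewrite ?cnorm_ge0//.
have y0 : 0 <= q0 ^+ k.+1 by exact: exprn_ge0.
rewrite [q0 ^+ k.+2]exprS; set y := q0 ^+ k.+1 in y0 *.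
have := mulr_ge0 y0 y0; have : q0 * y <= 4^-1 * y by rewrite ler_wpM2r.
nra.
Qed.

Lemma qpochn_tends (x : C) : cnorm x <= 1 -> tends_to (qpochn q x) (qpoch x q).
Proof.
move=> x1; have [l ul] : exists l, tends_to (qpochn q x) l.
  apply: (@tends_to_geometric R _ 3 q0).
    by rewrite q0_ge0 (le_lt_trans q0_le)// invf_lt1 ?ltr1n.
  move=> N; rewrite qpochn_recr.
  have -> : qpochn q x N * (1 - q ^+ N * x) - qpochn q x N = - (qpochn q x N * (q ^+ N * x)) by ring.
  rewrite normcN normcM ler_pM ?cnorm_ge0 ?qpochn_bound// normcM nq ler_piMr// exprn_ge0//.
by rewrite /qpoch (tends_to_lim ul).
Qed.

(** The product of the [1 - y_j] is at least [1 - \sum_j y_j], and here the sum is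
    at most [2/3]. *)
Lemma qpochn_lower (x : C) m : cnorm x <= 2^-1 -> 3^-1 <= cnorm (qpochn q x m).
Proof.
move=> x1; suff H k : 1 - cnorm x * \sum_(j < k) q0 ^+ j <= cnorm (qpochn q x k) /\
    \sum_(j < k) q0 ^+ j <= 4 / 3 - 4 / 3 * q0 ^+ k.
  have [h1 h2] := H m; apply: le_trans h1.
  have : cnorm x * \sum_(j < m) q0 ^+ j <= 2^-1 * (4 / 3).
    apply: ler_pM; rewrite ?cnorm_ge0//.
      by rewrite sumr_ge0// => j _; exact: exprn_ge0.
    by apply: le_trans h2 _; have := exprn_ge0 m q0_ge0; lra.
  lra.
elim: k => [|k [IH1 IH2]].
  by rewrite big_ord0 mulr0 subr0 /qpochn big_ord0 normc1 expr0; split=> //; lra.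
have y0 : 0 <= q0 ^+ k by exact: exprn_ge0.
rewrite !big_ord_recr /=; split; last first.
  have : q0 ^+ k.+1 <= 4^-1 * q0 ^+ k by rewrite exprS ler_wpM2r.
  lra.
rewrite qpochn_recr normcM; set S := \sum_(j < k) _ in IH1 IH2 *.
have S0 : 0 <= S by rewrite /S sumr_ge0// => j _; exact: exprn_ge0.
have low : 1 - q0 ^+ k * cnorm x <= cnorm (1 - q ^+ k * x).
  have := le_normcD (1 - q ^+ k * x) (q ^+ k * x).
  by rewrite subrK normc1 normcM nq; lra.
have nx := cnorm_ge0 x; have yl := q0X_le1 k.
have p1 : 0 <= 1 - q0 ^+ k * cnorm x by nra.
have p2 : 0 <= 1 - cnorm x * S.
  have : cnorm x * S <= 2^-1 * (4 / 3) by apply: ler_pM => //; lra.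
  lra.
apply: le_trans (ler_pM p2 p1 IH1 low).
have := mulr_ge0 (mulr_ge0 nx S0) (mulr_ge0 y0 nx); nra.
Qed.

Lemma qpoch_neq0 (x : C) : cnorm x <= 2^-1 -> qpoch x q != 0.
Proof.
move=> x1; have H : 3^-1 <= cnorm (qpoch x q).
  apply: (@tends_to_ge _ (qpochn q x)); first by move=> N; exact: qpochn_lower.
  by apply: qpochn_tends; apply: le_trans x1 _; rewrite invf_le1 ?ler1n.
by apply: contraTneq H => ->; rewrite cnorm_real normr0 -ltNge invr_gt0.
Qed.

Lemma qpochn_add (x : C) a N : qpochn q x (a + N) = qpochn q x a * qpochn q (q ^+ a * x) N.
Proof.
rewrite /qpochn big_split_ord /=; congr (_ * _); apply: eq_bigr => j _.
by rewrite mulrA -exprD addnC.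
Qed.

Lemma qpoch_shift (x : C) a : cnorm x <= 1 -> qpoch x q = qpochn q x a * qpoch (q ^+ a * x) q.
Proof.
move=> x1; have x1' : cnorm (q ^+ a * x) <= 1.
  by rewrite normcM nq mulr_ile1 ?exprn_ge0 ?cnorm_ge0.
apply: (@tends_to_unique R (fun N => qpochn q x (a + N))).
  by apply: (@tends_to_sub R (qpochn q x) _ (addn a)) (qpochn_tends x1) => N; exact: leq_addl.
apply: (@tends_to_ext _ (fun N => qpochn q x a * qpochn q (q ^+ a * x) N)).
  by move=> N; rewrite qpochn_add.
by apply: tends_toM; [exact: tends_to_cst|exact: qpochn_tends].
Qed.

(** [1 - q ^+ (2 j) * x ^+ 2] and [1 - q ^+ (2 j + 1) * x ^+ 2] factor over [x] and
    [s * x] respectively.  This splits the numerator of the density into four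
    symbols, one for each parameter. *)
Lemma qpoch_square (s x : C) : s ^+ 2 = q -> cnorm s <= 1 -> cnorm x <= 1 ->
  qpoch (x ^+ 2) q = qpoch x q * qpoch (- x) q * qpoch (s * x) q * qpoch (- (s * x)) q.
Proof.
move=> sq s1 x1.
have sx1 : cnorm (s * x) <= 1 by rewrite normcM mulr_ile1 ?cnorm_ge0.
have xx1 : cnorm (x ^+ 2) <= 1 by rewrite cnormX exprn_ile1 ?cnorm_ge0.
apply: (@tends_to_unique R (fun N => qpochn q (x ^+ 2) N.*2)).
  by apply: (@tends_to_sub R (qpochn q (x ^+ 2)) _ double) (qpochn_tends xx1) => N; rewrite -addnn leq_addr.
apply: (@tends_to_ext _ (fun N => qpochn q x N * qpochn q (- x) N * qpochn q (s * x) N * qpochn q (- (s * x)) N)).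
  elim=> [|N IH]; first by rewrite /qpochn !big_ord0 !mulr1.
  rewrite doubleS !qpochn_recr -IH -addnn !exprS exprD -sq; ring.
do 3 ?[apply: tends_toM]; apply: qpochn_tends => //; by rewrite normcN.
Qed.

End InfinitePochhammer.

(** * The three identities at special parameters *)

Section Numerators.
Variable R : realType.
Local Notation C := R[i].

Lemma numerator_minus : @numerator R (fun x => x) 0 1.
Proof.
exists (fun=> 1), [:: (1, 0)]; split.
- by move=> x _; rewrite mulr1.
- by move=> x; rewrite big_seq1 /= mulr1.
- by move=> p; rewrite inE => /eqP->.
- by rewrite big_cons big_nil /= addr0.
- by rewrite big_cons big_nil /= addr0.
Qed.

Lemma numerator_zero (a b : C) :
  @numerator R (fun x => (1 - a * x) * (1 - b * x)) 1 (a * b).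
Proof.
exists (fun x => \sum_(p <- [:: (1, -1); (- (a + b), 0); (a * b, 1)]) p.1 * x ^ p.2).
exists [:: (1, -1); (- (a + b), 0); (a * b, 1)]; split=> //.
- move=> x x0; rewrite !big_cons big_nil /= exprN1 expr0z expr1z; by field.
- by move=> p; rewrite !inE => /or3P[] /eqP->.
- by rewrite !big_cons big_nil /= addr0.
- by rewrite !big_cons big_nil /= addr0.
Qed.

Lemma numerator_plus (a b c d : C) :
  @numerator R (fun x => (1 - a * x) * (1 - b * x) * (1 - c * x) * (1 - d * x) / x) 2 (a * b * c * d).
Proof.
pose l : seq (C * int) := [:: (1, -2); (- (a + b + c + d), -1);
   (a * b + a * c + a * d + b * c + b * d + c * d, 0);
   (- (a * b * c + a * b * d + a * c * d + b * c * d), 1); (a * b * c * d, 2)].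
exists (fun x => \sum_(p <- l) p.1 * x ^ p.2), l; split=> //.
- move=> x x0; rewrite /l !big_cons big_nil /= exprN1 expr0z expr1z.
  rewrite -[x ^ 2]exprnP -[x ^ -2]exprnN; by field.
- by move=> p; rewrite !inE => /orP[|/orP[|/or3P[]]] /eqP->.
- by rewrite !big_cons big_nil /= addr0.
- by rewrite !big_cons big_nil /= addr0.
Qed.

End Numerators.

Lemma cancel_four (F : fieldType) (p1 p2 p3 p4 n1 n2 n3 n4 : F) :
  n1 != 0 -> n2 != 0 -> n3 != 0 -> n4 != 0 ->
  p1 * n1 * (p2 * n2) * (p3 * n3 * (p4 * n4)) / (n1 * n2 * (n3 * n4)) = p1 * p4 * p2 * p3.
Proof. by move=> h1 h2 h3 h4; field; rewrite h1 h2 h3 h4. Qed.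

Section Special.
Variables (R : realType) (n : nat) (r : R) (k : nat).
Hypotheses (r_gt0 : 0 < r) (r_le : r <= 2^-1).
Local Notation C := R[i].
Local Notation cnorm := (@normc R).
Variables (s q : C).
Hypotheses (sE : s = r%:C) (sq : s ^+ 2 = q).

Lemma q_real : q = (r ^+ 2)%:C.
Proof. by rewrite -sq sE -rmorphXn. Qed.

Let q0_le : r ^+ 2 <= 4^-1.
Proof.
have := r_gt0; have := r_le; rewrite expr2; nra.
Qed.

Let q0_ge0 : 0 <= r ^+ 2.
Proof. exact: sqr_ge0. Qed.

Let s_neq0 : s != 0.
Proof. by rewrite sE fmorph_eq0 gt_eqF. Qed.

Let cnorm_s : cnorm s = r.
Proof. by rewrite sE cnorm_real gtr0_norm. Qed.

Let cnorm_q : cnorm q = r ^+ 2.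
Proof. by rewrite q_real cnorm_real ger0_norm. Qed.

(** The one-variable factor of the weight: the quotient of the four symbols from
    [qpoch_square] by those with parameters [q ^+ a, - q ^+ b, s * q ^+ c,
    - s * q ^+ d]. *)
Definition w4 (a b c d : nat) (x : C) : C :=
  qpochn q x a * qpochn q (- x) b * qpochn q (s * x) c * qpochn q (- (s * x)) d.

Definition v4 (a b c d : nat) (x : C) : C :=
  qpochn q (q * x) a * qpochn q (- (q * x)) b * qpochn q (s * x) c * qpochn q (- (s * x)) d.

Lemma w4_v4 a b c d x : w4 a.+1 b.+1 c d x = (1 - x ^+ 2) * v4 a b c d x.
Proof. by rewrite /w4 !qpochn_recl mulrN /v4; ring. Qed.

Lemma laur_scaled (a : C) (i : 'I_n) (m : nat) : laur (fun z : 'I_n -> C => qpochn q (a * z i) m).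
Proof. by apply: laur_qpochn; apply: laurM; [exact: laur_cst|exact: laur_coord]. Qed.

Lemma laur_scaledV (a : C) (i : 'I_n) (m : nat) : laur (fun z : 'I_n -> C => qpochn q (a / z i) m).
Proof. by apply: laur_qpochn; apply: laurM; [exact: laur_cst|exact: laur_coordV]. Qed.

Lemma laur_four (a1 a2 a3 a4 : C) (m1 m2 m3 m4 : nat) :
  coordinate_laurent n (fun x => qpochn q (a1 * x) m1 * qpochn q (a2 * x) m2 * qpochn q (a3 * x) m3 * qpochn q (a4 * x) m4).
Proof.
move=> i; split.
  by apply: laurM; [apply: laurM; [apply: laurM|]|]; exact: laur_scaled.
by apply: laurM; [apply: laurM; [apply: laurM|]|]; exact: laur_scaledV.
Qed.

Lemma laur_w4 a b c d : coordinate_laurent n (w4 a b c d).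
Proof.
have := laur_four 1 (-1) s (-s) a b c d; congr coordinate_laurent.
by apply/funext => x; rewrite /w4 mul1r mulN1r mulNr.
Qed.

Lemma laur_v4 a b c d : coordinate_laurent n (v4 a b c d).
Proof.
have := laur_four q (-q) s (-s) a b c d; congr coordinate_laurent.
by apply/funext => x; rewrite /v4 !mulNr.
Qed.

Let q_conj : q^* = q.
Proof. by rewrite q_real conjc_real. Qed.

Let s_conj : s^* = s.
Proof. by rewrite sE conjc_real. Qed.

Lemma w4_conj a b c d x : (w4 a b c d x^*)^* = w4 a b c d x.
Proof.
by rewrite /w4 !rmorphM /= !qpochn_conj// !rmorphN /= !rmorphM /= !conjcK s_conj.
Qed.

(** No factor vanishes at an increasing sequence of points of the open interval
    from 0 to 1. *)
Lemma half_weight_w4_neq0 a b c d :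
  exists2 v : 'I_n -> C, nonzero v & half_weight q k (w4 a b c d) v != 0.
Proof.
have q1 : `|q| < 1.
  rewrite (_ : 1 = 1%:C) // cnorm_lt cnorm_q; have := q0_le; lra.
have s1 : `|s| <= 1.
  rewrite (_ : 1 = 1%:C) // normr_cnorm lecR cnorm_s; have := r_le; lra.
pose v (i : 'I_n) : C := i.+1%:R / n.+1%:R.
have n0 : 0 < n.+1%:R :> C by rewrite ltr0n.
have v0 i : 0 < v i by rewrite divr_gt0// ltr0n.
have v1 i : `|v i| < 1.
  by rewrite gtr0_norm// ltr_pdivrMr// mul1r ltr_nat ltnS.
exists v; first by move=> i; rewrite gt_eqF.
have sv1 i : `|s * v i| < 1 by rewrite normrM; apply: le_lt_trans (v1 i); rewrite ler_piMl.
rewrite mulf_neq0//; apply/prodf_neq0 => i _.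
  by rewrite /w4 !mulf_neq0 ?qpochn_neq0 ?normrN.
apply/prodf_neq0 => j ij; rewrite mulf_neq0 ?qpochn_neq0//.
  by rewrite normrM; apply: le_lt_trans (v1 j); rewrite ler_piMl// ltW.
rewrite normrM normrV ?unitfE ?gt_eqF// !gtr0_norm//.
rewrite ltr_pdivrMr// mul1r ltr_pM2r ?invr_gt0// ltr_nat //.
Qed.

Let unit_cnorm (x : C) : `|x| = 1 -> cnorm x = 1.
Proof. by rewrite normr_cnorm => -[]. Qed.

Let qX_small (x : C) m : cnorm x = 1 -> cnorm (q ^+ m.+1 * x) <= 2^-1.
Proof.
move=> x1; rewrite normcM x1 mulr1 cnormX cnorm_q exprS.
have : (r ^+ 2) ^+ m <= 1 by rewrite exprn_ile1//; have := q0_le; lra.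
have : 0 <= (r ^+ 2) ^+ m by rewrite exprn_ge0.
have := q0_le; have := q0_ge0; nra.
Qed.

Let sqX_small (x : C) m : cnorm x = 1 -> cnorm (s * q ^+ m * x) <= 2^-1.
Proof.
move=> x1; rewrite !normcM x1 mulr1 cnormX cnorm_q cnorm_s.
have : (r ^+ 2) ^+ m <= 1 by rewrite exprn_ile1//; have := q0_le; lra.
have : 0 <= (r ^+ 2) ^+ m by rewrite exprn_ge0.
have := r_le; have := r_gt0; nra.
Qed.

Let qpoch_shift_q (y : C) m : cnorm y <= 1 -> qpoch y q = qpochn q y m * qpoch (q ^+ m * y) q.
Proof. by rewrite q_real; exact: qpoch_shift. Qed.

Let qpoch_square_q (y : C) : cnorm y <= 1 ->
  qpoch (y ^+ 2) q = qpoch y q * qpoch (- y) q * qpoch (s * y) q * qpoch (- (s * y)) q.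
Proof.
move=> y1; rewrite q_real; apply: qpoch_square; rewrite ?sq ?q_real ?cnorm_s//.
by have := r_le; lra.
Qed.

Let nonzero_small (y : C) : cnorm y <= 2^-1 -> qpoch y q != 0.
Proof. by rewrite q_real; exact: qpoch_neq0. Qed.

Lemma qpoch_ratio (x : C) a b c d : `|x| = 1 ->
  qpoch (x ^+ 2) q = w4 a.+1 b.+1 c d x *
    (qpoch (q ^+ a.+1 * x) q * qpoch (- q ^+ b.+1 * x) q *
     qpoch (s * q ^+ c * x) q * qpoch (- (s * q ^+ d) * x) q) /\
  qpoch (q ^+ a.+1 * x) q * qpoch (- q ^+ b.+1 * x) q *
     qpoch (s * q ^+ c * x) q * qpoch (- (s * q ^+ d) * x) q != 0.
Proof.
move=> /unit_cnorm x1; have s1 : cnorm s <= 1 by rewrite cnorm_s; have := r_le; lra.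
have x1' : cnorm x <= 1 by rewrite x1.
have nx1 : cnorm (- x) <= 1 by rewrite normcN.
have sx1 : cnorm (s * x) <= 1 by rewrite normcM x1 mulr1.
have nsx1 : cnorm (- (s * x)) <= 1 by rewrite normcN.
split; last first.
  rewrite !mulf_neq0 ?nonzero_small// ?mulNr ?normcN ?qX_small ?sqX_small//.
rewrite (qpoch_square_q x1') (qpoch_shift_q a.+1 x1') (qpoch_shift_q b.+1 nx1).
rewrite (qpoch_shift_q c sx1) (qpoch_shift_q d nsx1).
rewrite /w4 !mulrN !mulNr !mulrA [q ^+ c * s]mulrC [q ^+ d * s]mulrC.
by ring.
Qed.

Lemma pair_ratio (x : C) : `|x| = 1 ->
  qpoch x q = qpochn q x k * qpoch (q ^+ k * x) q.
Proof.
by move=> /unit_cnorm x1; apply: qpoch_shift_q; rewrite x1.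
Qed.

Lemma densityE a b c d (z : 'I_n -> C) : (0 < k)%N -> (forall i, `|z i| = 1) ->
  koornwinder_density (q ^+ a.+1) (- q ^+ b.+1) (s * q ^+ c) (- (s * q ^+ d)) q (q ^+ k) z =
  weight q k (w4 a.+1 b.+1 c d) z.
Proof.
move=> k0 z1; rewrite /koornwinder_density /weight /pm.
have zV1 i : `|(z i)^-1| = 1 by rewrite normfV z1 invr1.
congr (_ * _); apply: eq_bigr => i _.
  rewrite !big_cons !big_nil !mulr1.
  have [E1 N1] := @qpoch_ratio (z i) a b c d (z1 i).
  have [E2 N2] := @qpoch_ratio (z i)^-1 a b c d (zV1 i).
  rewrite E1 E2 mulrACA mulfK// mulf_neq0//.
apply: eq_bigr => j _; rewrite !big_cons !big_nil !mulr1 /pair_weight mul1r.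
have H (x y : C) : `|x| = 1 -> `|y| = 1 ->
   qpoch (x * y) q = qpochn q (x * y) k * qpoch (q ^+ k * x * y) q /\ qpoch (q ^+ k * x * y) q != 0.
  move=> x1 y1; have xy1 : `|x * y| = 1 by rewrite normrM x1 y1 mulr1.
  rewrite (pair_ratio xy1) mulrA; split=> //.
  have -> : k = k.-1.+1 by rewrite prednK.
  by rewrite nonzero_small// -mulrA qX_small// unit_cnorm.
have [-> N1] := H _ _ (z1 i) (z1 j).
have [-> N2] := H _ _ (z1 i) (zV1 j).
have [-> N3] := H _ _ (zV1 i) (z1 j).
have [-> N4] := H _ _ (zV1 i) (zV1 j).
have -> : (z i * z j)^-1 = (z i)^-1 * (z j)^-1 by rewrite invfM.
have -> : z j / z i = (z i)^-1 * z j by rewrite mulrC.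
exact: cancel_four.
Qed.

Lemma density_swap (t0 t1 t2 t3 t' : C) (z : 'I_n -> C) :
  koornwinder_density t0 t1 t2 t3 q t' z = koornwinder_density t2 t3 t0 t1 q t' z.
Proof.
congr (_ * _); apply: eq_bigr => i _; congr (_ / _); apply: eq_bigr => x _.
by rewrite -mulrA mulrC mulrA.
Qed.

(** The four parameters at which the density on the torus is the Laurent
    polynomial with one-variable factor [w]. *)
Definition special (w : C -> C) (t0 t1 t2 t3 : C) :=
  [/\ coordinate_laurent n w, forall x, (w x^*)^* = w x,
      exists2 v : 'I_n -> C, nonzero v & half_weight q k w v != 0 &
      forall z : 'I_n -> C, (forall i, `|z i| = 1) ->
        koornwinder_density t0 t1 t2 t3 q (q ^+ k) z = weight q k w z].

Lemma specialA a b c d : (0 < k)%N ->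
  special (w4 a.+1 b.+1 c d) (q ^+ a.+1) (- q ^+ b.+1) (s * q ^+ c) (- (s * q ^+ d)).
Proof.
move=> k0; split; [exact: laur_w4|exact: w4_conj|exact: half_weight_w4_neq0|].
by move=> z z1; exact: densityE.
Qed.

Lemma specialB a b c d : (0 < k)%N ->
  special (w4 c.+1 d.+1 a b) (s * q ^+ a) (- (s * q ^+ b)) (q ^+ c.+1) (- q ^+ d.+1).
Proof.
move=> k0; split; [exact: laur_w4|exact: w4_conj|exact: half_weight_w4_neq0|].
by move=> z z1; rewrite density_swap densityE.
Qed.

Section SpecialOrthogonality.
Variables (w : C -> C) (t0 t1 t2 t3 : C).
Hypothesis sp : special w t0 t1 t2 t3.

Lemma special_orthogonal lam (K : ('I_n -> C) -> C) :
  torus_orthogonal lam t0 t1 t2 t3 q (q ^+ k) K <-> orthogonal_to q k w lam K.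
Proof.
have [_ _ _ dE] := sp; split=> H mu /H <-; apply: torus_integral_ext => z z1;
by rewrite dE.
Qed.

Lemma special_koornwinder lam : exists K, @koornwinder_torus R n lam t0 t1 t2 t3 q (q ^+ k) K.
Proof.
have [Lw wr hw _] := sp; have [K KM oK] := orthogonal_exists Lw q_conj wr hw lam.
exists K; split=> //; first exact/special_orthogonal.
by move=> L LM /special_orthogonal oL; exact: orthogonal_unique oL.
Qed.

End SpecialOrthogonality.

Section Identities.
Variables (a b c d : nat).
Hypothesis k_gt0 : (0 < k)%N.

Let hplus (x : C) : C := (1 - q ^+ a.+1 * x) * (1 - - q ^+ b.+1 * x) *
  (1 - s * q ^+ c * x) * (1 - - (s * q ^+ d) * x) / x.

Let arg_q (x : C) : x != 0 -> q * (s * x)^-1 = s * x^-1.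
Proof. by move=> x0; rewrite -sq; field; rewrite x0 s_neq0. Qed.

Let arg_s (x : C) : x != 0 -> s * (s * x)^-1 = x^-1.
Proof. by move=> x0; field; rewrite x0 s_neq0. Qed.

Let arg_ss (x : C) : s * (s * x) = q * x.
Proof. by rewrite -sq; ring. Qed.

Let hv_plus (x : C) : hplus x * v4 a b c d x =
  x^-1 * (qpochn q (q * x) a.+1 * qpochn q (- (q * x)) b.+1 * qpochn q (s * x) c.+1 * qpochn q (- (s * x)) d.+1).
Proof.
rewrite /hplus /v4 !qpochn_recr.
have -> : 1 - q ^+ a * (q * x) = 1 - q ^+ a.+1 * x by rewrite exprSr mulrA.
have -> : 1 - q ^+ b * - (q * x) = 1 - - q ^+ b.+1 * x by rewrite mulrN mulNr exprSr mulrA.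
have -> : 1 - q ^+ c * (s * x) = 1 - s * q ^+ c * x by rewrite mulrCA mulrA.
have -> : 1 - q ^+ d * - (s * x) = 1 - - (s * q ^+ d) * x by rewrite mulrN mulNr mulrCA mulrA.
ring.
Qed.

(** Both sides are the same product of eight q-Pochhammer symbols, because
    [x -> 1 / (s * x)] exchanges [q * x] with [s / x] and [s * x] with [1 / x]. *)
Lemma adj_minus (x : C) : x != 0 ->
  (s * x)^-1 * v4 c d a.+1 b.+1 (s * x)^-1 * w4 c.+1 d.+1 a.+1 b.+1 (s * x) =
  s^-1 * (hplus x * v4 a b c d x * w4 a.+1 b.+1 c d x^-1).
Proof.
move=> x0; rewrite hv_plus /v4 /w4 !arg_q// !arg_s// !arg_ss invfM; ring.
Qed.

(** This is [adj_minus] read at the point [1 / (s * x)]. *)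
Lemma adj_plus (x : C) : x != 0 ->
  hplus (s * x)^-1 * v4 a b c d (s * x)^-1 * w4 a.+1 b.+1 c d (s * x) =
  s * (x * v4 c d a.+1 b.+1 x * w4 c.+1 d.+1 a.+1 b.+1 x^-1).
Proof.
move=> x0; have y0 : (s * x)^-1 != 0 by rewrite invr_eq0 mulf_neq0.
have := adj_minus y0; have -> : s * (s * x)^-1 = x^-1 by exact: arg_s.
by rewrite !invrK => ->; rewrite mulVKf.
Qed.

Lemma adj_zero (x : C) : x != 0 ->
  (1 - q ^+ a.+1 * (s * x)^-1) * (1 - - q ^+ b.+1 * (s * x)^-1) *
    v4 a b c.+1 d.+1 (s * x)^-1 * w4 a.+1 b.+1 c.+1 d.+1 (s * x) =
  1 * ((1 - q ^+ c.+1 * x) * (1 - - q ^+ d.+1 * x) *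
    v4 c d a.+1 b.+1 x * w4 c.+1 d.+1 a.+1 b.+1 x^-1).
Proof.
have hv a' b' c' d' (y : C) : (1 - q ^+ a'.+1 * y) * (1 - - q ^+ b'.+1 * y) * v4 a' b' c' d' y =
    qpochn q (q * y) a'.+1 * qpochn q (- (q * y)) b'.+1 * qpochn q (s * y) c' * qpochn q (- (s * y)) d'.
  rewrite /v4 !qpochn_recr.
  have -> : 1 - q ^+ a' * (q * y) = 1 - q ^+ a'.+1 * y by rewrite exprSr mulrA.
  have -> : 1 - q ^+ b' * - (q * y) = 1 - - q ^+ b'.+1 * y by rewrite mulrN mulNr exprSr mulrA.
  ring.
move=> x0; rewrite !hv /w4 !arg_q// !arg_s// !arg_ss; ring.
Qed.

Variables (lam : {ffun 'I_n -> nat}).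
Hypothesis lamP : is_partition lam.

Lemma shift_factor (H : C) :
  \prod_(i < n) (s ^ (- (lam i)%:Z) - H * (q ^+ k) ^+ (n - i.+1) * s ^ (lam i)%:Z) =
  s ^- psize lam * \prod_(i < n) (1 - q ^+ lam i * (q ^+ k) ^+ (n - i.+1) * H).
Proof.
have -> : s ^- psize lam = \prod_(i < n) s ^- lam i by rewrite prodfV prodrXr.
rewrite -big_split; apply: eq_bigr => i _ /=.
rewrite -exprnN -exprnP mulrBr mulr1; congr (_ - _).
have -> : q ^+ lam i = s ^+ lam i * s ^+ lam i by rewrite -sq -exprM mulnC exprM expr2.
by rewrite !mulrA mulVf ?expf_neq0// mul1r; ring.
Qed.

Lemma special_minus K K' : monic_form lam K ->
  torus_orthogonal lam (q ^+ a.+1) (- q ^+ b.+1) (s * q ^+ c) (- (s * q ^+ d)) q (q ^+ k) K ->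
  (forall i, 0 < lam i)%N -> is_partition (part_pred lam) -> monic_form (part_pred lam) K' ->
  torus_orthogonal (part_pred lam) (s * q ^+ a.+1) (- (s * q ^+ b.+1)) (q ^+ c.+1) (- q ^+ d.+1) q (q ^+ k) K' ->
  forall z, regular z -> qdiff (fun x => x) s (q ^+ k) K z =
    s ^- psize lam * \prod_(i < n) (1 - q ^+ lam i * (q ^+ k) ^+ (n - i.+1) * 1) * K' z.
Proof.
move=> KM oK lam0 pP K'M oK' z rz; rewrite -shift_factor.
have spA := specialA a b c d k_gt0; have spB := specialB a.+1 b.+1 c d k_gt0.
have [Lw wr hw _] := spB; have [Lw' _ _ _] := spA.
have oKw := (special_orthogonal spA lam K).1 oK.
have oKw' := (special_orthogonal spB _ K').1 oK'.
have le_i i : ((part_pred lam) i).+1 = (lam i + 0)%N by rewrite ffunE addn0 prednK.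
exact: (@qdiff_eigen R n q s _ k _ (v4 c d a.+1 b.+1) (w4 c.+1 d.+1 a.+1 b.+1)
  hplus (v4 a b c d) (w4 a.+1 b.+1 c d) 0 2 _ _ s_neq0 sq
  (w4_v4 _ _ _ _) (w4_v4 _ _ _ _) (laur_v4 _ _ _ _) Lw (laur_v4 _ _ _ _) Lw' (numerator_minus R) (numerator_plus _ _ _ _) erefl
  adj_minus q_conj wr hw lam K lamP KM oKw
  (part_pred lam) K' pP le_i K'M oKw' z rz).
Qed.

Lemma special_minus0 K : monic_form lam K ->
  torus_orthogonal lam (q ^+ a.+1) (- q ^+ b.+1) (s * q ^+ c) (- (s * q ^+ d)) q (q ^+ k) K ->
  (exists i, lam i = 0%N) ->
  forall z, regular z -> qdiff (fun x => x) s (q ^+ k) K z = 0.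
Proof.
move=> KM oK lam0 z rz.
have spA := specialA a b c d k_gt0; have spB := specialB a.+1 b.+1 c d k_gt0.
have [Lw wr hw _] := spB; have [Lw' _ _ _] := spA.
have oKw := (special_orthogonal spA lam K).1 oK.
exact: (@qdiff_vanish R n q s _ k _ (v4 c d a.+1 b.+1) (w4 c.+1 d.+1 a.+1 b.+1)
  hplus (v4 a b c d) (w4 a.+1 b.+1 c d) 0 2 _ _ s_neq0 sq
  (w4_v4 _ _ _ _) (w4_v4 _ _ _ _) (laur_v4 _ _ _ _) Lw (laur_v4 _ _ _ _) Lw' (numerator_minus R) (numerator_plus _ _ _ _) erefl
  adj_minus q_conj wr hw lam K lamP KM oKw erefl lam0 z rz).
Qed.

Lemma special_plus K K' : monic_form lam K ->
  torus_orthogonal lam (s * q ^+ a.+1) (- (s * q ^+ b.+1)) (q ^+ c.+1) (- q ^+ d.+1) q (q ^+ k) K ->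
  is_partition (part_succ lam) -> monic_form (part_succ lam) K' ->
  torus_orthogonal (part_succ lam) (q ^+ a.+1) (- q ^+ b.+1) (s * q ^+ c) (- (s * q ^+ d)) q (q ^+ k) K' ->
  forall z, regular z -> qdiff hplus s (q ^+ k) K z =
    s ^- psize lam * \prod_(i < n) (1 - q ^+ lam i * (q ^+ k) ^+ (n - i.+1) *
       (q ^+ a.+1 * - q ^+ b.+1 * (s * q ^+ c) * (- (s * q ^+ d)))) * K' z.
Proof.
move=> KM oK pP K'M oK' z rz; rewrite -shift_factor.
have spA := specialA a b c d k_gt0; have spB := specialB a.+1 b.+1 c d k_gt0.
have [Lw' _ _ _] := spB; have [Lw wr hw _] := spA.
have oKw := (special_orthogonal spB lam K).1 oK.
have oKw' := (special_orthogonal spA _ K').1 oK'.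
have le_i i : ((part_succ lam) i).+1 = (lam i + 2)%N by rewrite ffunE addn2.
exact: (@qdiff_eigen R n q s _ k _ (v4 a b c d) (w4 a.+1 b.+1 c d)
  (fun x => x) (v4 c d a.+1 b.+1) (w4 c.+1 d.+1 a.+1 b.+1) 2 0 _ _ s_neq0 sq
  (w4_v4 _ _ _ _) (w4_v4 _ _ _ _) (laur_v4 _ _ _ _) Lw (laur_v4 _ _ _ _) Lw' (numerator_plus _ _ _ _) (numerator_minus R) erefl
  adj_plus q_conj wr hw lam K lamP KM oKw
  (part_succ lam) K' pP le_i K'M oKw' z rz).
Qed.

Lemma special_zero K K' : monic_form lam K ->
  torus_orthogonal lam (s * q ^+ a.+1) (- (s * q ^+ b.+1)) (q ^+ c.+1) (- q ^+ d.+1) q (q ^+ k) K ->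
  monic_form lam K' ->
  torus_orthogonal lam (q ^+ a.+1) (- q ^+ b.+1) (s * q ^+ c.+1) (- (s * q ^+ d.+1)) q (q ^+ k) K' ->
  forall z, regular z ->
    qdiff (fun x => (1 - q ^+ a.+1 * x) * (1 - - q ^+ b.+1 * x)) s (q ^+ k) K z =
    s ^- psize lam * \prod_(i < n) (1 - q ^+ lam i * (q ^+ k) ^+ (n - i.+1) *
       (q ^+ a.+1 * - q ^+ b.+1)) * K' z.
Proof.
move=> KM oK K'M oK' z rz; rewrite -shift_factor.
have spA := specialA a b c.+1 d.+1 k_gt0; have spB := specialB a.+1 b.+1 c d k_gt0.
have [Lw' _ _ _] := spB; have [Lw wr hw _] := spA.
have oKw := (special_orthogonal spB lam K).1 oK.
have oKw' := (special_orthogonal spA _ K').1 oK'.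
have le_i i : (lam i).+1 = (lam i + 1)%N by rewrite addn1.
exact: (@qdiff_eigen R n q s _ k _ (v4 a b c.+1 d.+1) (w4 a.+1 b.+1 c.+1 d.+1)
  (fun x => (1 - q ^+ c.+1 * x) * (1 - - q ^+ d.+1 * x)) (v4 c d a.+1 b.+1) (w4 c.+1 d.+1 a.+1 b.+1) 1 1 _ _ s_neq0 sq
  (w4_v4 _ _ _ _) (w4_v4 _ _ _ _) (laur_v4 _ _ _ _) Lw (laur_v4 _ _ _ _) Lw' (numerator_zero _ _) (numerator_zero _ _) erefl
  adj_zero q_conj wr hw lam K lamP KM oKw
  lam K' lamP le_i K'M oKw' z rz).
Qed.

End Identities.
End Special.

(** * Entire functions of one variable *)

Section PolynomialNorm.
Variable R : realType.
Local Notation C := R[i].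
Local Notation cnorm := (@normc R).
Implicit Types (p q : {poly C}) (r e : R) (x : C).

(** Replacing the coefficients by their norms turns the estimates for [polynorm]
    into coefficientwise inequalities between real polynomials. *)
Definition normpoly p : {poly R} := \poly_(i < size p) cnorm p`_i.

Lemma coef_normpoly p i : (normpoly p)`_i = cnorm p`_i.
Proof.
rewrite coef_poly; case: ltnP => // sp.
by rewrite nth_default// cnorm_real normr0.
Qed.

Definition polynorm r p : R := (normpoly p).[r].

Lemma horner_ge0 (P : {poly R}) r : 0 <= r -> (forall i, 0 <= P`_i) -> 0 <= P.[r].
Proof.
by move=> r0 H; rewrite horner_coef sumr_ge0// => i _; rewrite mulr_ge0// exprn_ge0.
Qed.

Lemma ler_horner (P Q : {poly R}) r : 0 <= r -> (forall i, P`_i <= Q`_i) -> P.[r] <= Q.[r].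
Proof.
move=> r0 H; rewrite -subr_ge0 -hornerN -hornerD horner_ge0// => i.
by rewrite coefB subr_ge0.
Qed.

Lemma polynorm_ge0 r p : 0 <= r -> 0 <= polynorm r p.
Proof. by move=> r0; rewrite horner_ge0// => i; rewrite coef_normpoly cnorm_ge0. Qed.

Lemma polynormD r p q : 0 <= r -> polynorm r (p + q) <= polynorm r p + polynorm r q.
Proof.
move=> r0; rewrite /polynorm -hornerD ler_horner// => i.
by rewrite coefD !coef_normpoly coefD le_normcD.
Qed.

Lemma polynormN r p : polynorm r (- p) = polynorm r p.
Proof.
congr (_.[r]); apply/polyP => i.
by rewrite !coef_normpoly coefN normcN.
Qed.

Lemma cnorm_sum (I : Type) (s : seq I) (F : I -> C) :
  cnorm (\sum_(i <- s) F i) <= \sum_(i <- s) cnorm (F i).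
Proof.
elim: s => [|i s IH]; first by rewrite !big_nil cnorm_real normr0.
by rewrite !big_cons; apply: le_trans (le_normcD _ _) _; rewrite lerD2l.
Qed.

Lemma polynormM r p q : 0 <= r -> polynorm r (p * q) <= polynorm r p * polynorm r q.
Proof.
move=> r0; rewrite /polynorm -hornerM ler_horner// => i.
rewrite coef_normpoly !coefM; apply: le_trans (cnorm_sum _ _) _.
by apply: ler_sum => j _; rewrite !coef_normpoly normcM.
Qed.

Lemma cnorm_horner p x : cnorm p.[x] <= polynorm (cnorm x) p.
Proof.
rewrite horner_coef /polynorm (@horner_coef_wide _ (size p)) ?size_poly//.
apply: le_trans (cnorm_sum _ _) _; apply: ler_sum => i _.
by rewrite coef_normpoly normcM cnormX.
Qed.

Lemma coef_le_polynorm r p d : 0 <= r -> cnorm p`_d * r ^+ d <= polynorm r p.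
Proof.
move=> r0; have -> : cnorm p`_d * r ^+ d = (cnorm p`_d *: 'X^d).[r] by rewrite hornerZ hornerXn.
apply: ler_horner => // i; rewrite coefZ coefXn coef_normpoly.
by case: eqP => [->|_]; rewrite ?mulr1 ?mulr0 ?cnorm_ge0.
Qed.

Lemma polynorm_monomial r (c : C) m : 0 <= r -> polynorm r (c *: 'X^m) <= cnorm c * r ^+ m.
Proof.
move=> r0; have -> : cnorm c * r ^+ m = (cnorm c *: 'X^m).[r] by rewrite hornerZ hornerXn.
apply: ler_horner => // i; rewrite coef_normpoly !coefZ !coefXn.
by case: eqP => _; rewrite ?mulr1// !mulr0 cnorm_real normr0.
Qed.

Lemma polynorm_sum r (I : Type) (s : seq I) (F : I -> {poly C}) : 0 <= r ->
  polynorm r (\sum_(i <- s) F i) <= \sum_(i <- s) polynorm r (F i).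
Proof.
move=> r0; elim: s => [|i s IH].
  rewrite !big_nil /polynorm (_ : normpoly 0 = 0) ?horner0//.
  by apply/polyP => j; rewrite coef_normpoly !coef0 cnorm_real normr0.
by rewrite !big_cons; apply: le_trans (polynormD _ _ r0) _; rewrite lerD2l.
Qed.

Definition cauchy_polys (P : nat -> {poly C}) := forall r e, 0 <= r -> 0 < e ->
  exists N0, forall N M, (N0 <= N)%N -> (N0 <= M)%N -> polynorm r (P N - P M) < e.

(** Entire functions of one variable as limits of polynomials that are Cauchy for
    all the norms [polynorm r].  This class is closed under products, and
    restricting a multiple power series to a curve requires no rearrangement of
    the series. *)
Definition entire1 (f : C -> C) := exists2 P : nat -> {poly C},
  cauchy_polys P & forall x, tends_to (fun N => (P N).[x]) (f x).

Lemma entire1_ext f g : f =1 g -> entire1 f -> entire1 g.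
Proof. by move=> fg [P cP Pf]; exists P => // x; rewrite -fg. Qed.

Lemma entire1_poly (p : {poly C}) : entire1 (fun x => p.[x]).
Proof.
exists (fun=> p) => [r e r0 e0|x]; last exact: tends_to_cst.
exists 0%N => N M _ _; rewrite subrr; apply: le_lt_trans e0.
have := polynorm_sum [::] (fun _ : nat => p) r0.
by rewrite !big_nil.
Qed.

Lemma entire1_cst c : entire1 (fun=> c).
Proof. by apply: entire1_ext (entire1_poly c%:P) => x; rewrite hornerC. Qed.

Lemma entire1D f g : entire1 f -> entire1 g -> entire1 (fun x => f x + g x).
Proof.
move=> [P cP Pf] [Q cQ Qg]; exists (fun N => P N + Q N).
  move=> r e r0 e0; have e2 : 0 < e / 2 by rewrite divr_gt0.
  have [N1 H1] := cP r _ r0 e2; have [N2 H2] := cQ r _ r0 e2.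
  exists (maxn N1 N2) => N M; rewrite !geq_max => /andP[n1 n2] /andP[m1 m2].
  rewrite opprD addrACA [e]splitr; apply: le_lt_trans (polynormD _ _ r0) _.
  by rewrite ltrD ?H1 ?H2.
by move=> x; apply: tends_to_ext (tends_toD (Pf x) (Qg x)) => N; rewrite hornerD.
Qed.

Lemma cauchy_bounded P r : 0 <= r -> cauchy_polys P ->
  exists B N0, 0 < B /\ forall N, (N0 <= N)%N -> polynorm r (P N) <= B.
Proof.
move=> r0 cP; have [N0 H] := cP r 1 r0 ltr01.
exists (polynorm r (P N0) + 1), N0; split; first by rewrite ltr_wpDl ?polynorm_ge0.
move=> N NN; have := H N N0 NN (leqnn _).
have := polynormD (P N - P N0) (P N0) r0; rewrite subrK; lra.
Qed.

Lemma entire1M f g : entire1 f -> entire1 g -> entire1 (fun x => f x * g x).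
Proof.
move=> [P cP Pf] [Q cQ Qg]; exists (fun N => P N * Q N).
  move=> r e r0 e0.
  have [B [N1 [B0 H1]]] := cauchy_bounded r0 cP.
  have [D [N2 [D0 H2]]] := cauchy_bounded r0 cQ.
  have eB : 0 < e / (2 * B) by rewrite divr_gt0// mulr_gt0.
  have eD : 0 < e / (2 * D) by rewrite divr_gt0// mulr_gt0.
  have [N3 H3] := cQ r _ r0 eB; have [N4 H4] := cP r _ r0 eD.
  exists (maxn (maxn N1 N2) (maxn N3 N4)) => N M; rewrite !geq_max.
  move=> /andP[/andP[n1 n2] /andP[n3 n4]] /andP[/andP[m1 m2] /andP[m3 m4]].
  have -> : P N * Q N - P M * Q M = P N * (Q N - Q M) + (P N - P M) * Q M by ring.
  apply: le_lt_trans (polynormD _ _ r0) _.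
  have t1 : polynorm r (P N * (Q N - Q M)) <= B * polynorm r (Q N - Q M).
    apply: le_trans (polynormM _ _ r0) _; rewrite ler_wpM2r ?polynorm_ge0//; exact: H1.
  have t2 : polynorm r ((P N - P M) * Q M) <= polynorm r (P N - P M) * D.
    apply: le_trans (polynormM _ _ r0) _; rewrite ler_wpM2l ?polynorm_ge0//; exact: H2.
  have t3 : B * polynorm r (Q N - Q M) < e / 2.
    have := H3 N M n3 m3; rewrite ltr_pdivlMr ?mulr_gt0// => h.
    rewrite ltr_pdivlMr//; lra.
  have t4 : polynorm r (P N - P M) * D < e / 2.
    have := H4 N M n4 m4; rewrite ltr_pdivlMr ?mulr_gt0// => h.
    rewrite ltr_pdivlMr//; lra.
  rewrite [e]splitr; lra.
by move=> x; apply: tends_to_ext (tends_toM (Pf x) (Qg x)) => N; rewrite hornerM.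
Qed.

Lemma tends_to_eq0 (u : nat -> C) (y : C) : tends_to u y ->
  (forall e, 0 < e -> exists N0, forall N, (N0 <= N)%N -> cnorm (u N) <= e) -> y = 0.
Proof.
move=> uy H; apply: (@tends_to_unique R u) => // e e0.
have [N0 HN] := H (e / 2) (divr_gt0 e0 (ltr0Sn _ _)).
exists N0 => N NN; rewrite subr0; have := HN N NN; lra.
Qed.

Lemma coefs_small (P : nat -> {poly C}) d e : 0 < e ->
  (forall i, (i < d)%N -> forall e, 0 < e ->
     exists N0, forall N, (N0 <= N)%N -> cnorm (P N)`_i < e) ->
  forall r, 0 <= r ->
  exists N0, forall N, (N0 <= N)%N -> \sum_(i < d) cnorm (P N)`_i * r ^+ i <= e.
Proof.
move=> e0 H r r0; elim: d e e0 H => [|d IH] e e0 H.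
  by exists 0%N => N _; rewrite big_ord0 ltW.
have e2 : 0 < e / 2 by rewrite divr_gt0.
have [N1 H1] := IH _ e2 (fun i id => H i (ltnW id)).
have y0 : 0 < 1 + r ^+ d by rewrite ltr_wpDr ?exprn_ge0.
have e3 : 0 < e / 2 / (1 + r ^+ d) by rewrite divr_gt0.
have [N2 H2] := H d (ltnSn _) _ e3.
exists (maxn N1 N2) => N; rewrite geq_max => /andP[n1 n2].
rewrite big_ord_recr /= [e]splitr lerD ?H1//.
have := H2 N n2; rewrite ltr_pdivlMr// => h; apply: le_trans (ltW h).
by rewrite ler_wpM2l ?cnorm_ge0// lerDr.
Qed.

(** Let [d] be the first degree whose coefficients do not tend to 0 along the
    approximating polynomials.  Near 0 the function is then bounded below by a
    multiple of [x ^+ d], so it has no zeros there except perhaps 0.  If there is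
    no such degree, the function is 0. *)
Lemma entire1_identity f : entire1 f ->
  (forall e, 0 < e -> exists x, 0 < cnorm x < e /\ f x = 0) -> forall x, f x = 0.
Proof.
move=> [P cP Pf] zeros.
pose small d := forall e, 0 < e -> exists N0, forall N, (N0 <= N)%N -> cnorm (P N)`_d < e.
have [all_small|] := pselect (forall d, small d).
  move=> x; apply: tends_to_eq0 (Pf x) _ => e e0.
  have e2 : 0 < e / 2 by rewrite divr_gt0.
  have r0 := cnorm_ge0 x.
  have [N1 H1] := cP (cnorm x) _ r0 e2; pose D := size (P N1).
  have [N2 H2] := coefs_small (d := D) e2 (fun i _ => all_small i) r0.
  exists (maxn N1 N2) => N; rewrite geq_max => /andP[n1 n2].
  apply: le_trans (cnorm_horner _ _) _; rewrite [e]splitr.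
  have := H1 N N1 n1 (leqnn _); have := H2 N n2 => h2 h1.
  apply: le_trans (lerD h2 (ltW h1)).
  have -> : \sum_(i < D) cnorm (P N)`_i * cnorm x ^+ i = (\poly_(i < D) cnorm (P N)`_i).[cnorm x].
    by rewrite horner_poly.
  rewrite /polynorm -hornerD ler_horner// => i.
  rewrite coefD !coef_normpoly coef_poly; case: ltnP => iD.
    by rewrite lerDl cnorm_ge0.
  by rewrite coefB [(P N1)`_i]nth_default// subr0 add0r.
move=> /existsNP/cid[d0 nd0].
have exd : exists d, ~~ `[< small d >] by exists d0; apply/negP => /asboolP.
have [d nd dmin] := ex_minnP exd.
have sm i : (i < d)%N -> small i.
  move=> id; apply/asboolP; apply: contraLR id => /dmin; by rewrite -leqNgt.
have [eta [eta0 [N1 H1]]] : exists eta, 0 < eta /\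
    exists N1, forall N, (N1 <= N)%N -> eta <= cnorm (P N)`_d.
  have [e [e0 He]] : exists e, 0 < e /\ forall N0, exists2 N, (N0 <= N)%N & e <= cnorm (P N)`_d.
    apply: contrapT => H; move/negP: nd; apply; apply/asboolP => e e0.
    apply: contrapT => H'; apply: H; exists e; split=> // N0.
    apply: contrapT => H''; apply: H'; exists N0 => N NN.
    by rewrite ltNge; apply/negP => eN; apply: H''; exists N.
  have e2 : 0 < e / 2 by rewrite divr_gt0.
  have [N1 HN1] := cP 1 _ ler01 e2; exists (e / 2); split=> //; exists N1 => N NN.
  have [M MM eM] := He N1; have := HN1 M N MM NN.
  have := coef_le_polynorm (P M - P N) d ler01; rewrite expr1n mulr1 coefB => h1 h2.
  have := le_normcD ((P M)`_d - (P N)`_d) (P N)`_d; rewrite subrK; lra.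
have [B [N2 [B0 H2]]] := cauchy_bounded ler01 cP.
have e1 : 0 < Num.min 1 (eta / (2 * B)) by rewrite lt_min ltr01 divr_gt0// mulr_gt0.
have [x [/andP[x0 xe] fx]] := zeros _ e1.
have x1 : cnorm x <= 1 by apply: ltW; apply: lt_le_trans xe _; rewrite ge_min lexx.
have xB : cnorm x * B <= eta / 2.
  have : cnorm x < eta / (2 * B) by apply: lt_le_trans xe _; rewrite ge_min lexx orbT.
  rewrite ltr_pdivlMr ?mulr_gt0// => h; lra.
have xd0 : 0 < cnorm x ^+ d by rewrite exprn_gt0.
(* An eighth of the main term is left over for each of the error terms. *)
pose e := eta * cnorm x ^+ d / 8.
have e0 : 0 < e by rewrite /e divr_gt0// mulr_gt0.
have [N3 H3] := coefs_small e0 sm (ltW x0).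
have [N4 H4] := Pf x e e0.
pose N := maxn (maxn N1 N2) (maxn N3 N4).
have n1 : (N1 <= N)%N by rewrite /N !leq_max leqnn.
have n2 : (N2 <= N)%N by rewrite /N !leq_max leqnn orbT.
have n3 : (N3 <= N)%N by rewrite /N !leq_max leqnn !orbT.
have n4 : (N4 <= N)%N by rewrite /N !leq_max leqnn !orbT.
have {H1} h1 := H1 N n1; have {H2} h2 := H2 N n2; have {H3} h3 := H3 N n3.
have {H4} h4 := H4 N n4; rewrite fx subr0 in h4.
pose Q := P N - (P N)`_d *: 'X^d.
have hQ : cnorm Q.[x] <= \sum_(i < d) cnorm (P N)`_i * cnorm x ^+ i + cnorm x ^+ d.+1 * polynorm 1 (P N).
  rewrite horner_coef; apply: le_trans (cnorm_sum _ _) _.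
  pose m := maxn (size Q) (maxn (size (P N)) d).
  have -> : \sum_(i < size Q) cnorm (Q`_i * x ^+ i) = \sum_(i < m) cnorm (Q`_i * x ^+ i).
    rewrite (big_ord_widen m (fun i => cnorm (Q`_i * x ^+ i))) ?leq_maxl//.
    rewrite big_mkcond; apply: eq_bigr => i _; case: ltnP => // si.
    by rewrite nth_default// mul0r cnorm_real normr0.
  have -> : polynorm 1 (P N) = \sum_(i < m) cnorm (P N)`_i.
    rewrite /polynorm (@horner_coef_wide _ m) ?(leq_trans (size_poly _ _))//.
      by apply: eq_bigr => i _; rewrite coef_normpoly expr1n mulr1.
    by rewrite /m !leq_max leqnn !orbT.
  rewrite (big_ord_widen m (fun i => cnorm (P N)`_i * cnorm x ^+ i)); last first.
    by rewrite /m !leq_max leqnn !orbT.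
  rewrite [X in _ <= X + _]big_mkcond mulr_sumr -big_split /=; apply: ler_sum => i _.
  rewrite normcM cnormX /Q coefB coefZ coefXn.
  have p0 := cnorm_ge0 (P N)`_i; have y0 : 0 <= cnorm x ^+ d.+1 by rewrite exprn_ge0// ltW.
  case: (ltngtP i d) => [id|di|->].
  - by rewrite mulr0 subr0 lerDl mulr_ge0.
  - rewrite mulr0 subr0 add0r mulrC ler_wpM2r//.
    by rewrite ler_wiXn2l// ?cnorm_ge0.
  - by rewrite mulr1 subrr cnorm_real normr0 mul0r add0r mulr_ge0 ?cnorm_ge0.
have hmain : eta * cnorm x ^+ d <= cnorm (P N).[x] + cnorm Q.[x].
  apply: (@le_trans _ _ (cnorm (P N)`_d * cnorm x ^+ d)); first by rewrite ler_wpM2r// ltW.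
  rewrite -cnormX -normcM.
  have -> : (P N)`_d * x ^+ d = (P N).[x] + - Q.[x].
    by rewrite /Q hornerD hornerN hornerZ hornerXn opprD opprK addrA subrr add0r.
  by apply: le_trans (le_normcD _ _) _; rewrite normcN.
have hB : cnorm x ^+ d.+1 * polynorm 1 (P N) <= eta / 2 * cnorm x ^+ d.
  rewrite exprSr -mulrA [eta / 2 * _]mulrC ler_wpM2l ?(ltW xd0)//.
  by apply: le_trans xB; rewrite ler_wpM2l ?cnorm_ge0.
have eE : eta * cnorm x ^+ d = 8 * e by rewrite /e; field.
have eE2 : eta / 2 * cnorm x ^+ d = 4 * e by rewrite /e; field.
exfalso; lra.
Qed.

End PolynomialNorm.

(** * Entire functions of the parameters *)

Section EntireSections.
Variable R : realType.
Local Notation C := R[i].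
Local Notation cnorm := (@normc R).

Definition box k N : seq {ffun 'I_k -> nat} :=
  [seq [ffun i => nat_of_ord (al i)] | al : {ffun 'I_k -> 'I_N} <- enum {: {ffun 'I_k -> 'I_N}}].

Lemma box_uniq k N : uniq (box k N).
Proof.
rewrite map_inj_uniq ?enum_uniq// => x y /ffunP xy; apply/ffunP => i.
by have := xy i; rewrite !ffunE => /val_inj.
Qed.

Lemma mem_box k N (b : {ffun 'I_k -> nat}) : (b \in box k N) = [forall i, (b i < N)%N].
Proof.
apply/mapP/forallP => [[al _ ->] i|H]; first by rewrite ffunE.
exists [ffun i => Ordinal (H i)]; rewrite ?mem_enum//.
by apply/ffunP => i; rewrite !ffunE.
Qed.

Lemma big_box (T : nmodType) k N (F : {ffun 'I_k -> nat} -> T) :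
  \sum_(b <- box k N) F b =
  \sum_(al : {ffun 'I_k -> 'I_N}) F [ffun i => nat_of_ord (al i)].
Proof. by rewrite big_map big_enum. Qed.

Lemma big_box_sub (T : zmodType) k M N (F : {ffun 'I_k -> nat} -> T) : (M <= N)%N ->
  \sum_(b <- box k N) F b - \sum_(b <- box k M) F b =
  \sum_(b <- box k N | b \notin box k M) F b.
Proof.
move=> MN; rewrite (bigID (mem (box k M))) /=.
suff -> : \sum_(b <- box k N | b \in box k M) F b = \sum_(b <- box k M) F b.
  by rewrite addrAC subrr add0r.
rewrite -big_filter; apply/perm_big/uniq_perm; rewrite ?filter_uniq ?box_uniq// => b.
rewrite mem_filter; apply/andb_idr; rewrite !mem_box => /forallP H.
by apply/forallP => i; exact: leq_trans (H i) MN.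
Qed.

(** The partial sums over boxes are polynomials along the curve.  The norm of a
    difference of two of them is at most the corresponding difference of partial
    sums of the absolute values at the point of the curve over [r], and these
    converge because they are bounded. *)
Lemma entire_monomial k (F : ('I_k -> C) -> C) (c : 'I_k -> C) (m : 'I_k -> nat) :
  entire F -> entire1 (fun y => F (fun i => c i * y ^+ m i)).
Proof.
move=> [a aF].
pose deg (b : {ffun 'I_k -> nat}) := (\sum_(i < k) m i * b i)%N.
pose co (b : {ffun 'I_k -> nat}) : C := a b * \prod_(i < k) c i ^+ b i.
have termE (b : {ffun 'I_k -> nat}) y :
    a b * \prod_(i < k) (c i * y ^+ m i) ^+ b i = co b * y ^+ deg b.
  rewrite /co -mulrA; congr (_ * _); rewrite /deg -prodrXr -big_split /=.
  by apply: eq_bigr => i _; rewrite exprMn -exprM.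
exists (fun N => \sum_(b <- box k N) co b *: 'X^(deg b)); last first.
  move=> y; have [_] := aF (fun i => c i * y ^+ m i); move/tends_toP; apply: tends_to_ext => N.
  rewrite horner_sum big_box; apply: eq_bigr => al _.
  rewrite hornerZ hornerXn -termE; congr (_ * _).
  by apply: eq_bigr => i _; rewrite ffunE.
move=> r e r0 e0.
pose S N : R := \sum_(b <- box k N) cnorm (co b) * r ^+ deg b.
have S_sub M N : (M <= N)%N -> S N - S M = \sum_(b <- box k N | b \notin box k M) cnorm (co b) * r ^+ deg b.
  exact: big_box_sub.
have term0 b : 0 <= cnorm (co b) * r ^+ deg b by rewrite mulr_ge0 ?cnorm_ge0 ?exprn_ge0.
have S_mono : nondecreasing_seq S.
  by move=> M N MN; rewrite -subr_ge0 S_sub// sumr_ge0.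
have S_bound : exists B, forall N, S N <= B.
  have [[Bc HB] _] := aF (fun i => c i * r%:C ^+ m i).
  exists (complex.Re Bc) => N; have := HB N.
  have -> : \sum_(al : {ffun 'I_k -> 'I_N}) `|a [ffun i => nat_of_ord (al i)] *
      \prod_(i < k) (c i * r%:C ^+ m i) ^+ al i| = (S N)%:C.
    rewrite /S big_box rmorph_sum; apply: eq_bigr => al _.
    rewrite normr_cnorm; congr (_%:C).
    have -> : \prod_(i < k) (c i * r%:C ^+ m i) ^+ al i =
       \prod_(i < k) (c i * r%:C ^+ m i) ^+ [ffun i => nat_of_ord (al i)] i.
      by apply: eq_bigr => i _; rewrite ffunE.
    by rewrite termE normcM cnormX cnorm_real ger0_norm.
  by rewrite lecE => /andP[_].
have S_cvg : cvgn S.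
  apply: nondecreasing_is_cvgn => //; have [B HB] := S_bound.
  by exists B => _ [N _ <-].
have e2 : 0 < e / 2 by rewrite divr_gt0.
have /cvgrPdist_lt/(_ _ e2)[N0 _ HN0] := S_cvg.
exists N0 => N M NN MM.
have key M' N' : (N0 <= M')%N -> (M' <= N')%N ->
   polynorm r (\sum_(b <- box k N') co b *: 'X^(deg b) - \sum_(b <- box k M') co b *: 'X^(deg b)) < e.
  move=> NM' MN'; rewrite big_box_sub// -big_filter.
  apply: le_lt_trans (polynorm_sum _ _ r0) _; rewrite big_filter.
  apply: (@le_lt_trans _ _ (S N' - S M')).
    by rewrite S_sub//; apply: ler_sum => b _; exact: polynorm_monomial.
  have := HN0 N' (leq_trans NM' MN'); have := HN0 M' NM' => /= h1 h2.
  have -> : S N' - S M' = (S N' - limn S) + (limn S - S M') by ring.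
  apply: le_lt_trans (ler_norm _) _; apply: le_lt_trans (ler_normD _ _) _.
  by rewrite [e]splitr ltrD// distrC.
case: (leqP M N) => [MN|/ltnW NM]; first exact: key.
by rewrite -polynormN opprB; exact: key.
Qed.

Local Notation point := ('I_6 -> C).
Implicit Types (x : point) (j : 'I_6) (F G : point -> C).

Definition upd x j (y : C) : point := fun i => if i == j then y else x i.

(** Separate analyticity in each of the six parameters is all that the iterated
    use of the identity theorem requires. *)
Definition entire6 F := forall x j, entire1 (fun y => F (upd x j y)).

Lemma entire6_ext F G : F =1 G -> entire6 F -> entire6 G.
Proof. by move=> FG eF x j; apply: entire1_ext (eF x j) => y; rewrite FG. Qed.

Lemma entire6_cst c : entire6 (fun=> c).
Proof. by move=> x j; exact: entire1_cst. Qed.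

Lemma entire6D F G : entire6 F -> entire6 G -> entire6 (fun x => F x + G x).
Proof. by move=> eF eG x j; exact: entire1D. Qed.

Lemma entire6M F G : entire6 F -> entire6 G -> entire6 (fun x => F x * G x).
Proof. by move=> eF eG x j; exact: entire1M. Qed.

Lemma entire6N F : entire6 F -> entire6 (fun x => - F x).
Proof.
move=> eF; apply: entire6_ext (entire6M (entire6_cst (-1)) eF) => x.
by rewrite mulN1r.
Qed.

Lemma entire6B F G : entire6 F -> entire6 G -> entire6 (fun x => F x - G x).
Proof. by move=> eF eG; apply: entire6D => //; exact: entire6N. Qed.

Lemma entire6_coord i : entire6 (fun x => x i).
Proof.
move=> x j; rewrite /upd; case: (i == j); last exact: entire1_cst.
by apply: entire1_ext (entire1_poly 'X) => y; rewrite hornerX.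
Qed.

Lemma entire6X F m : entire6 F -> entire6 (fun x => F x ^+ m).
Proof.
move=> eF; elim: m => [|m IH].
  by apply: entire6_ext (entire6_cst 1) => x; rewrite expr0.
by apply: entire6_ext (entire6M eF IH) => x; rewrite exprS.
Qed.

Lemma entire6_sum (I : Type) (s : seq I) (F : I -> point -> C) :
  (forall i, entire6 (F i)) -> entire6 (fun x => \sum_(i <- s) F i x).
Proof.
move=> eF; elim: s => [|i s IH].
  by apply: entire6_ext (entire6_cst 0) => x; rewrite big_nil.
by apply: entire6_ext (entire6D (eF i) IH) => x; rewrite big_cons.
Qed.

Lemma entire6_prod (I : Type) (s : seq I) (P : pred I) (F : I -> point -> C) :
  (forall i, entire6 (F i)) -> entire6 (fun x => \prod_(i <- s | P i) F i x).
Proof.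
move=> eF; elim: s => [|i s IH].
  by apply: entire6_ext (entire6_cst 1) => x; rewrite big_nil.
case: (boolP (P i)) => Pi; last by apply: entire6_ext IH => x; rewrite big_cons (negPf Pi).
by apply: entire6_ext (entire6M (eF i) IH) => x; rewrite big_cons Pi.
Qed.

Definition monomial6 F := forall x j, exists c m, forall y, F (upd x j y) = c * y ^+ m.

Lemma monomial6_coord i : monomial6 (fun x => x i).
Proof.
move=> x j; rewrite /upd; case: (i == j).
  by exists 1, 1%N => y; rewrite mul1r.
by exists (x i), 0%N => y; rewrite mulr1.
Qed.

Lemma monomial6M F G : monomial6 F -> monomial6 G -> monomial6 (fun x => F x * G x).
Proof.
move=> mF mG x j; have [c [m E1]] := mF x j; have [d [l E2]] := mG x j.
by exists (c * d), (m + l)%N => y; rewrite E1 E2 exprD mulrACA.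
Qed.

Lemma entire6_entire (F : point -> C) (G : point -> point) : entire F ->
  (forall i, monomial6 (fun x => G x i)) -> entire6 (fun x => F (G x)).
Proof.
move=> eF mG x j.
have /choice[c /choice[m H]] : forall i, exists c, exists m, forall y, G (upd x j y) i = c * y ^+ m.
  by move=> i; have [c [m H]] := mG i x j; exists c, m.
apply: entire1_ext (entire_monomial c m eF) => y; congr F.
by apply/funext => i; rewrite H.
Qed.

Lemma monomial6_params (f0 f1 f2 f3 f4 f5 : point -> C) :
  monomial6 f0 -> monomial6 f1 -> monomial6 f2 -> monomial6 f3 -> monomial6 f4 -> monomial6 f5 ->
  forall i, monomial6 (fun x => params (f0 x) (f1 x) (f2 x) (f3 x) (f4 x) (f5 x) i).
Proof. by move=> h0 h1 h2 h3 h4 h5 [[|[|[|[|[|[|//]]]]]] hi]. Qed.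

Lemma params_eta x : x = params (x (inord 0)) (x (inord 1)) (x (inord 2))
  (x (inord 3)) (x (inord 4)) (x (inord 5)).
Proof.
apply/funext => i; have {1}-> : i = inord i by rewrite inord_val.
by case: i => [[|[|[|[|[|[|//]]]]]] hi].
Qed.

Definition null_seq (u : nat -> C) := forall e, 0 < e -> exists m, 0 < cnorm (u m) < e.

Lemma entire6_step F x j (u : nat -> C) : entire6 F -> null_seq u ->
  (forall m, F (upd x j (u m)) = 0) -> forall y, F (upd x j y) = 0.
Proof.
move=> eF nu H; apply: (entire1_identity (eF x j)) => e e0.
by have [m hm] := nu e e0; exists (u m).
Qed.

(** Free the variables one at a time by the identity theorem, the one that stands
    for the square root of [q] last, because the sequences for the other ones
    depend on it. *)
Lemma entire6_uniqueness F (e0 e1 e2 e3 e5 : R -> nat -> C) : entire6 F ->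
  (forall r : R, 0 < r <= 2^-1 ->
     null_seq (e0 r) /\ null_seq (e1 r) /\ null_seq (e2 r) /\ null_seq (e3 r) /\ null_seq (e5 r)) ->
  (forall r : R, 0 < r <= 2^-1 -> forall a b c d k,
     F (params (e0 r a) (e1 r b) (e2 r c) (e3 r d) r%:C (e5 r k)) = 0) ->
  forall x, F x = 0.
Proof.
move=> eF nul H x; rewrite (params_eta x).
move: (x (inord 0)) (x (inord 1)) (x (inord 2)) (x (inord 3)) (x (inord 4)) (x (inord 5)) => x0 x1 x2 x3 x4 x5.
have u0 y a0 a1 a2 a3 a4 a5 : upd (params a0 a1 a2 a3 a4 a5) (inord 0) y = params y a1 a2 a3 a4 a5.
  by apply/funext => -[[|[|[|[|[|[|//]]]]]] hi]; rewrite /upd -val_eqE /= inordK.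
have u1 y a0 a1 a2 a3 a4 a5 : upd (params a0 a1 a2 a3 a4 a5) (inord 1) y = params a0 y a2 a3 a4 a5.
  by apply/funext => -[[|[|[|[|[|[|//]]]]]] hi]; rewrite /upd -val_eqE /= inordK.
have u2 y a0 a1 a2 a3 a4 a5 : upd (params a0 a1 a2 a3 a4 a5) (inord 2) y = params a0 a1 y a3 a4 a5.
  by apply/funext => -[[|[|[|[|[|[|//]]]]]] hi]; rewrite /upd -val_eqE /= inordK.
have u3 y a0 a1 a2 a3 a4 a5 : upd (params a0 a1 a2 a3 a4 a5) (inord 3) y = params a0 a1 a2 y a4 a5.
  by apply/funext => -[[|[|[|[|[|[|//]]]]]] hi]; rewrite /upd -val_eqE /= inordK.
have u4 y a0 a1 a2 a3 a4 a5 : upd (params a0 a1 a2 a3 a4 a5) (inord 4) y = params a0 a1 a2 a3 y a5.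
  by apply/funext => -[[|[|[|[|[|[|//]]]]]] hi]; rewrite /upd -val_eqE /= inordK.
have u5 y a0 a1 a2 a3 a4 a5 : upd (params a0 a1 a2 a3 a4 a5) (inord 5) y = params a0 a1 a2 a3 a4 y.
  by apply/funext => -[[|[|[|[|[|[|//]]]]]] hi]; rewrite /upd -val_eqE /= inordK.
have H5 (r : R) : 0 < r <= 2^-1 -> forall y0 y1 y2 y3 y5, F (params y0 y1 y2 y3 r%:C y5) = 0.
  move=> hr y0 y1 y2 y3 y5; have [n0 [n1 [n2 [n3 n5]]]] := nul r hr.
  rewrite -(u0 y0 0); apply: (entire6_step eF n0) => a; rewrite u0.
  rewrite -(u1 y1 _ 0); apply: (entire6_step eF n1) => b; rewrite u1.
  rewrite -(u2 y2 _ _ 0); apply: (entire6_step eF n2) => c; rewrite u2.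
  rewrite -(u3 y3 _ _ _ 0); apply: (entire6_step eF n3) => d; rewrite u3.
  rewrite -(u5 y5 _ _ _ _ _ 0); apply: (entire6_step eF n5) => k; rewrite u5.
  exact: H.
rewrite -(u4 x4 _ _ _ _ 0); apply: (entire6_step (u := fun m => (m.+2%:R^-1 : R)%:C) eF) => [e e_gt0|m].
  have [m hm] : exists m : nat, e^-1 < m.+2%:R.
    exists (Num.truncn e^-1); apply: (@lt_trans _ _ (Num.truncn e^-1).+1%:R).
      by rewrite truncnS_gt.
    by rewrite ltr_nat.
  exists m; rewrite cnorm_real gtr0_norm ?invr_gt0 ?ltr0n//=.
  by rewrite -[e]invrK ltf_pV2 ?posrE ?invr_gt0 ?ltr0n.
rewrite u4; apply: H5; rewrite invr_gt0 ltr0n /= lef_pV2 ?posrE ?ltr0n//.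
by rewrite ler_nat.
Qed.

End EntireSections.

(** * Analytic continuation in the parameters *)

Section Continuation.
Variables (R : realType) (n : nat).
Local Notation C := R[i].
Local Notation cnorm := (@normc R).
Local Notation part := {ffun 'I_n -> nat}.
Local Notation point := ('I_6 -> C).
Implicit Types (lam mu : part) (z : 'I_n -> C) (x : point).

Lemma orbit_size lam a : a \in bc_orbit lam -> (\sum_(i < n) `|a i| = psize lam)%N.
Proof.
move=> /bc_orbitP[e [s ->]]; rewrite /psize [RHS](reindex_inj (@perm_inj _ s)).
by apply: eq_bigr => i _; rewrite !ffunE; case: ifP; rewrite ?abszN.
Qed.

Lemma prod_exprz (s : C) (a : {ffun 'I_n -> int}) : s != 0 ->
  \prod_(i < n) s ^ a i = s ^ (\sum_(i < n) a i).
Proof.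
move=> s0; apply/esym; apply: (big_morph (fun m : int => s ^ m)) => [i j|]; last exact: expr0z.
exact: expfzDr.
Qed.

(** This is [s ^+ N * msym mu (s z)], a polynomial in [s] for [N] at least the
    size of [mu]. *)
Definition smsym N mu (s : C) z : C :=
  \sum_(a <- bc_orbit mu) s ^+ absz (N%:Z + \sum_(i < n) a i) * mono a z.

Lemma smsymE N mu s z : s != 0 -> (psize mu <= N)%N ->
  smsym N mu s z = s ^+ N * msym mu (scalez s z).
Proof.
move=> s0 muN; rewrite msymE mulr_sumr /smsym [LHS]big_seq [RHS]big_seq; apply: eq_bigr => a aO.
rewrite mono_scale prod_exprz// mulrA; congr (_ * _).
have ge0 : 0 <= N%:Z + \sum_(i < n) a i.
  have h : - \sum_(i < n) a i <= (\sum_(i < n) `|a i|)%N%:Z.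
    rewrite (big_morph Posz PoszD (erefl _)) -sumrN; apply: ler_sum => i _; lia.
  rewrite (orbit_size aO) in h; lia.
by rewrite [LHS]exprnP gez0_abs// expfzDr.
Qed.

Lemma psize_psum lam : psize lam = psum lam n.
Proof. by apply: eq_bigl => i; rewrite inE ltn_ord. Qed.

Lemma sdominated_psize lam mu : sdominated lam mu -> (psize mu <= psize lam)%N.
Proof. by move=> /sdominatedP[_ H _]; rewrite !psize_psum; exact: H. Qed.

Definition msym_family lam (mus : seq part) (c : part -> C) z : C :=
  msym lam z + \sum_(mu <- mus) c mu * msym mu z.

Lemma qdiff_family h s t lam mus c z :
  qdiff h s t (msym_family lam mus c) z =
  qdiff h s t (msym lam) z + \sum_(mu <- mus) c mu * qdiff h s t (msym mu) z.
Proof.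
rewrite /qdiff !symmetrizeE.
under [X in _ = _ + X]eq_bigr do rewrite symmetrizeE mulr_sumr.
rewrite exchange_big -big_split; apply: eq_bigr => e _ /=.
rewrite /msym_family mulrDr mulr_sumr; congr (_ + _); apply: eq_bigr => mu _.
exact: mulrCA.
Qed.

Section Operator.
Variables (h : point -> C -> C) (z : 'I_n -> C) (N : nat).
Hypothesis h_entire : forall w, entire6 (fun x => h x w).
Local Notation xs x := (x (inord 4)).
Local Notation xt x := (x (inord 5)).

Definition prefactor x (w : 'I_n -> C) : C := (\prod_(i < n) (h x (w i) / (1 - w i ^+ 2))) * cross_factor (xt x) w.

(** [s ^+ N] times the image of [msym mu] at [z], made polynomial in the parameters. *)
Definition scaled_image mu x : C := \sum_e prefactor x (flip e z) * smsym N mu (xs x) (flip e z).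

Lemma image_entire mu : entire6 (scaled_image mu).
Proof.
apply: entire6_sum => e; apply: entire6M.
  apply: entire6M; apply: entire6_prod => i; first by apply: entire6M => //; exact: entire6_cst.
  apply: entire6_prod => j; apply: entire6M; last exact: entire6_cst.
  apply: entire6B; first exact: entire6_cst.
  do 2 ?[apply: entire6M]; [exact: entire6_coord|exact: entire6_cst|exact: entire6_cst].
apply: entire6_sum => a; apply: entire6M; last exact: entire6_cst.
exact/entire6X/entire6_coord.
Qed.

Lemma imageE mu x : xs x != 0 -> (psize mu <= N)%N ->
  scaled_image mu x = xs x ^+ N * qdiff (h x) (xs x) (xt x) (msym mu) z.
Proof.
move=> s0 muN; rewrite /qdiff symmetrizeE mulr_sumr; apply: eq_bigr => e _.
by rewrite smsymE// mulrCA.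
Qed.

End Operator.

(** Clearing denominators in the identity between an operator applied to one
    family of polynomials and another family gives a function that is entire in
    each parameter; its vanishing propagates from the special parameters to all
    of them. *)
Lemma continuation (h : point -> C -> C) (cc d1 d2 : point -> C) (n1 n2 : part -> point -> C)
    (mus1 mus2 : seq part) lam lam2 z (e0 e1 e2 e3 e5 : R -> nat -> C) :
  all (sdominated lam) mus1 ->
  (forall w, entire6 (fun x => h x w)) -> entire6 cc -> entire6 d1 -> entire6 d2 ->
  (forall mu, entire6 (n1 mu)) -> (forall mu, entire6 (n2 mu)) ->
  (forall r : R, 0 < r <= 2^-1 ->
     null_seq (e0 r) /\ null_seq (e1 r) /\ null_seq (e2 r) /\ null_seq (e3 r) /\ null_seq (e5 r)) ->
  let identity x := qdiff (h x) (x (inord 4)) (x (inord 5)) (msym_family lam mus1 (fun mu => n1 mu x / d1 x)) z =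
       x (inord 4) ^- psize lam * cc x * msym_family lam2 mus2 (fun mu => n2 mu x / d2 x) z in
  (forall r : R, 0 < r <= 2^-1 -> forall a b c d k,
     let x := params (e0 r a) (e1 r b) (e2 r c) (e3 r d) r%:C (e5 r k) in
     d1 x != 0 -> d2 x != 0 -> identity x) ->
  forall x, x (inord 4) != 0 -> d1 x != 0 -> d2 x != 0 -> identity x.
Proof.
move=> /allP mus1P eh ec ed1 ed2 en1 en2 nul identity special x s0 d10 d20.
pose N := psize lam.
pose Phi x := d2 x * (d1 x * scaled_image h z N lam x + \sum_(mu <- mus1) n1 mu x * scaled_image h z N mu x)
   - d1 x * cc x * (d2 x * msym lam2 z + \sum_(mu <- mus2) n2 mu x * msym mu z).
have ePhi : entire6 Phi.
  apply: entire6B; apply: entire6M => //.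
  - apply: entire6D; first by apply: entire6M => //; exact: image_entire.
    by apply: entire6_sum => mu; apply: entire6M => //; exact: image_entire.
  - exact: entire6M.
  - apply: entire6D; first by apply: entire6M => //; exact: entire6_cst.
    by apply: entire6_sum => mu; apply: entire6M => //; exact: entire6_cst.
have PhiE y : y (inord 4) != 0 -> d1 y != 0 -> d2 y != 0 ->
   Phi y = d1 y * d2 y * (y (inord 4) ^+ N *
     qdiff (h y) (y (inord 4)) (y (inord 5)) (msym_family lam mus1 (fun mu => n1 mu y / d1 y)) z
     - cc y * msym_family lam2 mus2 (fun mu => n2 mu y / d2 y) z).
  move=> y0 y1 y2; rewrite /Phi.
  have -> : d1 y * scaled_image h z N lam y + \sum_(mu <- mus1) n1 mu y * scaled_image h z N mu y =
     d1 y * (y (inord 4) ^+ N * qdiff (h y) (y (inord 4)) (y (inord 5))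
       (msym_family lam mus1 (fun mu => n1 mu y / d1 y)) z).
    rewrite imageE// qdiff_family !mulrDr !mulr_sumr; congr (_ + _).
    rewrite [LHS]big_seq [RHS]big_seq; apply: eq_bigr => mu mumus.
    rewrite imageE//; last by apply: sdominated_psize; exact: mus1P.
    by field.
  have -> : d2 y * msym lam2 z + \sum_(mu <- mus2) n2 mu y * msym mu z =
     d2 y * msym_family lam2 mus2 (fun mu => n2 mu y / d2 y) z.
    rewrite /msym_family mulrDr mulr_sumr; congr (_ + _); apply: eq_bigr => mu _; by field.
  rewrite mulrBr; congr (_ - _); last exact: mulrACA.
  by rewrite mulrCA [LHS]mulrA.
(* Where a denominator vanishes nothing is known about [Phi], hence the factors. *)
have Psi0 y : d1 y * d2 y * Phi y = 0.
  move: y; apply: (entire6_uniqueness (entire6M (entire6M ed1 ed2) ePhi) nul) => r hr a b c d k.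
  have := special r hr a b c d k; set y := params _ _ _ _ _ _ => sp.
  have y4 : y (inord 4) = r%:C by rewrite /y /params inordK.
  have y40 : y (inord 4) != 0.
    by rewrite y4 fmorph_eq0 gt_eqF//; case/andP: hr.
  have [->|y1] := eqVneq (d1 y) 0; first by rewrite !mul0r.
  have [->|y2] := eqVneq (d2 y) 0; first by rewrite mulr0 mul0r.
  rewrite PhiE// sp// -/N !mulrA mulfV ?expf_neq0// mul1r subrr !mulr0 //.
have /eqP := Psi0 x; rewrite PhiE// !mulf_eq0 (negPf d10) (negPf d20) /= subr_eq0 => /eqP E.
by rewrite /identity -mulrA -E mulrA mulVf ?mul1r// expf_neq0.
Qed.

End Continuation.

Section Final.
Variables (R : realType) (n : nat).
Local Notation C := R[i].
Local Notation cnorm := (@normc R).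
Local Notation part := {ffun 'I_n -> nat}.
Implicit Types (lam mu : part) (z : 'I_n -> C).

Section SmallParameters.
Local Open Scope classical_set_scope.
Variable r : R.
Hypothesis hr : 0 < r <= 2^-1.
Let s : C := r%:C.
Let q : C := s ^+ 2.

Let r0 : 0 < r. Proof. by case/andP: hr. Qed.
Let r1 : r <= 2^-1. Proof. by case/andP: hr. Qed.

Let cnorm_q : cnorm q = r ^+ 2.
Proof. by rewrite cnormX cnorm_real gtr0_norm. Qed.

Let r2 : 0 < r ^+ 2 < 1.
Proof. by rewrite exprn_gt0//= expr2; have := r0; have := r1; nra. Qed.

Lemma null_geometric (c : C) : c != 0 -> null_seq (fun m => c * q ^+ m).
Proof.
move=> c0 e e0; have c1 : 0 < cnorm c.
  by rewrite lt_neqAle cnorm_ge0 andbT eq_sym; apply: contra_neq c0; exact: eq0_normc.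
have /andP[q0 q1] := r2.
have : (fun m => (r ^+ 2) ^+ m) @ \oo --> (0 : R).
  by apply: cvg_expr; rewrite ger0_norm// ltW.
move/cvgrPdist_lt => /(_ (e / cnorm c)); rewrite divr_gt0// => /(_ isT)[N0 _ /(_ N0 (leqnn _))] /=.
rewrite sub0r normrN ger0_norm ?exprn_ge0 ?ltW// => H.
exists N0; rewrite normcM cnormX cnorm_q mulr_gt0 ?exprn_gt0//=.
by rewrite mulrC -ltr_pdivlMr.
Qed.

Lemma q_neq0 : q != 0.
Proof. by rewrite expf_neq0// fmorph_eq0 gt_eqF. Qed.

Lemma s_neq0 : s != 0.
Proof. by rewrite fmorph_eq0 gt_eqF. Qed.

Lemma null_q : null_seq (fun m => q ^+ m.+1).
Proof.
move=> e e0; have [m hm] := null_geometric q_neq0 e0.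
by exists m; rewrite exprS.
Qed.

Lemma null_Nq : null_seq (fun m => - q ^+ m.+1).
Proof. by move=> e e0; have [m hm] := null_q e0; exists m; rewrite normcN. Qed.

Lemma null_sq : null_seq (fun m => s * q ^+ m).
Proof. exact: null_geometric s_neq0. Qed.

Lemma null_Nsq : null_seq (fun m => - (s * q ^+ m)).
Proof. by move=> e e0; have [m hm] := null_sq e0; exists m; rewrite normcN. Qed.

Let cnorm_lt1 (y : C) : cnorm y < 1 -> `|y| < 1.
Proof. by rewrite -cnorm_lt. Qed.

Lemma q_lt1 m : `|q ^+ m.+1| < 1.
Proof.
apply: cnorm_lt1; rewrite cnormX cnorm_q exprS; have /andP[q0 q1] := r2.
have : (r ^+ 2) ^+ m <= 1 by rewrite exprn_ile1// ltW.
have : 0 <= (r ^+ 2) ^+ m by rewrite exprn_ge0// ltW.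
nra.
Qed.

Lemma sq_lt1 m : `|s * q ^+ m| < 1.
Proof.
apply: cnorm_lt1; rewrite normcM cnormX cnorm_q cnorm_real gtr0_norm//; have /andP[q0 q1] := r2.
have : (r ^+ 2) ^+ m <= 1 by rewrite exprn_ile1// ltW.
have : 0 <= (r ^+ 2) ^+ m by rewrite exprn_ge0// ltW.
have := r0; have := r1; nra.
Qed.

End SmallParameters.

Lemma params_lt1 (t0 t1 t2 t3 q t : C) : `|t0| < 1 -> `|t1| < 1 -> `|t2| < 1 -> `|t3| < 1 ->
  `|q| < 1 -> `|t| < 1 -> forall i, `|params t0 t1 t2 t3 q t i| < 1.
Proof. by move=> h0 h1 h2 h3 h4 h5 [[|[|[|[|[|[|//]]]]]] hi]. Qed.

Lemma monic_family lam mus (c : part -> C) : all (sdominated lam) mus ->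
  monic_form lam (msym_family lam mus c).
Proof. by move=> H; exists mus, c. Qed.

(** At special parameters in the unit polydisc a Koornwinder polynomial exists and
    therefore equals the member of the family. *)
Lemma family_orthogonal r k w lam mus (N : part -> ('I_6 -> C) -> C) (D : ('I_6 -> C) -> C)
    (t0 t1 t2 t3 s q : C) :
  0 < r -> r <= 2^-1 -> s = r%:C -> s ^+ 2 = q ->
  special n k q w t0 t1 t2 t3 ->
  (forall u0 u1 u2 u3 r v : C, let p := params u0 u1 u2 u3 r v in
     (forall i, `|p i| < 1) -> D p != 0 ->
     forall L, koornwinder_torus lam u0 u1 u2 u3 r v L ->
       L =1 msym_family lam mus (fun mu => N mu p / D p)) ->
  (forall i, `|params t0 t1 t2 t3 q (q ^+ k) i| < 1) ->
  D (params t0 t1 t2 t3 q (q ^+ k)) != 0 ->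
  torus_orthogonal lam t0 t1 t2 t3 q (q ^+ k)
    (msym_family lam mus (fun mu => N mu (params t0 t1 t2 t3 q (q ^+ k)) / D (params t0 t1 t2 t3 q (q ^+ k)))).
Proof.
move=> r0 r1 sE sq sp HL lt1 D0.
have [L LK] := special_koornwinder sE sq sp lam.
have LE := HL _ _ _ _ _ _ lt1 D0 _ LK.
have -> : msym_family lam mus (fun mu => N mu (params t0 t1 t2 t3 q (q ^+ k)) / D (params t0 t1 t2 t3 q (q ^+ k))) = L.
  by apply/funext => z; rewrite LE.
by have [] := LK.
Qed.

End Final.

(** * Koornwinder polynomials at generic parameters *)

Section Main.
Variables (R : realType) (n : nat).
Local Notation C := R[i].
Local Notation part := {ffun 'I_n -> nat}.
Local Notation point := ('I_6 -> C).
Implicit Types (lam mu : part) (z : 'I_n -> C) (x : point).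

Local Notation "x .[: i ]" := (x (inord i : 'I_6)) (at level 2, format "x .[: i ]").

Lemma params_inord (a0 a1 a2 a3 a4 a5 : C) :
  (params a0 a1 a2 a3 a4 a5).[: 0] = a0 /\ (params a0 a1 a2 a3 a4 a5).[: 1] = a1 /\
  (params a0 a1 a2 a3 a4 a5).[: 2] = a2 /\ (params a0 a1 a2 a3 a4 a5).[: 3] = a3 /\
  (params a0 a1 a2 a3 a4 a5).[: 4] = a4 /\ (params a0 a1 a2 a3 a4 a5).[: 5] = a5.
Proof. by rewrite /params !inordK. Qed.

(** The flag tells whether the parameter is multiplied by the square root of [q]. *)
Definition scaled (b : bool) x (i : nat) : C := if b then x.[: 4] * x.[: i] else x.[: i].

(** The arguments of the Koornwinder polynomials as functions of the free parameters
    of an identity.  The fifth free parameter is the square root of [q]. *)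
Definition arg (b0 b1 b2 b3 : bool) x : point :=
  params (scaled b0 x 0) (scaled b1 x 1) (scaled b2 x 2) (scaled b3 x 3) (x.[: 4] * x.[: 4]) x.[: 5].

Lemma arg_entire b0 b1 b2 b3 (F : point -> C) : entire F -> entire6 (fun x => F (arg b0 b1 b2 b3 x)).
Proof.
move=> eF; have sc b i : monomial6 (fun x => scaled b x i).
  case: b; last exact: monomial6_coord.
  by apply: monomial6M; exact: monomial6_coord.
apply: entire6_entire => //; apply: monomial6_params => //; last exact: monomial6_coord.
by apply: monomial6M; exact: monomial6_coord.
Qed.

Lemma argE b0 b1 b2 b3 a0 a1 a2 a3 a4 a5 :
  arg b0 b1 b2 b3 (params a0 a1 a2 a3 a4 a5) =
  params (if b0 then a4 * a0 else a0) (if b1 then a4 * a1 else a1)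
         (if b2 then a4 * a2 else a2) (if b3 then a4 * a3 else a3) (a4 ^+ 2) a5.
Proof.
have [h0 [h1 [h2 [h3 [h4 h5]]]]] := params_inord a0 a1 a2 a3 a4 a5.
by rewrite /arg /scaled h0 h1 h2 h3 h4 h5 expr2.
Qed.

(** The eigenvalue without its power of the square root of [q]. *)
Definition factor lam (H : point -> C) x : C :=
  \prod_(i < n) (1 - (x.[: 4] ^+ 2) ^+ lam i * x.[: 5] ^+ (n - i.+1) * H x).

Lemma factor_entire lam H : entire6 H -> entire6 (factor lam H).
Proof.
move=> eH; apply: entire6_prod => i; apply: entire6B; first exact: entire6_cst.
apply: entire6M => //; apply: entire6M; apply: entire6X; last exact: entire6_coord.
exact/entire6X/entire6_coord.
Qed.

Lemma linear_entire i (w : C) : entire6 (fun x => 1 - x i * w).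
Proof.
apply: entire6B; first exact: entire6_cst.
by apply: entire6M; [exact: entire6_coord|exact: entire6_cst].
Qed.

Lemma part_pred_partition lam : is_partition lam -> is_partition (part_pred lam).
Proof.
move=> lP; apply/forallP => i; apply/forallP => j; apply/implyP => ij; rewrite !ffunE.
by have := partP lP ij; lia.
Qed.

Lemma part_succ_partition lam : is_partition lam -> is_partition (part_succ lam).
Proof.
move=> lP; apply/forallP => i; apply/forallP => j; apply/implyP => ij; rewrite !ffunE.
by have := partP lP ij; lia.
Qed.

Lemma koornwinderE lam t0 t1 t2 t3 q t K : @koornwinder R n lam t0 t1 t2 t3 q t K ->
  exists mus N D, [/\ all (sdominated lam) mus, entire D, forall mu, entire (N mu),
    forall u0 u1 u2 u3 r v : C, let p := params u0 u1 u2 u3 r v in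
     (forall i, `|p i| < 1) -> D p != 0 ->
     forall L, koornwinder_torus lam u0 u1 u2 u3 r v L ->
       L =1 msym_family lam mus (fun mu => N mu p / D p) &
    D (params t0 t1 t2 t3 q t) != 0 /\
    K = msym_family lam mus (fun mu => N mu (params t0 t1 t2 t3 q t) / D (params t0 t1 t2 t3 q t))].
Proof.
move=> [mus [N [D [musP [De Ne] fam D0 KE]]]]; exists mus, N, D; split=> //.
by split=> //; apply/funext => z; rewrite KE.
Qed.

Lemma specialA_lt1 (r : R) (hr : 0 < r <= 2^-1) a b c d k :
  let s : C := r%:C in let q := s ^+ 2 in
  forall i, `|params (q ^+ a.+1) (- q ^+ b.+1) (s * q ^+ c) (- (s * q ^+ d)) q (q ^+ k.+1) i| < 1.
Proof.
move=> s q; apply: params_lt1; rewrite ?normrN ?q_lt1 ?sq_lt1//.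
exact: (q_lt1 hr 0).
Qed.

Lemma specialB_lt1 (r : R) (hr : 0 < r <= 2^-1) a b c d k :
  let s : C := r%:C in let q := s ^+ 2 in
  forall i, `|params (s * q ^+ a) (- (s * q ^+ b)) (q ^+ c.+1) (- q ^+ d.+1) q (q ^+ k.+1) i| < 1.
Proof.
move=> s q; apply: params_lt1; rewrite ?normrN ?q_lt1 ?sq_lt1//.
exact: (q_lt1 hr 0).
Qed.

Lemma scale_sq (s : C) c : s * (s * (s ^+ 2) ^+ c) = (s ^+ 2) ^+ c.+1.
Proof. by rewrite mulrA -expr2 -exprS. Qed.

Variables (lam : part).
Hypothesis lamP : is_partition lam.

(** Together with [seq_sq], the sequences of parameters along which the density is
    a Laurent polynomial. *)
Definition seq_q (r : R) m : C := (r%:C ^+ 2) ^+ m.+1.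
Definition seq_sq (r : R) m : C := r%:C * (r%:C ^+ 2) ^+ m.

Lemma null_q_sq (r : R) : 0 < r <= 2^-1 ->
  null_seq (seq_q r) /\ null_seq (fun m => - seq_q r m) /\ null_seq (seq_sq r) /\
  null_seq (fun m => - seq_sq r m) /\ null_seq (seq_q r).
Proof.
move=> hr; do ![split]; [exact: null_q|exact: null_Nq|exact: null_sq|exact: null_Nsq|exact: null_q].
Qed.

Lemma null_q_q (r : R) : 0 < r <= 2^-1 ->
  null_seq (seq_q r) /\ null_seq (fun m => - seq_q r m) /\ null_seq (seq_q r) /\
  null_seq (fun m => - seq_q r m) /\ null_seq (seq_q r).
Proof.
move=> hr; do ![split]; [exact: null_q|exact: null_Nq|exact: null_q|exact: null_Nq|exact: null_q].
Qed.

Lemma Dminus_koornwinder (t0 t1 t2 t3 s t : C) K K' : s != 0 ->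
  (forall i, 0 < lam i)%N ->
  koornwinder lam t0 t1 t2 t3 (s ^+ 2) t K ->
  koornwinder (part_pred lam) (s * t0) (s * t1) (s * t2) (s * t3) (s ^+ 2) t K' ->
  forall z, regular z ->
    qdiff (fun w : C => w) s t K z =
    s ^- psize lam * (\prod_(i < n) (1 - (s ^+ 2) ^+ lam i * t ^+ (n - i.+1) * 1)) * K' z.
Proof.
move=> s0 lam0 /koornwinderE[mus [N [D [musP De Ne fam [D0 KE]]]]].
move=> /koornwinderE[mus' [N' [D' [musP' De' Ne' fam' [D0' KE']]]]] z rz.
pose p1 := arg false false false false; pose p2 := arg true true true true.
pose x := params t0 t1 t2 t3 s t.
have [_ [_ [_ [_ [E4 E5]]]]] := params_inord t0 t1 t2 t3 s t.
suff : qdiff (fun w : C => w) x.[: 4] x.[: 5] (msym_family lam mus (fun mu => N mu (p1 x) / D (p1 x))) z =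
    x.[: 4] ^- psize lam * factor lam (fun=> 1) x *
      msym_family (part_pred lam) mus' (fun mu => N' mu (p2 x) / D' (p2 x)) z.
  by rewrite /p1 /p2 /x !argE /factor E4 E5 -KE -KE'.
apply: (@continuation R n (fun _ w => w) (factor lam (fun=> 1)) (fun x => D (p1 x)) (fun x => D' (p2 x))
  (fun mu x => N mu (p1 x)) (fun mu x => N' mu (p2 x)) mus mus' lam (part_pred lam) z
  seq_q (fun r m => - seq_q r m) seq_sq (fun r m => - seq_sq r m) seq_q musP _ _ _ _ _ _ null_q_sq).
- by move=> w; exact: entire6_cst.
- exact/factor_entire/entire6_cst.
- exact: (arg_entire _ _ _ _ De).
- exact: (arg_entire _ _ _ _ De').
- by move=> mu; exact: (arg_entire _ _ _ _ (Ne mu)).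
- by move=> mu; exact: (arg_entire _ _ _ _ (Ne' mu)).
- move=> r hr a b c d k; have /andP[r0 r1] := hr.
  have [_ [_ [_ [_ [e4 e5]]]]] := params_inord (seq_q r a) (- seq_q r b) (seq_sq r c) (- seq_sq r d) r%:C (seq_q r k).
  rewrite /p1 /p2 !argE /factor e4 e5 /seq_q /seq_sq !mulrN !scale_sq => d10 d20.
  apply: (@special_minus R n r k.+1 r0 r1 _ _ erefl erefl a b c d (ltn0Sn _) lam lamP) => //.
  + exact: monic_family.
  + apply: (family_orthogonal r0 r1 erefl erefl _ fam _ d10); last exact: specialA_lt1.
    exact: (@specialA R n r k.+1 r0 r1 _ _ erefl erefl).
  + exact: part_pred_partition.
  + exact: monic_family.
  + apply: (family_orthogonal r0 r1 erefl erefl _ fam' _ d20); last exact: specialB_lt1.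
    exact: (@specialB R n r k.+1 r0 r1 _ _ erefl erefl).
- by rewrite /x E4.
- by rewrite /p1 /x argE.
- by rewrite /p2 /x argE.
Qed.

Lemma Dminus_koornwinder0 (t0 t1 t2 t3 s t : C) K : s != 0 ->
  (exists i, lam i = 0%N) ->
  koornwinder lam t0 t1 t2 t3 (s ^+ 2) t K ->
  forall z, regular z -> qdiff (fun w : C => w) s t K z = 0.
Proof.
move=> s0 lam0 /koornwinderE[mus [N [D [musP De Ne fam [D0 KE]]]]] z rz.
pose p1 := arg false false false false; pose x := params t0 t1 t2 t3 s t.
have [_ [_ [_ [_ [E4 E5]]]]] := params_inord t0 t1 t2 t3 s t.
suff : qdiff (fun w : C => w) x.[: 4] x.[: 5] (msym_family lam mus (fun mu => N mu (p1 x) / D (p1 x))) z =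
    x.[: 4] ^- psize lam * 0 * msym_family lam [::] (fun mu => 0 / 1) z.
  by rewrite /p1 /x !argE E4 E5 -KE mulr0 mul0r.
apply: (@continuation R n (fun _ w => w) (fun=> 0) (fun x => D (p1 x)) (fun=> 1)
  (fun mu x => N mu (p1 x)) (fun mu x => 0) mus [::] lam lam z
  seq_q (fun r m => - seq_q r m) seq_sq (fun r m => - seq_sq r m) seq_q musP _ _ _ _ _ _ null_q_sq).
- by move=> w; exact: entire6_cst.
- exact: entire6_cst.
- exact: (arg_entire _ _ _ _ De).
- exact: entire6_cst.
- by move=> mu; exact: (arg_entire _ _ _ _ (Ne mu)).
- by move=> mu; exact: entire6_cst.
- move=> r hr a b c d k; have /andP[r0 r1] := hr.
  have [_ [_ [_ [_ [e4 e5]]]]] := params_inord (seq_q r a) (- seq_q r b) (seq_sq r c) (- seq_sq r d) r%:C (seq_q r k).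
  rewrite /p1 !argE e4 e5 /seq_q /seq_sq mulr0 mul0r => d10 _.
  apply: (@special_minus0 R n r k.+1 r0 r1 _ _ erefl erefl a b c d (ltn0Sn _) lam lamP) => //.
  + exact: monic_family.
  + apply: (family_orthogonal r0 r1 erefl erefl _ fam _ d10); last exact: specialA_lt1.
    exact: (@specialA R n r k.+1 r0 r1 _ _ erefl erefl).
- by rewrite /x E4.
- by rewrite /p1 /x argE.
- exact: oner_neq0.
Qed.

Lemma Dzero_koornwinder (t0 t1 t2 t3 s t : C) K K' : s != 0 ->
  koornwinder lam (s * t0) (s * t1) t2 t3 (s ^+ 2) t K ->
  koornwinder lam t0 t1 (s * t2) (s * t3) (s ^+ 2) t K' ->
  forall z, regular z ->
    qdiff (fun w : C => (1 - t0 * w) * (1 - t1 * w)) s t K z =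
    s ^- psize lam * (\prod_(i < n) (1 - (s ^+ 2) ^+ lam i * t ^+ (n - i.+1) * (t0 * t1))) * K' z.
Proof.
move=> s0 /koornwinderE[mus [N [D [musP De Ne fam [D0 KE]]]]].
move=> /koornwinderE[mus' [N' [D' [musP' De' Ne' fam' [D0' KE']]]]] z rz.
pose p1 := arg true true false false; pose p2 := arg false false true true.
pose x := params t0 t1 t2 t3 s t.
pose h (y : point) (w : C) := (1 - y.[: 0] * w) * (1 - y.[: 1] * w).
pose H (y : point) := y.[: 0] * y.[: 1].
have [E0 [E1 [_ [_ [E4 E5]]]]] := params_inord t0 t1 t2 t3 s t.
suff : qdiff (h x) x.[: 4] x.[: 5] (msym_family lam mus (fun mu => N mu (p1 x) / D (p1 x))) z =
    x.[: 4] ^- psize lam * factor lam H x *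
      msym_family lam mus' (fun mu => N' mu (p2 x) / D' (p2 x)) z.
  by rewrite /p1 /p2 /x /h /H !argE /factor E0 E1 E4 E5 -KE -KE'.
apply: (@continuation R n h (factor lam H) (fun x => D (p1 x)) (fun x => D' (p2 x))
  (fun mu x => N mu (p1 x)) (fun mu x => N' mu (p2 x)) mus mus' lam lam z
  seq_q (fun r m => - seq_q r m) seq_q (fun r m => - seq_q r m) seq_q musP _ _ _ _ _ _ null_q_q).
- by move=> w; apply: entire6M; exact: linear_entire.
- by apply: factor_entire; apply: entire6M; exact: entire6_coord.
- exact: (arg_entire _ _ _ _ De).
- exact: (arg_entire _ _ _ _ De').
- by move=> mu; exact: (arg_entire _ _ _ _ (Ne mu)).
- by move=> mu; exact: (arg_entire _ _ _ _ (Ne' mu)).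
- move=> r hr a b c d k; have /andP[r0 r1] := hr.
  have [e0 [e1 [_ [_ [e4 e5]]]]] := params_inord (seq_q r a) (- seq_q r b) (seq_q r c) (- seq_q r d) r%:C (seq_q r k).
  rewrite /p1 /p2 /h /H !argE /factor e0 e1 e4 e5 /seq_q => d10 d20.
  rewrite [r%:C * - (r%:C ^+ 2) ^+ b.+1]mulrN in d10 *.
  rewrite [r%:C * - (r%:C ^+ 2) ^+ d.+1]mulrN in d20 *.
  apply: (@special_zero R n r k.+1 r0 r1 _ _ erefl erefl a b c d (ltn0Sn _) lam lamP) => //.
  + exact: monic_family.
  + apply: (family_orthogonal r0 r1 erefl erefl _ fam _ d10); last exact: specialB_lt1.
    exact: (@specialB R n r k.+1 r0 r1 _ _ erefl erefl).
  + exact: monic_family.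
  + apply: (family_orthogonal r0 r1 erefl erefl _ fam' _ d20); last exact: specialA_lt1.
    exact: (@specialA R n r k.+1 r0 r1 _ _ erefl erefl).
- by rewrite /x E4.
- by rewrite /p1 /x argE.
- by rewrite /p2 /x argE.
Qed.

Lemma Dplus_koornwinder (t0 t1 t2 t3 s t : C) K K' : s != 0 ->
  koornwinder lam (s * t0) (s * t1) (s * t2) (s * t3) (s ^+ 2) t K ->
  koornwinder (part_succ lam) t0 t1 t2 t3 (s ^+ 2) t K' ->
  forall z, regular z ->
    qdiff (fun w : C => (1 - t0 * w) * (1 - t1 * w) * (1 - t2 * w) * (1 - t3 * w) / w) s t K z =
    s ^- psize lam * (\prod_(i < n) (1 - (s ^+ 2) ^+ lam i * t ^+ (n - i.+1) * (t0 * t1 * t2 * t3))) * K' z.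
Proof.
move=> s0 /koornwinderE[mus [N [D [musP De Ne fam [D0 KE]]]]].
move=> /koornwinderE[mus' [N' [D' [musP' De' Ne' fam' [D0' KE']]]]] z rz.
pose p1 := arg true true true true; pose p2 := arg false false false false.
pose x := params t0 t1 t2 t3 s t.
pose h (y : point) (w : C) := (1 - y.[: 0] * w) * (1 - y.[: 1] * w) * (1 - y.[: 2] * w) * (1 - y.[: 3] * w) / w.
pose H (y : point) := y.[: 0] * y.[: 1] * y.[: 2] * y.[: 3].
have [E0 [E1 [E2 [E3 [E4 E5]]]]] := params_inord t0 t1 t2 t3 s t.
suff : qdiff (h x) x.[: 4] x.[: 5] (msym_family lam mus (fun mu => N mu (p1 x) / D (p1 x))) z =
    x.[: 4] ^- psize lam * factor lam H x *
      msym_family (part_succ lam) mus' (fun mu => N' mu (p2 x) / D' (p2 x)) z.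
  by rewrite /p1 /p2 /x /h /H !argE /factor E0 E1 E2 E3 E4 E5 -KE -KE'.
apply: (@continuation R n h (factor lam H) (fun x => D (p1 x)) (fun x => D' (p2 x))
  (fun mu x => N mu (p1 x)) (fun mu x => N' mu (p2 x)) mus mus' lam (part_succ lam) z
  seq_q (fun r m => - seq_q r m) seq_sq (fun r m => - seq_sq r m) seq_q musP _ _ _ _ _ _ null_q_sq).
- by move=> w; do 4 ?[apply: entire6M]; try exact: linear_entire; exact: entire6_cst.
- by apply: factor_entire; do 3 ?[apply: entire6M]; exact: entire6_coord.
- exact: (arg_entire _ _ _ _ De).
- exact: (arg_entire _ _ _ _ De').
- by move=> mu; exact: (arg_entire _ _ _ _ (Ne mu)).
- by move=> mu; exact: (arg_entire _ _ _ _ (Ne' mu)).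
- move=> r hr a b c d k; have /andP[r0 r1] := hr.
  have [e0 [e1 [e2 [e3 [e4 e5]]]]] := params_inord (seq_q r a) (- seq_q r b) (seq_sq r c) (- seq_sq r d) r%:C (seq_q r k).
  rewrite /p1 /p2 /h /H !argE /factor e0 e1 e2 e3 e4 e5 /seq_q /seq_sq => d10 d20.
  rewrite [r%:C * - (r%:C ^+ 2) ^+ b.+1]mulrN [r%:C * - (r%:C * _)]mulrN !scale_sq in d10 *.
  apply: (@special_plus R n r k.+1 r0 r1 _ _ erefl erefl a b c d (ltn0Sn _) lam lamP) => //.
  + exact: monic_family.
  + apply: (family_orthogonal r0 r1 erefl erefl _ fam _ d10); last exact: specialB_lt1.
    exact: (@specialB R n r k.+1 r0 r1 _ _ erefl erefl).
  + exact: part_succ_partition.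
  + exact: monic_family.
  + apply: (family_orthogonal r0 r1 erefl erefl _ fam' _ d20); last exact: specialA_lt1.
    exact: (@specialA R n r k.+1 r0 r1 _ _ erefl erefl).
- by rewrite /x E4.
- by rewrite /p1 /x argE.
- by rewrite /p2 /x argE.
Qed.

End Main.

Theorem corollary2p4 (R : realType) (n : nat) (lam : {ffun 'I_n -> nat})
    (t0 t1 t2 t3 q s t : R[i])
    (n_ge1 : (1 <= n)%N) (lam_part : is_partition lam)
    (q_neq0 : q != 0) (sqrt_q : s ^+ 2 = q) :
  [/\ forall K K' : ('I_n -> R[i]) -> R[i],
        (forall i, 0 < lam i)%N ->
        koornwinder lam (s^-1 * t0) (s^-1 * t1) (s^-1 * t2) (s^-1 * t3) q t K ->
        koornwinder (part_pred lam) t0 t1 t2 t3 q t K' ->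
        forall z, regular z ->
          Dminus s t K z =
          s ^- psize lam
            * (\prod_(i < n) (1 - q ^+ lam i * t ^+ (n - i.+1))) * K' z,
      forall K : ('I_n -> R[i]) -> R[i],
        (exists i, lam i = 0%N) ->
        koornwinder lam (s^-1 * t0) (s^-1 * t1) (s^-1 * t2) (s^-1 * t3) q t K ->
        forall z, regular z -> Dminus s t K z = 0,
      forall K K' : ('I_n -> R[i]) -> R[i],
        koornwinder lam (s * t0) (s * t1) (s^-1 * t2) (s^-1 * t3) q t K ->
        koornwinder lam t0 t1 t2 t3 q t K' ->
        forall z, regular z ->
          Dzero s t0 t1 t K z =
          s ^- psize lam
            * (\prod_(i < n) (1 - q ^+ lam i * t ^+ (n - i.+1) * t0 * t1))
            * K' z
    & forall K K' : ('I_n -> R[i]) -> R[i],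
        koornwinder lam (s * t0) (s * t1) (s * t2) (s * t3) q t K ->
        koornwinder (part_succ lam) t0 t1 t2 t3 q t K' ->
        forall z, regular z ->
          Dplus s t0 t1 t2 t3 t K z =
          s ^- psize lam
            * (\prod_(i < n)
                 (1 - q ^+ lam i * t ^+ (n - i.+1) * t0 * t1 * t2 * t3))
            * K' z].
Proof.
have s0 : s != 0 by apply: contraNneq q_neq0 => s0; rewrite -sqrt_q s0 expr0n.
subst q.
have scale (u : R[i]) : s * (s^-1 * u) = u by rewrite mulrA mulfV// mul1r.
split.
- move=> K K' lam0 HK HK' z rz.
  rewrite -(scale t0) -(scale t1) -(scale t2) -(scale t3) in HK'.
  have -> : Dminus s t K z = _ := Dminus_koornwinder lam_part s0 lam0 HK HK' rz.
  congr (_ * _ * _).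
  by apply: eq_bigr => i _; rewrite mulr1.
- by move=> K lam0 HK z rz; exact: (Dminus_koornwinder0 lam_part s0 lam0 HK rz).
- move=> K K' HK HK' z rz.
  rewrite -(scale t2) -(scale t3) in HK'.
  have -> : Dzero s t0 t1 t K z = _ := Dzero_koornwinder lam_part s0 HK HK' rz.
  congr (_ * _ * _).
  by apply: eq_bigr => i _; rewrite !mulrA.
- move=> K K' HK HK' z rz.
  have -> : Dplus s t0 t1 t2 t3 t K z =
      qdiff (fun w => (1 - t0 * w) * (1 - t1 * w) * (1 - t2 * w) * (1 - t3 * w) / w) s t K z.
    rewrite /Dplus /qdiff; congr symmetrize; apply/funext => w.
    congr (_ * _ * _); apply: eq_bigr => i _.
    by rewrite invfM mulrA.
  rewrite (Dplus_koornwinder lam_part s0 HK HK' rz); congr (_ * _ * _).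
  by apply: eq_bigr => i _; rewrite !mulrA.
Qed.
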